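(* Let $m_1,m_2,K$ be integers with $2\le K\le m_1\wedge m_2$, let $M$ be a deterministic $m_1\times m_2$ matrix with non-negative entries, and suppose we observe $Y=M+\mathcal{E}$ where the noise $\mathcal{E}$ satisfies Assumption (Noise). Let the densities $h$ and $f$ on $\mathbb{R}_+$ satisfy Assumption (Prior-h) with constants $\alpha,\beta,\delta$ and Assumption (Prior-f) with density $\widetilde f$ and constant $\mathcal{C}_f$, respectively. Fix $\lambda=1/4$ and let $\widehat{M}_\lambda$ be the quasi-posterior mean. (All assumptions and objects are defined in the context.) Then $$\mathbb{E}\left(\|\widehat{M}_{\lambda}-M\|_F^2\right)\le \inf_{1\le r\le K}\ \inf_{(U^0,V^0)\in\mathcal{M}_r}\Bigl\{\|U^0V^{0\top}-M\|_F^2+\mathcal{R}(r,U^0,V^0)\Bigr\},$$ where, with $B:=1+\|U^0\|_F+\|V^0\|_F+2\|U^0V^{0\top}-M\|_F$, \begin{align*} \mathcal{R}(r,U^0,V^0)={}&8(m_1\vee m_2)r\log\left(\sqrt{2(m_1\vee m_2)r}\right)+8(m_1\vee m_2)r\log\left(\frac{B^2}{\mathcal{C}_f}\right)\\ &+4\sum_{\substack{1\le i\le m_1\\1\le\ell\le r}}\log\left(\frac{1}{\widetilde f(U^0_{i,\ell}+1)}\right)+4\sum_{\substack{1\le j\le m_2\\1\le\ell\le r}}\log\left(\frac{1}{\widetilde f(V^0_{j,\ell}+1)}\right)\\ &+4\beta K\log\left(B^2\right)+4\beta K\log\left(2S_f\sqrt{2K(m_1\vee m_2)}\right)\\ &+4r\log\left(\frac1\delta\right)+4K\log\left(\frac1\alpha\right)+4\log(4)+1.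 \end{align*}
   Context: Notation: $a\vee b=\max(a,b)$, $a\wedge b=\min(a,b)$; $\|A\|_F$ is the Frobenius norm; $\log(1/0)=+\infty$. Assumption (Noise): the entries $\mathcal{E}_{i,j}$ of the random $m_1\times m_2$ matrix $\mathcal{E}$ are i.i.d. with $\mathbb{E}(\mathcal{E}_{i,j})=0$. With $m(x)=-\mathbb{E}[\mathcal{E}_{i,j}\mathbf{1}_{(\mathcal{E}_{i,j}\le x)}]$ and $F(x)=\mathbb{P}(\mathcal{E}_{i,j}\le x)$, there exists a non-negative bounded function $g$ with $\|g\|_\infty\le1$ such that $\int_u^v m(x)\,dx=\int_u^v g(x)\,dF(x)$ for all real $u\le v$. Prior: $f$ is a probability density with respect to the Lebesgue measure on $\mathbb{R}_+$ with $S_f:=1\vee\int_0^\infty x^2f(x)\,dx<+\infty$. For $a,x>0$ let $g_a(x)=\frac1a f(x/a)$. $h$ is a probability density on $\mathbb{R}_+$. The prior $\pi$ on triples $(U,V,\gamma)$, where $U$ is $m_1\times K$ and $V$ is $m_2\times K$ with non-negative entries and $\gamma\in\mathbb{R}_+^K$, has density $$\pi(U,V,\gamma)=\prod_{\ell=1}^K\Bigl(\prod_{i=1}^{m_1}g_{\gamma_\ell}(U_{i,\ell})\Bigr)\Bigl(\prod_{j=1}^{m_2}g_{\gamma_\ell}(V_{j,\ell})\Bigr)h(\gamma_\ell).$$ Assumption (Prior-h): $0<\alpha<1$, $\beta\ge0$, $\delta>0$ are constants such that for any $0<\varepsilon\le\frac{1}{2\sqrt2S_f}$, $\int_0^\varepsilon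 h(x)\,dx\ge\alpha\varepsilon^\beta$, and $\int_1^2h(x)\,dx\ge\delta$. Assumption (Prior-f): $\widetilde f$ is a non-increasing probability density with respect to the Lebesgue measure on $\mathbb{R}_+$ and $\mathcal{C}_f>0$ is a constant such that $f(x)\ge\mathcal{C}_f\widetilde f(x)$ for any $x>0$. Quasi-posterior and estimator: for $\lambda>0$, $$\widehat\rho_\lambda(U,V,\gamma)=\frac1Z\exp\left[-\lambda\|Y-UV^\top\|_F^2\right]\pi(U,V,\gamma),\quad Z=\int\exp\left[-\lambda\|Y-UV^\top\|_F^2\right]\pi(U,V,\gamma)\,d(U,V,\gamma),$$ and $\widehat{M}_\lambda=\int UV^\top\,\widehat\rho_\lambda(U,V,\gamma)\,d(U,V,\gamma)$. For $r\in\{1,\dots,K\}$, $\mathcal{M}_r$ is the set of pairs $(U^0,V^0)$ of matrices with non-negative entries, $U^0$ of size $m_1\times K$ and $V^0$ of size $m_2\times K$, whose columns with index $\ell>r$ are all zero. *)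

(* Defs.v *)
From HB Require Import structures.
From mathcomp Require Import all_boot all_order all_algebra.
From mathcomp Require Import all_classical all_reals all_analysis.

Set Implicit Arguments.
Unset Strict Implicit.
Unset Printing Implicit Defensive.

Import Order.TTheory GRing.Theory Num.Theory.
Import numFieldNormedType.Exports.

Local Open Scope classical_set_scope.
Local Open Scope ring_scope.

(** * Finite powers of a sigma-finite measure

    The library has the product [mu \x nu] of two measures and a measurable
    structure on [n.-tuple T], but no measure on the latter. *)

Section pushforward_tuple_cons.
Context d (T : measurableType d) (R : realType) (n : nat).
Context (mu : {sigma_finite_measure set T -> \bar R})
        (nu : {sigma_finite_measure set (n.-tuple T) -> \bar R}).

Definition tuple_cons (p : T * n.-tuple T) : n.+1.-tuple T :=
  [tuple of p.1 :: p.2].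

Lemma measurable_tuple_cons : measurable_fun [set: T * n.-tuple T] tuple_cons.
Proof. exact: measurable_cons. Qed.

Definition cons_measure (A : set (n.+1.-tuple T)) : \bar R :=
  pushforward (mu \x nu)%E tuple_cons A.

Let cons_measure0 : cons_measure set0 = 0%E.
Proof. by rewrite /cons_measure /pushforward preimage_set0 measure0. Qed.

Let cons_measure_ge0 A : (0 <= cons_measure A)%E.
Proof. by rewrite /cons_measure /pushforward; exact: measure_ge0. Qed.

Let cons_measure_sigma_additive : semi_sigma_additive cons_measure.
Proof.
move=> F mF tF mUF; rewrite /cons_measure /pushforward preimage_bigcup.
apply: measure_semi_sigma_additive.
- by move=> k; rewrite -[X in measurable X]setTI; exact: measurable_tuple_cons.
- apply/trivIsetP => /= i j _ _ ij; rewrite -preimage_setI.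
  by move/trivIsetP : tF => /(_ _ _ _ _ ij) ->//; rewrite preimage_set0.
- rewrite -preimage_bigcup -[X in measurable X]setTI.
  exact: measurable_tuple_cons.
Qed.

HB.instance Definition _ := isMeasure.Build _ _ _ cons_measure
  cons_measure0 cons_measure_ge0 cons_measure_sigma_additive.

(** Proved from scratch: canonical inference finds the subprobability instance
    of [mu \x nu] before the sigma-finite one. *)
Let cons_measure_sigma_finite : sigma_finite setT cons_measure.
Proof.
have /sigma_finiteP[F [TF ndF Foo]] := sigma_finiteT mu.
have /sigma_finiteP[G [TG ndG Goo]] := sigma_finiteT nu.
pose uncons (t : n.+1.-tuple T) : T * n.-tuple T :=
  (thead t, [tuple of behead t]).
have consK : cancel tuple_cons uncons.
  by case=> x t; rewrite /uncons/= theadE; congr pair; exact: val_inj.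
have muncons : measurable_fun setT uncons.
  apply/measurable_fun_pair; first exact: measurable_tnth.
  exact: measurable_behead.
have FGT : \bigcup_k (F k `*` G k) = setT.
  rewrite -setXTT TF TG predeqE => -[x y]; split.
    by move=> [k _ []/= ? ?]; split; exists k.
  move=> [/= [i _ Fix] [j _ Gjy]]; exists (maxn i j) => //; split.
  - by move: x Fix; exact/subsetPset/ndF/leq_maxl.
  - by move: y Gjy; exact/subsetPset/ndG/leq_maxr.
exists (fun k => uncons @^-1` (F k `*` G k)).
  by rewrite -preimage_bigcup FGT preimage_setT.
move=> k; have [mF Fk] := Foo k; have [mG Gk] := Goo k; split.
  by rewrite -[X in measurable X]setTI; apply: muncons => //; exact: measurableX.
rewrite /cons_measure /pushforward -comp_preimage.
have -> : uncons \o tuple_cons = id by apply/funext => p /=; rewrite consK.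
by rewrite preimage_id product_measure1E// lte_mul_pinfty// ge0_fin_numE.
Qed.

HB.instance Definition _ := Measure_isSigmaFinite.Build _ _ _ cons_measure
  cons_measure_sigma_finite.

End pushforward_tuple_cons.

Fixpoint power_measure d (T : measurableType d) (R : realType)
    (mu : {sigma_finite_measure set T -> \bar R}) (n : nat) :
    {sigma_finite_measure set (n.-tuple T) -> \bar R} :=
  match n with
  | 0 => dirac [tuple]
  | k.+1 => cons_measure mu (power_measure mu k)
  end.

(** * Matrices *)

Definition frob (R : realType) (m n : nat) (A : 'M[R]_(m, n)) : R :=
  Num.sqrt (\sum_i \sum_j A i j ^+ 2).

Definition nonneg_mx (R : realType) (m n : nat) (A : 'M[R]_(m, n)) : Prop :=
  forall i j, 0 <= A i j.

(** Ordinals start at 0, so the columns of rank greater than [r] are those of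
    index [l] with [r <= l]. *)
Definition nonneg_factors (R : realType) (m1 m2 K r : nat) :
    set ('M[R]_(m1, K) * 'M[R]_(m2, K)) :=
  [set UV | [/\ nonneg_mx UV.1, nonneg_mx UV.2,
    (forall i (l : 'I_K), (r <= l)%N -> UV.1 i l = 0) &
    (forall j (l : 'I_K), (r <= l)%N -> UV.2 j l = 0)]].

(** * Noise *)

Section noise.
Context d (T : measurableType d) (R : realType) (P : probability T R).
Local Open Scope ereal_scope.

Definition mutually_independent (I : finType) (X : I -> {RV P >-> R}) : Prop :=
  forall (J : {set I}) (A : I -> set R), (forall i, measurable (A i)) ->
    P (\bigcap_(i in [set` J]) (X i @^-1` A i)) =
    \prod_(i in J) P (X i @^-1` A i).

Definition identically_distributed (I : finType) (X : I -> {RV P >-> R}) :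
    Prop :=
  forall i j (A : set R), measurable A ->
    distribution P (X i) A = distribution P (X j) A.

Definition neg_truncated_mean (X : {RV P >-> R}) (x : R) : \bar R :=
  - 'E_P[fun w => (X w * \1_[set w | (X w <= x)%R] w)%R].

(** The Stieltjes integral of [g] against [dF], with [F] the cumulative
    distribution function of [X], is the integral over the half-open interval
    against the distribution of [X]. *)
Definition noise_assumption (m1 m2 : nat) (E : 'I_m1 -> 'I_m2 -> {RV P >-> R}) :
    Prop :=
  let X (ij : 'I_m1 * 'I_m2) : {RV P >-> R} := E ij.1 ij.2 in
  [/\ mutually_independent X,
      identically_distributed X,
      (forall i j, P.-integrable setT (EFin \o E i j) /\ 'E_P[E i j] = 0) &
      exists g : R -> R,
        [/\ measurable_fun setT g, (forall x, (0 <= g x <= 1)%R) &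
            forall i j (u v : R), (u <= v)%R ->
              \int[lebesgue_measure]_(x in `[u, v]) neg_truncated_mean (E i j) x
              = \int[distribution P (E i j)]_(x in `]u, v]) (g x)%:E]].

End noise.

(** * Prior *)

Section prior.
Context (R : realType).
Implicit Types (f h ftilde : R -> R).

(** Only the values of [f] on the half-line matter. *)
Definition is_density f : Prop :=
  [/\ measurable_fun (`[0, +oo[%classic : set R) f, (forall x, 0 <= x -> 0 <= f x) &
      (\int[lebesgue_measure]_(x in `[0%R, +oo[) (f x)%:E = 1)%E].

Definition second_moment f : \bar R :=
  (\int[lebesgue_measure]_(x in `[0%R, +oo[) (x ^+ 2 * f x)%:E)%E.

(** Meaningful when [second_moment f < +oo]. *)
Definition S_ f : R := Num.max 1 (fine (second_moment f)).

Definition prior_h_assumption f h (alpha beta delta : R) : Prop :=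
  [/\ 0 < alpha < 1, 0 <= beta, 0 < delta,
      (forall eps, 0 < eps <= (2 * Num.sqrt 2 * S_ f)^-1 ->
        ((alpha * eps `^ beta)%:E <=
          \int[lebesgue_measure]_(x in `[0%R, eps]) (h x)%:E)%E) &
      (delta%:E <= \int[lebesgue_measure]_(x in `[1%R, 2%R]) (h x)%:E)%E].

(** Monotonicity is required on the open half-line only, so that [ftilde] may
    be unbounded near 0. *)
Definition prior_f_assumption f ftilde (Cf : R) : Prop :=
  [/\ is_density ftilde,
      (forall x y, 0 < x -> x <= y -> ftilde y <= ftilde x),
      0 < Cf & forall x, 0 < x -> Cf * ftilde x <= f x].

Definition gscale f (a x : R) : R := a^-1 * f (x / a).

(** At [gamma l = 0], a null event, [gscale] takes the junk value 0. *)
Definition prior_density f h (m1 m2 K : nat)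
    (U : 'M[R]_(m1, K)) (V : 'M[R]_(m2, K)) (gamma : K.-tuple R) : R :=
  \prod_(l < K) ((\prod_(i < m1) gscale f (tnth gamma l) (U i l)) *
                 (\prod_(j < m2) gscale f (tnth gamma l) (V j l)) *
                 h (tnth gamma l)).

End prior.

(** * Quasi-posterior mean

    An m x n matrix variable of integration is an m-tuple of rows, so that the
    tuple sigma-algebra and the Lebesgue power measure apply. *)

Section quasi_posterior.
Context (R : realType) (f h : R -> R) (m1 m2 K : nat).

Definition mx_of_rows (m n : nat) (t : m.-tuple (n.-tuple (measurableTypeR R))) :
    'M[R]_(m, n) :=
  \matrix_(i < m, j < n) tnth (tnth t i) j.

Definition lebesgue_rv (n : nat) :
    {sigma_finite_measure set (n.-tuple (measurableTypeR R)) -> \bar R} :=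
  power_measure (@lebesgue_measure R) n.

Definition lebesgue_mx (m n : nat) :
    {sigma_finite_measure set (m.-tuple (n.-tuple (measurableTypeR R))) ->
                          \bar R} :=
  power_measure (lebesgue_rv n) m.

Definition param : Type :=
  (m1.-tuple (K.-tuple (measurableTypeR R)) *
   m2.-tuple (K.-tuple (measurableTypeR R)) *
   K.-tuple (measurableTypeR R))%type.

Definition Upart (x : param) : 'M[R]_(m1, K) := mx_of_rows x.1.1.
Definition Vpart (x : param) : 'M[R]_(m2, K) := mx_of_rows x.1.2.
Definition gpart (x : param) : K.-tuple R := x.2.

Definition nonneg_param : set param :=
  [set x | [/\ nonneg_mx (Upart x), nonneg_mx (Vpart x) &
               forall l, 0 <= tnth (gpart x) l]].

Definition lebesgue_param : {measure set param -> \bar R} :=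
  (lebesgue_mx m1 K \x lebesgue_mx m2 K \x lebesgue_rv K)%E.

Definition quasi_weight (lambda : R) (Y : 'M[R]_(m1, m2)) (x : param) : R :=
  expR (- lambda * frob (Y - Upart x *m (Vpart x)^T) ^+ 2) *
  prior_density f h (Upart x) (Vpart x) (gpart x).

Definition partition_function (lambda : R) (Y : 'M[R]_(m1, m2)) : R :=
  \int[lebesgue_param]_(x in nonneg_param) quasi_weight lambda Y x.

Definition quasi_posterior (lambda : R) (Y : 'M[R]_(m1, m2)) (x : param) : R :=
  (partition_function lambda Y)^-1 * quasi_weight lambda Y x.

Definition Mhat (lambda : R) (Y : 'M[R]_(m1, m2)) : 'M[R]_(m1, m2) :=
  \matrix_(i, j) \int[lebesgue_param]_(x in nonneg_param)
    ((Upart x *m (Vpart x)^T) i j * quasi_posterior lambda Y x).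

End quasi_posterior.

(** * Remainder term *)

Section remainder.
Context (R : realType) (f ftilde : R -> R) (alpha beta delta Cf : R).
Context (m1 m2 K : nat) (M : 'M[R]_(m1, m2)).

(** [log_inv 0 = +oo], since [0^-1 = +oo] in the extended reals. *)
Definition log_inv (y : R) : \bar R := lne (y%:E^-1)%E.

Definition Bconst (U0 : 'M[R]_(m1, K)) (V0 : 'M[R]_(m2, K)) : R :=
  1 + frob U0 + frob V0 + 2 * frob (U0 *m V0^T - M).

Definition remainder (r : nat) (U0 : 'M[R]_(m1, K)) (V0 : 'M[R]_(m2, K)) :
    \bar R :=
  let mm : R := (maxn m1 m2)%:R in
  let B := Bconst U0 V0 in
  ((8 * mm * r%:R * ln (Num.sqrt (2 * mm * r%:R)))%:E
   + (8 * mm * r%:R * ln (B ^+ 2 / Cf))%:E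
   + 4%:E * (\sum_(i < m1) \sum_(l < K | (l < r)%N)
                log_inv (ftilde (U0 i l + 1)%R))
   + 4%:E * (\sum_(j < m2) \sum_(l < K | (l < r)%N)
                log_inv (ftilde (V0 j l + 1)%R))
   + (4 * beta * K%:R * ln (B ^+ 2))%:E
   + (4 * beta * K%:R * ln (2 * S_ f * Num.sqrt (2 * K%:R * mm)))%:E
   + (4 * r%:R * ln (1 / delta))%:E
   + (4 * K%:R * ln (1 / alpha))%:E
   + (4 * ln 4)%:E + 1)%E.

End remainder.

(* Main.v *)
(** For [lambda = 1/4] the quasi-posterior mean is an exponentially weighted
    aggregate of the matrices [U V^T]. After subtracting [M] the truth is 0 and
    the observation is the noise itself. Stating the noise assumption as
    [E (X psi(X)) = E (g(X) psi'(X))] and using [g <= 1] gives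
    [E (X psi(X)) <= E (psi'(X))] for every non-decreasing [psi]. By independence
    this applies to each coordinate of the posterior mean with the other
    coordinates frozen; its derivative is half the posterior variance, which
    bounds the risk by the expected posterior average of the squared residual
    minus that of the noise. The Gibbs variational principle then bounds this
    average by [4 ln C + \int |U V^T - M|^2 q] for any probability density
    [q <= C * prior].

    The comparison density [q] makes the entries of the first [r] columns uniform
    on boxes of width [c] above those of [U0] and [V0], with scales conditioned to
    [1, 2], and keeps the prior for the other columns, with scales conditioned to
    be at most [eps]. Taking [c] and [eps] proportional to [1/B^2] makes the
    integral at most [|U0 V0^T - M|^2 + 1], and [4 ln C + 1] is at most the
    remainder. If some [ftilde] value is 0 the remainder is infinite. *)

Require Import Defs.
From HB Require Import structures.
From mathcomp Require Import all_boot all_order all_algebra.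
From mathcomp Require Import all_classical all_reals all_analysis.
From mathcomp Require Import ring lra measurable_realfun.

Set Implicit Arguments.
Unset Strict Implicit.
Unset Printing Implicit Defensive.

Import Order.TTheory GRing.Theory Num.Theory.
Import numFieldNormedType.Exports.

Local Open Scope classical_set_scope.
Local Open Scope ring_scope.

(** The noise hypothesis compares integrals over intervals only, and nothing guarantees in advance
    that [psi'(X)] is integrable for the [psi] at hand. Both difficulties disappear once
    [X (psi(X) - psi(0))] is written as the integral of [psi'] against a non-negative kernel: as [X]
    is centered, the expectation of the kernel is the truncated mean, and Tonelli applies without
    integrability.

    The value [1/4] is the largest [lambda] at which this argument closes. In general the derivative
    of the posterior mean is [2 lambda] times the posterior variance, so Stein bounds [2 E (N mean)]
    by [4 lambda] expected variances, while the expanded square offers a single variance to absorb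
    them.

    The constant 1 in front of [|U0 V0^T - M|^2] forbids splitting the loss by
    [(a + b)^2 <= 2 a^2 + 2 b^2]. The cross term between this distance and the deviations of the
    factors has to stay bounded, which is why the deviations are of order [1/B^2], with [B]
    dominating both [1 + |U0| + |V0|] and [1 + 2 |U0 V0^T - M|]. *)

(** * Measures with a density and their comparison with another measure *)

Section density_measure.
Context d (T : measurableType d) (R : realType) (mu : {measure set T -> \bar R}).
Context (f : T -> \bar R) (mf : measurable_fun [set: T] f)
  (f0 : forall x, (0 <= f x)%E).
Local Open Scope ereal_scope.

(** The two proofs are arguments so that the measure structure, which depends on them, can be
    inferred from the term itself. *)
Definition density_measure of measurable_fun [set: T] f & (forall x, 0 <= f x) :=
  fun A => \int[mu]_(x in A) f x.

Local Notation nu := (density_measure mf f0).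

Let nu0 : nu set0 = 0. Proof. by rewrite /nu integral_set0. Qed.

Let nu_ge0 A : 0 <= nu A.
Proof. exact: integral_ge0. Qed.

Let nu_sigma_additive : semi_sigma_additive nu.
Proof. exact: semi_sigma_additive_nng_induced. Qed.

HB.instance Definition _ := isMeasure.Build _ _ _ nu nu0 nu_ge0
  nu_sigma_additive.

End density_measure.

Section density_le.
Context d (T : measurableType d) (R : realType).
Context (mu nu : {measure set T -> \bar R}).
Local Open Scope ereal_scope.
Import HBNNSimple.

(** By monotone convergence it is enough to treat simple functions, and by linearity indicators of
    their level sets, for which this is the hypothesis. *)
Lemma ge0_integral_density_le (f phi : T -> \bar R) :
  measurable_fun [set: T] f -> (forall x, 0 <= f x) ->
  (forall A, measurable A -> \int[mu]_(x in A) f x <= nu A) ->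
  measurable_fun [set: T] phi -> (forall x, 0 <= phi x) ->
  \int[mu]_x (phi x * f x) <= \int[nu]_x phi x.
Proof.
move=> mf f0 fnu mphi phi0.
pose h := nnsfun_approx measurableT mphi.
have hnd x : {homo (fun n => (h n x)%:E) : a b / (a <= b)%N >-> a <= b}.
  by move=> a b ab; rewrite lee_fin; exact/lefP/nd_nnsfun_approx.
have hcvg x : (h n x)%:E @[n --> \oo] --> phi x.
  exact: (@cvg_nnsfun_approx _ _ _ _ measurableT _ mphi).
have hle n x : (h n x)%:E <= phi x.
  have hc := @ereal_nondecreasing_cvgn _ (fun n => (h n x)%:E) (hnd x).
  rewrite -(cvg_unique _ hc (hcvg x))//; apply: ereal_sup_ubound.
  by exists n.
have -> : \int[mu]_x (phi x * f x) =
    limn (fun n => \int[mu]_x ((h n x)%:E * f x)).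
  rewrite -monotone_convergence//.
  - apply: eq_integral => x _; apply/esym/cvg_lim => //.
    have [fin|] := boolP (f x \is a fin_num).
      by apply: cvgeZr => //; exact: hcvg.
    (* Multiplication by [+oo] is not continuous at 0. If [phi x = 0], all approximants vanish at
       [x]; otherwise they are eventually positive and the products are eventually equal to
       [+oo]. *)
    rewrite ge0_fin_numE// -leNgt leye_eq => /eqP ->.
    have [p0|p0] := eqVneq (phi x) 0.
      rewrite p0 mul0e; rewrite (_ : (fun _ => _) = cst 0); first exact: cvg_cst.
      apply/funext => n /=; have := hle n x; rewrite p0 => h0.
      suff -> : (h n x)%:E = 0 by rewrite mul0e.
      by apply/le_anti; rewrite h0/= lee_fin fun_ge0.
    have p1 : 0 < phi x by rewrite lt0e p0 phi0.
    rewrite gt0_muley//.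
    have [N _ HN] : \forall n \near \oo, 0 < (h n x)%:E.
      move: (hcvg x) => /(_ [set y | 0 < y]); apply.
      by apply: open_nbhs_nbhs; split => //; exact: open_ereal_gt_ereal.
    apply: cvg_near_cst; exists N => // n Nn /=.
    by rewrite gt0_muley//; exact: HN.
  - move=> n; apply: emeasurable_funM => //; apply/measurable_EFinP.
    exact/measurable_funP.
  - by move=> n x _; rewrite mule_ge0// lee_fin.
  - by move=> x _ a b ab; rewrite lee_wpmul2r//; exact: hnd.
apply: lime_le.
  apply: ereal_nondecreasing_is_cvgn => a b ab; apply: ge0_le_integral => //.
  - by move=> x _; rewrite mule_ge0// lee_fin.
  - apply: emeasurable_funM => //; apply/measurable_EFinP.
    exact/measurable_funP.
  - apply: emeasurable_funM => //; apply/measurable_EFinP.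
    exact/measurable_funP.
  - by move=> x _; rewrite lee_wpmul2r//; exact: hnd.
apply: nearW => n; apply: (@le_trans _ _ (\int[nu]_x (h n x)%:E)); last first.
  apply: ge0_le_integral => //; first by move=> x _; rewrite lee_fin.
  by apply/measurable_EFinP; exact/measurable_funP.
rewrite integralT_nnsfun sintegralE.
rewrite (_ : \int[mu]_x _ = \int[mu]_x (\sum_(y \in range (h n))
    ((y * \1_(h n @^-1` [set y]) x)%:E * f x))); last first.
  apply: eq_integral => x _.
  rewrite -ge0_mule_fsuml => [|y]; last exact: nnfun_muleindic_ge0.
  by rewrite fsumEFin// -(fimfunE _ x).
rewrite ge0_integral_fsum//; last 2 first.
- move=> y; apply: emeasurable_funM => //; apply/measurable_EFinP.
  by apply: measurable_funM => //; exact: measurable_indic.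
- by move=> y x _; rewrite mule_ge0// nnfun_muleindic_ge0.
apply: lee_fsum => // y [x _ <-].
under eq_integral do rewrite EFinM -muleA.
rewrite ge0_integralZl//; last 3 first.
- apply: emeasurable_funM => //; apply/measurable_EFinP.
  exact: measurable_indic.
- by move=> z _; rewrite mule_ge0// lee_fin.
- by rewrite lee_fin.
rewrite lee_wpmul2l ?lee_fin//.
under eq_integral do rewrite muleC.
rewrite (eq_integral (f \_ (h n @^-1` [set h n x]))); last first.
  by move=> z _; rewrite epatch_indic.
by rewrite -integral_mkcond; exact: fnu.
Qed.

End density_le.

(** * Noise and the Stein inequality *)

Section noise_kernel.
Context (R : realType).
Implicit Types x t : R.

(* This is [|x|] times the indicator of [t] lying between [0] and [x]. *)
Definition noise_kernel x t : R :=
  x * ((if 0 <= t then 1 else 0) - (if x <= t then 1 else 0)).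

Lemma noise_kernel_ge0 x t : 0 <= noise_kernel x t.
Proof.
rewrite /noise_kernel; case: (leP 0 t) => t0; case: (leP x t) => xt.
- by rewrite subrr mulr0.
- by rewrite subr0 mulr1 (le_trans t0)// ltW.
- by rewrite sub0r mulrN1 oppr_ge0 (le_trans xt)// ltW.
- by rewrite subr0 mulr0.
Qed.

Lemma measurable_noise_kernel :
  measurable_fun [set: R * R] (fun z => noise_kernel z.1 z.2).
Proof.
apply: measurable_funM => //; apply: measurable_funB.
- apply: (measurable_fun_ifT (f := fun z : R * R => 0 <= z.2)) => //.
  exact: measurable_fun_ler.
- apply: (measurable_fun_ifT (f := fun z : R * R => z.1 <= z.2)) => //.
  exact: measurable_fun_ler.
Qed.

Section antiderivative.
Context (psi dpsi : R -> R) (cdpsi : continuous dpsi)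
  (dpsiE : forall t, is_derive t (1%R : R) psi (dpsi t)).

Let cpsi : continuous psi.
Proof.
move=> t; apply: differentiable_continuous; apply/derivable1_diffP.
by have := dpsiE t => -[].
Qed.

Lemma integral_itv_derive c a b : a < b ->
  (\int[lebesgue_measure]_(t in `[a, b]) (c * dpsi t)%:E =
   (c * (psi b - psi a))%:E)%E.
Proof.
move=> ab; rewrite (@continuous_FTC2 _ _ (fun t => c * psi t)) ?mulrBr ?EFinB//.
- apply: continuous_subspaceT => t; apply: cvgM; first exact: cvg_cst.
  exact: cdpsi.
- have cc : continuous (fun t => c * psi t).
    by move=> t; apply: cvgM; [exact: cvg_cst|exact: cpsi].
  split => [t _| | ].
  + apply: derivableM; first exact: derivable_cst.
    by have := dpsiE t => -[].
  + exact/cvg_at_right_filter/cc.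
  + exact/cvg_at_left_filter/cc.
- move=> t _; rewrite derive1E.
  have /@derive_val -> // : is_derive t (1%R : R) (fun t => c * psi t) (c * dpsi t).
  have -> : (fun t => c * psi t) = c \*: psi by [].
  exact: is_deriveZ.
Qed.

(** The kernel is [x] on [[0, x[] when [x > 0] and [- x] on [[x, 0[] when [x < 0]; in the second
    case the sign also compensates the orientation of the interval in the fundamental theorem of
    calculus. *)
Lemma integral_noise_kernel x :
  (\int[lebesgue_measure]_t (noise_kernel x t * dpsi t)%:E =
   (x * (psi x - psi 0))%:E)%E.
Proof.
have mdpsi : measurable_fun [set: R] dpsi by exact: continuous_measurable_fun.
have [x0|x0|<-] := ltgtP 0 x.
- rewrite -(integral_itv_derive x x0) -integral_itv_bndo_bndc; last first.
    apply/measurable_EFinP/measurable_funTS; exact: measurable_funM.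
  rewrite [RHS]integral_mkcond; apply: eq_integral => t _.
  rewrite patchE mem_setE in_itv/= /noise_kernel.
  case: (leP 0 t) => t0; case: (leP x t) => xt; rewrite ?(subrr, subr0, mulr0, mul0r, mulr1)//=.
  by have := lt_trans (le_lt_trans xt t0) x0; rewrite ltxx.
- have -> : x * (psi x - psi 0) = (- x) * (psi 0 - psi x) by ring.
  rewrite -(integral_itv_derive (- x) x0) -integral_itv_bndo_bndc; last first.
    apply/measurable_EFinP/measurable_funTS; exact: measurable_funM.
  rewrite [RHS]integral_mkcond; apply: eq_integral => t _.
  rewrite patchE mem_setE in_itv/= /noise_kernel.
  case: (leP 0 t) => t0; case: (leP x t) => xt;
  rewrite ?(subrr, subr0, sub0r, mulr0, mul0r, mulrN1)//=.
  by have := lt_le_trans (lt_trans xt x0) t0; rewrite ltxx.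
- rewrite mul0r; apply: integral0_eq => t _.
  by rewrite /noise_kernel !mul0r.
Qed.

End antiderivative.
End noise_kernel.

Section borel_rv.
Context d (T : measurableType d) (R : realType) (P : probability T R).

(* [R] and [measurableTypeR R] have the same measurable sets but different
   displays, and [lebesgue_measure] lives on the latter. *)
Definition borel_rv (X : {RV P >-> R}) : {RV P >-> measurableTypeR R} :=
  MeasurableFun.Pack (MeasurableFun.Class (isMeasurableFun.Build _ _ _ _ _
    (measurable_funPT X : measurable_fun [set: T] (X : T -> measurableTypeR R)))).

End borel_rv.

Section stein.
Context d (T : measurableType d) (R : realType) (P : probability T R).
Context (X : {RV P >-> R}) (g : R -> R).
Context (intX : P.-integrable setT (EFin \o X)) (EX0 : ('E_P[X] = 0)%E).
Context (mg : measurable_fun setT g) (g01 : forall x, 0 <= g x <= 1).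
Context (gE : forall u v : R, u <= v ->
  (\int[lebesgue_measure]_(x in `[u, v]) neg_truncated_mean X x =
   \int[distribution P X]_(x in `]u, v]) (g x)%:E)%E).
Local Open Scope ereal_scope.

(** Since [X] has mean 0, adding [X] times the indicator of [0 <= t], a constant in [w], does not
    change the expectation. It makes the integrand non-negative, as Tonelli requires. *)
Lemma neg_truncated_meanE t :
  neg_truncated_mean X t = \int[P]_w (noise_kernel (X w) t)%:E.
Proof.
rewrite /neg_truncated_mean unlock.
set c : R := if (0 <= t)%R then 1%R else 0%R.
have intX1 : P.-integrable setT
    (fun w => (X w * (if (X w <= t)%R then 1 else 0))%:E).
  apply: le_integrable intX => //.
    apply/measurable_EFinP/measurable_funM => //.
    apply: (measurable_fun_ifT (f := fun w => (X w <= t)%R)) => //.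
    exact: measurable_fun_ler.
  move=> w _ /=; rewrite lee_fin normrM ler_piMr//.
  by case: ifP; rewrite ?normr1// normr0.
have -> : \int[P]_w (noise_kernel (X w) t)%:E =
    \int[P]_w (c%:E * (X w)%:E - (X w * (if (X w <= t)%R then 1 else 0))%:E).
  by apply: eq_integral => w _; rewrite /noise_kernel -EFinM -EFinB mulrBr mulrC.
rewrite integralB//; last exact: integrableZl.
rewrite integralZl//.
have -> : \int[P]_w (X w)%:E = 0 by rewrite -EX0 unlock.
rewrite mule0 sub0e; congr (- _); apply: eq_integral => w _.
rewrite indicE; case: ifPn => Xt; first by rewrite mem_set.
by rewrite memNset//; exact/negP.
Qed.

Lemma measurable_neg_truncated_mean :
  measurable_fun [set: R] (neg_truncated_mean X).
Proof.
rewrite (_ : neg_truncated_mean X =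
    fubini_G P (fun z : T * R => (noise_kernel (X z.1) z.2)%:E)); last first.
  by apply/funext => t; rewrite neg_truncated_meanE.
apply: measurable_fun_fubini_tonelli_G => //.
- apply/measurable_EFinP.
  have mXid : measurable_fun [set: T * R] (fun z => (X z.1, z.2)).
    by apply/measurable_fun_pair => //; exact: measurableT_comp.
  by have := measurableT_comp (@measurable_noise_kernel R) mXid; apply.
- by move=> z; rewrite lee_fin noise_kernel_ge0.
Qed.

Lemma neg_truncated_mean_ge0 t : 0 <= neg_truncated_mean X t.
Proof.
by rewrite neg_truncated_meanE integral_ge0// => w _; rewrite lee_fin noise_kernel_ge0.
Qed.

(** The noise hypothesis says that the measure with density [neg_truncated_mean X] and the measure
    with density [g] with respect to the law of [X] agree on half-open intervals, hence on Borel
    sets; the latter is below the law because [g <= 1]. *)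
Lemma integral_neg_truncated_mean_le (A : set R) : measurable A ->
  \int[lebesgue_measure]_(x in A) neg_truncated_mean X x <=
  distribution P (borel_rv X) A.
Proof.
move=> mA.
have g0 x : 0 <= (g x)%:E by rewrite lee_fin; have /andP[] := g01 x.
have mge : measurable_fun [set: measurableTypeR R] (EFin \o g).
  exact/measurable_EFinP.
pose m1 : {measure set (measurableTypeR R) -> \bar R} :=
  density_measure (@lebesgue_measure R)
    measurable_neg_truncated_mean neg_truncated_mean_ge0.
pose m2 : {measure set (measurableTypeR R) -> \bar R} :=
  density_measure (distribution P (borel_rv X)) mge g0.
have m2E (B : set (measurableTypeR R)) : measurable B ->
    m2 B = \int[distribution P X]_(x in B) (g x)%:E.
  move=> mB; rewrite /m2/= /density_measure !ge0_integral_pushforward//;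
    do ?[exact: measurable_funTS|by move=> y _; exact: g0].
have g1 (B : set (measurableTypeR R)) : measurable B ->
    m2 B <= distribution P (borel_rv X) B.
  move=> mB; rewrite -[leRHS]mul1e -integral_cst//.
  apply: ge0_le_integral => //.
  - by move=> x _; exact: g0.
  - exact: measurable_funTS.
  - by move=> x _; rewrite lee_fin; have /andP[] := g01 x.
have m12 (B : set (measurableTypeR R)) : ocitv B -> m1 B = m2 B.
  move=> [[u v] _ <-]; rewrite m2E//.
  rewrite /m1 /density_measure/=.
  have [uv|vu] := leP u v.
    (* The left end is immaterial for Lebesgue measure, but not for the law of [X], which may have
       atoms. *)
    rewrite -gE//; apply: integral_itv_obnd_cbnd; apply: measurable_funTS.
    exact: measurable_neg_truncated_mean.
  by rewrite set_itv_ge ?integral_set0// bnd_simp -leNgt ltW.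
have -> : \int[lebesgue_measure]_(x in A) neg_truncated_mean X x = m2 A.
  have cov : \bigcup_n `](- n%:R)%R, (n%:R : R)]%classic = setT.
    apply/seteqP; split => // x _; exists (Num.truncn `|x|).+1 => //=.
    rewrite in_itv/=; have := truncnS_gt `|x|.
    by rewrite ltr_norml => /andP[-> /ltW ->].
  (* Finiteness of [m1] on bounded intervals is not visible from its density; it is read off [m2],
     whose mass is at most 1. *)
  have fin n : m1 `](- n%:R)%R, (n%:R : R)]%classic < +oo.
    rewrite m12; last exact: is_ocitv.
    by rewrite (le_lt_trans (g1 _ _))// (le_lt_trans (probability_le1 _ _))// ltry.
  exact: (@measure_unique _ R (measurableTypeR R) (@ocitv R) _ erefl
    (@ocitvI R) (fun n => is_ocitv _ _) cov m1 m2 m12 fin A mA).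
exact: g1.
Qed.

(** After exchanging the integrals, the truncated mean appears as a density and is dominated by the
    law of [X]. The shift by [psi 0] costs nothing because [X] is centered. *)
Lemma stein_le (psi dpsi : R -> R) : continuous dpsi ->
  (forall t, (0 <= dpsi t)%R) ->
  (forall t, is_derive t (1%R : R) psi (dpsi t)) ->
  \int[P]_w (X w * psi (X w))%:E <= \int[P]_w (dpsi (X w))%:E.
Proof.
move=> cdpsi dpsi0 dpsiE.
have mdpsi : measurable_fun [set: R] dpsi by exact: continuous_measurable_fun.
have mpsi : measurable_fun [set: R] psi.
  apply: continuous_measurable_fun => t; apply: differentiable_continuous.
  by apply/derivable1_diffP; have := dpsiE t => -[].
have mk : measurable_fun [set: T * R] (fun z => noise_kernel (X z.1) z.2).
  have mXid : measurable_fun [set: T * R] (fun z => (X z.1, z.2)).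
    by apply/measurable_fun_pair => //; exact: measurableT_comp.
  by have := measurableT_comp (@measurable_noise_kernel R) mXid; apply.
pose D w := (X w * (psi (X w) - psi 0))%:E.
have DE w : D w = \int[lebesgue_measure]_t (noise_kernel (X w) t * dpsi t)%:E.
  by rewrite integral_noise_kernel.
have D0 w : 0 <= D w.
  rewrite DE integral_ge0// => t _.
  by rewrite lee_fin mulr_ge0// noise_kernel_ge0.
have mD : measurable_fun [set: T] D.
  apply/measurable_EFinP/measurable_funM => //; apply: measurable_funB => //.
  exact: measurableT_comp.
have leD : \int[P]_w D w <= \int[P]_w (dpsi (X w))%:E.
  under eq_integral do rewrite DE.
  rewrite (fubini_tonelli (m1 := P) (m2 := @lebesgue_measure R)
    (fun z => (noise_kernel (X z.1) z.2 * dpsi z.2)%:E)); last 2 first.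
  - apply/measurable_EFinP/measurable_funM => //.
    exact: measurableT_comp.
  - by move=> z; rewrite lee_fin mulr_ge0// noise_kernel_ge0.
  rewrite [leRHS](_ : _ = \int[distribution P (borel_rv X)]_t (dpsi t)%:E); last first.
    by rewrite ge0_integral_distribution//; exact/measurable_EFinP.
  rewrite [leLHS](_ : _ = \int[lebesgue_measure]_t
      ((dpsi t)%:E * neg_truncated_mean X t)); last first.
    apply: eq_integral => t _; rewrite neg_truncated_meanE.
    under eq_integral do rewrite EFinM muleC /=.
    rewrite ge0_integralZl ?lee_fin//.
      apply/measurable_EFinP.
      by have := measurableT_comp mk (measurable_pair2 t); apply.
    by move=> w _; rewrite lee_fin noise_kernel_ge0.
  apply: ge0_integral_density_le.
  - exact: measurable_neg_truncated_mean.
  - exact: neg_truncated_mean_ge0.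
  - exact: integral_neg_truncated_mean_le.
  - exact/measurable_EFinP.
  - by move=> x; rewrite lee_fin.
(* When the right-hand side is finite, the bound just proved makes [D] integrable, which permits
   splitting off the term [psi 0 * X]. *)
have [->|Dfin] := eqVneq (\int[P]_w (dpsi (X w))%:E) +oo; first by rewrite leey.
have intD : P.-integrable setT D.
  apply/integrableP; split => //.
  under eq_integral do rewrite gee0_abs//.
  by rewrite (le_lt_trans leD)// ltey.
rewrite (_ : \int[P]_w (X w * psi (X w))%:E =
    \int[P]_w (D w + (psi 0)%:E * (X w)%:E)); last first.
  by apply: eq_integral => w _; rewrite /D -EFinM -EFinD; congr EFin; ring.
rewrite integralD//; last exact: integrableZl.
rewrite integralZl//.
have -> : \int[P]_w (X w)%:E = 0 by rewrite -EX0 unlock.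
by rewrite mule0 adde0.
Qed.

(** Stein's inequality for [psi = id]. It supplies the square integrability of the noise. *)
Lemma integral_noise_sqr_le1 : \int[P]_w (X w ^+ 2)%:E <= 1.
Proof.
have h1 : \int[P]_w (cst 1%R (X w))%:E = 1.
  transitivity (1 * P setT); last by rewrite probability_setT mule1.
  exact: (integral_cst P measurableT 1%:E).
rewrite -[leRHS]h1; under eq_integral do rewrite expr2.
apply: (@stein_le id (cst 1%R)).
- exact: cst_continuous.
- by [].
Qed.

End stein.

(** * Resampling one coordinate of the noise *)

Section rectangles.
Context d (S : measurableType d) (R : realType) (n : nat).

Definition rectangle (A : 'I_n -> set S) : set (n.-tuple S) :=
  [set t | forall i, A i (tnth t i)].

Definition rectangles : set (set (n.-tuple S)) :=
  [set rectangle A | A in [set A | forall i, measurable (A i)]].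

Lemma measurable_rectangle A : (forall i, measurable (A i)) ->
  measurable (rectangle A).
Proof.
move=> mA; rewrite (_ : rectangle A =
    \bigcap_(i in [set: 'I_n]) ((tnth (T := S))^~ i @^-1` A i)); last first.
  by apply/seteqP; split => t h i; [move=> _|]; exact: h.
apply: fin_bigcap_measurable => // i _; rewrite -[X in measurable X]setTI.
exact: measurable_tnth.
Qed.

(** The tuple sigma-algebra is generated by conditions on a single coordinate, which are rectangles
    with all other sides full. Unlike those, rectangles are stable under intersection, as uniqueness
    of measures requires. *)
Lemma measurable_rectanglesE :
  @measurable _ (n.-tuple S) = <<s rectangles >>.
Proof.
rewrite eqEsubset; split.
- apply: smallest_sub; first exact: smallest_sigma_algebra.
  move=> B; rewrite -bigcup_seq => -[i _ [A mA <-]].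
  apply: sub_sigma_algebra.
  exists (fun j => if j == i then A else setT) => [j|]; first by case: ifP.
  apply/seteqP; split => t /=.
    by move=> /(_ i); rewrite eqxx.
  by move=> [_ At] j; case: eqP => [->|//].
- apply: smallest_sub; first exact: sigma_algebra_measurable.
  by move=> _ [A mA <-]; exact: measurable_rectangle.
Qed.

Lemma tuple_probability_unique (m1 m2 : probability (n.-tuple S) R) :
  (forall A, (forall i, measurable (A i)) ->
    m1 (rectangle A) = m2 (rectangle A)) ->
  forall B, measurable B -> m1 B = m2 B.
Proof.
move=> m12 B mB.
apply: (measure_unique rectangles (fun=> setT) measurable_rectanglesE) => //.
- move=> _ _ [A mA <-] [A' mA' <-]; exists (fun i => A i `&` A' i).
    by move=> i; exact: measurableI.
  by apply/seteqP; split => t; [move=> AA; split => i; case: (AA i)|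
    move=> [At A't] i; split].
- move=> _; exists (fun=> setT) => //.
  by apply/seteqP; split.
- by apply/seteqP; split => // t _; exists 0%N.
- by move=> _ [A mA <-]; exact: m12.
- move=> _; apply: (le_lt_trans (probability_le1 m1 measurableT)).
  by rewrite ltry.
Qed.

End rectangles.

Section resampling.
Context d (T : measurableType d) (R : realType) (P : probability T R).
Context (n : nat) (N : 'I_n -> {RV P >-> R}).
Context (indepN : mutually_independent N).

Definition noise_tuple (w : T) : n.-tuple R := [tuple N i w | i < n].

(** Instead of conditioning on the other coordinates, the [k]-th one is read off an independent copy
    of the probability space. *)
Definition resample (k : 'I_n) (z : T * T) : n.-tuple R :=
  [tuple if i == k then N i z.2 else N i z.1 | i < n].

Lemma measurable_noise_tuple : measurable_fun [set: T] noise_tuple.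
Proof.
apply/measurable_fun_tnthP => i.
rewrite (_ : _ \o _ = N i)//.
by apply/funext => w /=; rewrite tnth_mktuple.
Qed.

Lemma measurable_resample k : measurable_fun [set: T * T] (resample k).
Proof.
apply/measurable_fun_tnthP => i.
rewrite (_ : _ \o _ = fun z => if i == k then N i z.2 else N i z.1); last first.
  by apply/funext => w /=; rewrite tnth_mktuple.
by case: (i == k); exact: measurableT_comp.
Qed.

Let noise_rv : {RV P >-> n.-tuple R} :=
  MeasurableFun.Pack (MeasurableFun.Class (isMeasurableFun.Build _ _ _ _ _
    measurable_noise_tuple)).

Let resample_rv k : {RV (P \x P)%E >-> n.-tuple R} :=
  MeasurableFun.Pack (MeasurableFun.Class (isMeasurableFun.Build _ _ _ _ _
    (measurable_resample k))).

Lemma noise_tuple_rectangle (A : 'I_n -> set R) (J : {set 'I_n}) :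
  (forall i, measurable (A i)) ->
  P [set w | forall i, i \in J -> A i (N i w)] =
  (\prod_(i in J) P (N i @^-1` A i))%E.
Proof.
move=> mA; by rewrite -indepN.
Qed.

(** Both laws give a rectangle the product of the marginal probabilities: independence is used for
    all coordinates on one side, and for those other than [k] on the other side, where the product
    measure provides the last factor. *)
Lemma distribution_resample k (B : set (n.-tuple R)) : measurable B ->
  distribution P noise_rv B = distribution (P \x P)%E (resample_rv k) B.
Proof.
move: B; apply: tuple_probability_unique => A mA.
rewrite -[LHS]/(P (noise_tuple @^-1` rectangle A)).
rewrite -[RHS]/((P \x P)%E (resample k @^-1` rectangle A)).
rewrite (_ : noise_tuple @^-1` rectangle A =
    [set w | forall i, i \in [set: 'I_n]%SET -> A i (N i w)]); last first.
  apply/seteqP; split => w /= h i; have := h i; rewrite tnth_mktuple//.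
  by apply; rewrite inE.
rewrite noise_tuple_rectangle//.
rewrite (_ : resample k @^-1` rectangle A =
    [set w | forall i : 'I_n, i \in [set~ k]%SET -> A i (N i w)] `*` (N k @^-1` A k));
    last first.
  apply/seteqP; split => -[w w'] /=.
    move=> h; split => [i|].
      rewrite !inE => /negbTE ik.
      by have := h i; rewrite tnth_mktuple ik.
    by have := h k; rewrite tnth_mktuple eqxx.
  move=> [h1 h2] i; rewrite tnth_mktuple /=; case: eqP => [->//|/eqP ik].
  by apply: h1; rewrite !inE.
rewrite product_measure1E.
- rewrite [RHS](_ : _ = ((\prod_(i in [set~ k]%SET) P (N i @^-1` A i)) *
      P (N k @^-1` A k))%E); last first.
    by congr (_ * _)%E; exact: noise_tuple_rectangle.
  rewrite (bigD1 k) ?inE//=; apply: etrans (muleC _ _) _; congr (_ * _)%E.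
  by apply: eq_bigl => i; rewrite !inE.
- rewrite (_ : [set w | _] =
    \bigcap_(i in [set` [set~ k]%SET]) (N i @^-1` A i)); last first.
    by apply/seteqP; split => w /= h i; exact: h.
  apply: fin_bigcap_measurable => // i _.
  by rewrite -[X in measurable X]setTI; exact: measurable_funPT.
- by rewrite -[X in measurable X]setTI; exact: measurable_funPT.
Qed.

Section integral.
Context (k : 'I_n) (F : n.-tuple R -> R).
Context (mF : measurable_fun setT F).
Context (intF : P.-integrable setT (EFin \o F \o noise_tuple)).

Lemma integrable_resample :
  (P \x P)%E.-integrable setT (EFin \o F \o resample k).
Proof.
move/integrableP : intF => [_ Foo]; apply/integrableP; split.
  apply/measurable_EFinP; apply: measurableT_comp => //.
  exact: measurable_resample.
rewrite (le_lt_trans _ Foo)// le_eqVlt; apply/orP; left; apply/eqP.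
have mabsF : measurable_fun [set: n.-tuple R] (fun t => `|(F t)%:E|%E).
  by apply: measurableT_comp => //; exact/measurable_EFinP.
rewrite -[RHS](ge0_integral_distribution noise_rv mabsF)//.
rewrite -[LHS](ge0_integral_distribution (resample_rv k) mabsF)//.
by apply: eq_measure_integral => B mB _; exact/esym/distribution_resample.
Qed.

(** Two changes of variables through the common law, then Fubini: in the inner integral only the
    [k]-th coordinate varies. *)
Lemma integral_resample : (\int[P]_w (F (noise_tuple w))%:E =
  \int[P]_w \int[P]_w' (F (resample k (w, w')))%:E)%E.
Proof.
have mF' : measurable_fun [set: n.-tuple R] (EFin \o F) by exact/measurable_EFinP.
rewrite -[LHS](@integral_distribution _ _ _ _ _ _ noise_rv _ mF')//.
rewrite [RHS](integral12_prod_meas1 integrable_resample).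
rewrite -[RHS](@integral_distribution _ _ _ _ _ _ (resample_rv k) _ mF')//; last first.
  exact: integrable_resample.
by apply: eq_measure_integral => B mB _; exact: distribution_resample.
Qed.

End integral.
End resampling.

(** * Exponentially weighted aggregation *)

Section tilted_moments.
Context d (S : measurableType d) (R : realType) (mu : {measure set S -> \bar R}).
Context (zeta v : S -> R) (mzeta : measurable_fun setT zeta)
  (v0 : forall x, 0 <= v x) (iv : mu.-integrable setT (EFin \o v)).

(** Up to the factor [exp (- t^2 / 4)], free of [x], this is [zeta^j] times the Gaussian weight
    [exp (- (t - zeta)^2 / 4)]. Without that factor, differentiating in [t] merely raises [j] by one
    and divides by 2. *)
Definition tilt j (t : R) x : R :=
  zeta x ^+ j * expR (t * zeta x / 2 - zeta x ^+ 2 / 4) * v x.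

Definition tilted_moment j (t : R) : R := \int[mu]_x tilt j t x.

Let mv : measurable_fun [set: S] v.
Proof. by case/integrableP : iv => /measurable_EFinP. Qed.

Lemma measurable_tilt j t : measurable_fun [set: S] (tilt j t).
Proof.
apply: measurable_funM => //; apply: measurable_funM.
  exact: measurable_funX.
apply: measurableT_comp; first exact: measurable_expR.
apply: measurable_funB.
  by apply: measurable_funM => //; apply: measurable_funM.
by apply: measurable_funM => //; exact: measurable_funX.
Qed.

(** From [|z|^j <= exp (j |z|)] the exponent is at most [(j + b/2) |z| - |z|^2 / 4], whose maximum,
    at [|z| = 2 j + b], is [(j + b/2)^2]. The bound is uniform in [x], so an integrable [v] has all
    tilted moments, however heavy the tails of [zeta] are under it. *)
Lemma le_tilt j (b t : R) x : `|t| <= b ->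
  `|tilt j t x| <= expR ((j%:R + b / 2) ^+ 2) * v x.
Proof.
move=> tb; rewrite normrM (ger0_norm (v0 x)) ler_wpM2r//.
rewrite normrM normrX (gtr0_norm (expR_gt0 _)).
set z := zeta x.
have z0 := normr_ge0 z.
have h1 : `|z| ^+ j <= expR (j%:R * `|z|).
  rewrite expRM_natl lerXn2r ?nnegrE ?expR_ge0//.
  by apply: le_trans (expR_ge1Dx _); rewrite lerDr.
apply: (le_trans (ler_wpM2r (expR_ge0 _) h1)).
rewrite -expRD ler_expR.
have h2 : t * z <= b * `|z|.
  by apply: (le_trans (ler_norm _)); rewrite normrM ler_wpM2r.
have h3 : z ^+ 2 = `|z| ^+ 2 by rewrite real_normK ?num_real.
rewrite h3; set c := `|z| in z0 h2 *; set i := j%:R.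
have : 0 <= (i + b / 2 - c / 2) ^+ 2 by exact: sqr_ge0.
by rewrite !expr2; nra.
Qed.

Lemma integrable_tilt j t : mu.-integrable setT (EFin \o tilt j t).
Proof.
apply: (le_integrable measurableT) (integrableZl measurableT
  (expR ((j%:R + `|t| / 2) ^+ 2)) iv).
  exact/measurable_EFinP/measurable_tilt.
move=> x _ /=; rewrite lee_fin [leRHS]ger0_norm ?le_tilt//.
by rewrite mulr_ge0// expR_ge0.
Qed.

Lemma is_derive_tilt j t x :
  is_derive t (1 : R) (tilt j ^~ x) (tilt j.+1 t x / 2).
Proof.
rewrite /tilt; set z := zeta x.
have -> : (fun u => z ^+ j * expR (u * z / 2 - z ^+ 2 / 4) * v x) =
    (z ^+ j * v x) \*: (expR \o (fun u => u * z / 2 - z ^+ 2 / 4)).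
  by apply/funext => u /=; rewrite /GRing.scale/=; ring.
have hd : is_derive t (1 : R) (fun u : R => u * z / 2 - z ^+ 2 / 4) (z / 2).
  have -> : (fun u : R => u * z / 2 - z ^+ 2 / 4) =
      (z / 2) \*: (id : R -> R) + cst (- (z ^+ 2 / 4)).
    by apply/funext => u; rewrite -[RHS]/(z / 2 * u - z ^+ 2 / 4); ring.
  apply: is_derive_eq; rewrite /GRing.scale/=; ring.
have hc := @is_derive1_comp R expR (fun u : R => u * z / 2 - z ^+ 2 / 4) t _ _
  (is_derive_expR _) hd.
apply: (is_derive_eq (is_deriveZ (z ^+ j * v x) hc)).
rewrite -[LHS]/(z ^+ j * v x * (expR (t * z / 2 - z ^+ 2 / 4) * (z / 2))) [z ^+ j.+1]exprS.
by ring.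
Qed.

Lemma is_derive_tilted_moment j t :
  is_derive t (1 : R) (tilted_moment j) (tilted_moment j.+1 t / 2).
Proof.
have It : `]t - 1, t + 1[%classic t.
  by rewrite /= in_itv/= ltrBlDr ltrDl ltr01.
(* One dominating constant for the whole window around [t]: there [|u| <= |t| + 1], and the
   derivative involves the power [j + 1]. *)
pose c : R := expR ((j.+1%:R + (`|t| + 1) / 2) ^+ 2).
have ub u : `]t - 1, t + 1[%classic u -> `|u| <= `|t| + 1.
  rewrite /= in_itv/= => /andP[u1 u2].
  rewrite -(subrK t u) addrC (le_trans (ler_normD _ _))// lerD2l.
  by rewrite ler_norml; apply/andP; split; lra.
have d1E u x : partial1of2 (tilt j) u x = tilt j.+1 u x / 2.
  rewrite partial1of2E; have := is_derive_tilt j u x.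
  by move=> h; rewrite derive_val.
have intG : mu.-integrable setT (EFin \o (fun x => c * v x)).
  exact: (integrableZl measurableT c iv).
have G0 x : 0 <= c * v x by rewrite mulr_ge0// expR_ge0.
have dtilt u x : `]t - 1, t + 1[%classic u -> setT x -> derivable (tilt j ^~ x) u 1.
  by move=> _ _; have := is_derive_tilt j u x => -[].
have Gub u x : `]t - 1, t + 1[%classic u -> setT x ->
    `|partial1of2 (tilt j) u x| <= c * v x.
  move=> /ub uI _; rewrite d1E normrM [X in _ * X]ger0_norm; last lra.
  rewrite (le_trans _ (le_tilt j.+1 x uI))// ler_piMr//; lra.
have int_tilt u : `]t - 1, t + 1[%classic u ->
    mu.-integrable setT (EFin \o tilt j u) by move=> _; exact: integrable_tilt.
apply: DeriveDef.
  exact: (derivable_under_integral measurableT It int_tilt dtilt G0 intG Gub).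
rewrite -derive1E.
rewrite (differentiation_under_integral measurableT It int_tilt dtilt G0 intG Gub).
transitivity (\int[mu]_x (tilt j.+1 t x * 2^-1)).
  by apply: eq_Rintegral => x _; rewrite d1E.
by rewrite RintegralZr//; exact: integrable_tilt.
Qed.

Lemma continuous_tilted_moment j : continuous (tilted_moment j).
Proof.
move=> t; apply: differentiable_continuous; apply/derivable1_diffP.
by have := is_derive_tilted_moment j t => -[].
Qed.

Lemma is_derive_tilted_mean t : 0 < tilted_moment 0 t ->
  is_derive t (1 : R) (fun u => tilted_moment 1 u / tilted_moment 0 u)
   ((tilted_moment 2 t / tilted_moment 0 t -
     (tilted_moment 1 t / tilted_moment 0 t) ^+ 2) / 2).
Proof.
move=> J0; have J0' : tilted_moment 0 t != 0 by rewrite gt_eqF.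
have d0 := is_derive_tilted_moment 0 t.
have d1 := is_derive_tilted_moment 1 t.
have -> : (fun u => tilted_moment 1 u / tilted_moment 0 u) =
  (tilted_moment 1) * (fun u => (tilted_moment 0 u)^-1) by [].
have dV := is_deriveV J0' d0.
apply: (is_derive_eq (is_deriveM d1 dV)).
move: J0'; set a := tilted_moment 0 t; set b := tilted_moment 1 t => a0.
rewrite -[LHS]/(b * (- a ^- 2 * (b / 2)) + a^-1 * (tilted_moment 2 t / 2)).
by field.
Qed.

End tilted_moments.

Section real_integral.
Context d (S : measurableType d) (R : realType) (mu : {measure set S -> \bar R}).
Implicit Types f g : S -> R.

Local Notation int f := (mu.-integrable setT (fun x => (f x)%:E)).

Lemma integrableD_real f g : int f -> int g -> int (fun x => f x + g x).
Proof. by move=> hf hg; exact: (integrableD measurableT hf hg). Qed.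

Lemma integrableZ_real c f : int f -> int (fun x => c * f x).
Proof. by move=> hf; exact: (integrableZl measurableT c hf). Qed.

Lemma integrable_sum_real (I : Type) (s : seq I) (f : I -> S -> R) :
  (forall i, int (f i)) -> int (fun x => \sum_(i <- s) f i x).
Proof.
move=> hf; elim: s => [|i s ih].
  under eq_fun do rewrite big_nil; exact: integrable0.
under eq_fun do rewrite big_cons; exact: integrableD_real.
Qed.

Lemma Rintegral_sum (I : Type) (s : seq I) (f : I -> S -> R) :
  (forall i, int (f i)) ->
  \int[mu]_x (\sum_(i <- s) f i x) = \sum_(i <- s) \int[mu]_x f i x.
Proof.
move=> hf; elim: s => [|i s ih].
  rewrite big_nil; under eq_Rintegral do rewrite big_nil.
  by rewrite /Rintegral integral0.
rewrite big_cons -ih -RintegralD//; last 2 first.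
- exact: hf.
- exact: integrable_sum_real.
by apply: eq_Rintegral => x _; rewrite big_cons.
Qed.

Lemma Rintegral_fineE f : int f -> (\int[mu]_x f x)%:E = (\int[mu]_x (f x)%:E)%E.
Proof. by move=> hf; rewrite /Rintegral fineK//; exact: integrable_fin_num. Qed.

Lemma Rintegral_lin2 c1 c2 f g : int f -> int g ->
  \int[mu]_x (c1 * f x + c2 * g x) = c1 * \int[mu]_x f x + c2 * \int[mu]_x g x.
Proof.
move=> hf hg; rewrite RintegralD//; [|exact: integrableZ_real..].
by rewrite !RintegralZl.
Qed.

Lemma Rintegral_lin3 c1 c2 c3 f g h : int f -> int g -> int h ->
  \int[mu]_x (c1 * f x + c2 * g x + c3 * h x) =
  c1 * \int[mu]_x f x + c2 * \int[mu]_x g x + c3 * \int[mu]_x h x.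
Proof.
move=> hf hg hh; rewrite RintegralD//; last 2 first.
- by apply: integrableD_real; exact: integrableZ_real.
- exact: integrableZ_real.
by rewrite Rintegral_lin2// RintegralZl.
Qed.

Lemma le_Rintegral_real f g : int f -> int g -> (forall x, f x <= g x) ->
  \int[mu]_x f x <= \int[mu]_x g x.
Proof. by move=> hf hg fg; exact: le_Rintegral. Qed.

End real_integral.

(** Continuity fails at 0. The expression [x * (x^2)^(-1)] in real powers covers all [x], both sides
    being 0 at 0. *)
Lemma measurable_invr (R : realType) :
  measurable_fun [set: R] (fun x : R => x^-1).
Proof.
rewrite (_ : (fun x : R => x^-1) = (fun x => x * (x ^+ 2) `^ (-1))).
  apply: measurable_funM => //.
  have := measurableT_comp (@measurable_powR R (-1))
    (@measurable_funX _ _ _ _ _ 2 (@measurable_id _ R setT)).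
  exact.
apply/funext => x; rewrite powR_inv1 ?sqr_ge0//.
have [->|x0] := eqVneq x 0; first by rewrite invr0 mul0r.
by field.
Qed.

Section exponential_weights.
Context d (S : measurableType d) (R : realType)
  (mu : {sigma_finite_measure set S -> \bar R}).
Context (n : nat) (zeta : 'I_n -> S -> R) (mzeta : forall k, measurable_fun setT (zeta k)).
Context (p : S -> R) (p0 : forall x, 0 <= p x)
  (ip : mu.-integrable setT (fun x => (p x)%:E)).
Implicit Types (y : n.-tuple R) (x : S) (k : 'I_n).

Let mp : measurable_fun [set: S] p.
Proof. by case/integrableP : ip => /measurable_EFinP. Qed.

Definition sqdist y x : R := \sum_k (tnth y k - zeta k x) ^+ 2.

Definition ew_weight y x : R := expR (- sqdist y x / 4) * p x.

Definition ew_moment k j y : R := \int[mu]_x (zeta k x ^+ j * ew_weight y x).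

Definition ew_total y : R := \int[mu]_x ew_weight y x.

Definition ew_mean k y : R := ew_moment k 1 y / ew_total y.

Definition ew_sqr k y : R := ew_moment k 2 y / ew_total y.

Lemma sqdist_ge0 y x : 0 <= sqdist y x.
Proof. by apply: sumr_ge0 => k _; exact: sqr_ge0. Qed.

Lemma ew_weight_ge0 y x : 0 <= ew_weight y x.
Proof. by rewrite mulr_ge0 ?expR_ge0. Qed.

(** The weight left after removing the [k]-th square. It does not involve the [k]-th coordinate of
    [y], so along that coordinate [ew_weight] is a tilt of a fixed weight. *)
Definition other_weight k y x : R :=
  expR (- (\sum_(i | i != k) (tnth y i - zeta i x) ^+ 2) / 4) * p x.

Lemma measurable_other_weight k y : measurable_fun setT (other_weight k y).
Proof.
apply: measurable_funM => //; apply: measurableT_comp.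
  exact: measurable_expR.
apply: measurable_funM => //; apply: measurableT_comp => //.
under eq_fun do rewrite big_mkcond.
apply: (@measurable_sum _ _ R setT _ _
  (fun i x => if i != k then (tnth y i - zeta i x) ^+ 2 else 0)) => i.
case: (i != k) => //.
by apply: measurable_funX; exact: measurable_funB.
Qed.

Lemma other_weight_ge0 k y x : 0 <= other_weight k y x.
Proof. by rewrite mulr_ge0 ?expR_ge0. Qed.

Lemma integrable_other_weight k y :
  mu.-integrable setT (fun x => (other_weight k y x)%:E).
Proof.
apply: (le_integrable measurableT) ip.
  exact/measurable_EFinP/measurable_other_weight.
move=> x _ /=; rewrite lee_fin !ger0_norm ?other_weight_ge0// ler_piMl//.
rewrite -[leRHS]expR0 ler_expR mulNr oppr_le0 divr_ge0//.
by apply: sumr_ge0 => i _; exact: sqr_ge0.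
Qed.

Lemma ew_weightE k j y x : zeta k x ^+ j * ew_weight y x =
  expR (- (tnth y k) ^+ 2 / 4) *
  tilt (zeta k) (other_weight k y) j (tnth y k) x.
Proof.
rewrite /ew_weight /tilt /other_weight /sqdist (bigD1 k)//=.
set s := \sum_(i < n | _) _; set t := tnth y k; set z := zeta k x.
have -> : - ((t - z) ^+ 2 + s) / 4 =
    (- t ^+ 2 / 4) + ((t * z / 2 - z ^+ 2 / 4) + (- s / 4)) by field.
by rewrite !expRD; ring.
Qed.

Lemma integrable_ew_moment k j y :
  mu.-integrable setT (fun x => (zeta k x ^+ j * ew_weight y x)%:E).
Proof.
under eq_fun do rewrite ew_weightE.
apply: integrableZ_real; apply: integrable_tilt => //.
  exact: other_weight_ge0.
exact: integrable_other_weight.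
Qed.

Lemma ew_momentE k j y : ew_moment k j y = expR (- (tnth y k) ^+ 2 / 4) *
  tilted_moment mu (zeta k) (other_weight k y) j (tnth y k).
Proof.
rewrite /ew_moment /tilted_moment -RintegralZl//.
  by apply: eq_Rintegral => x _; rewrite ew_weightE.
apply: integrable_tilt => //; first exact: other_weight_ge0.
exact: integrable_other_weight.
Qed.

Lemma ew_totalE k y : ew_total y = ew_moment k 0 y.
Proof. by apply: eq_Rintegral => x _; rewrite expr0 mul1r. Qed.

Lemma measurable_ew_weight y : measurable_fun setT (ew_weight y).
Proof.
apply: measurable_funM => //; apply: measurableT_comp.
  exact: measurable_expR.
apply: measurable_funM => //; apply: measurableT_comp => //.
apply: (@measurable_sum _ _ R setT _ _ (fun i x => (tnth y i - zeta i x) ^+ 2)).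
by move=> i; apply: measurable_funX; exact: measurable_funB.
Qed.

Lemma integrable_ew_weight y : mu.-integrable setT (fun x => (ew_weight y x)%:E).
Proof.
apply: (le_integrable measurableT) ip.
  exact/measurable_EFinP/measurable_ew_weight.
move=> x _ /=; rewrite lee_fin !ger0_norm ?ew_weight_ge0// ler_piMl//.
by rewrite -[leRHS]expR0 ler_expR mulNr oppr_le0 divr_ge0// sqdist_ge0.
Qed.

Lemma measurable_Rintegral_ew_weight (g : S -> R) : measurable_fun setT g ->
  (forall x, 0 <= g x) ->
  measurable_fun [set: n.-tuple R] (fun y => \int[mu]_x (g x * ew_weight y x)).
Proof.
move=> mg g0; rewrite /Rintegral; apply: measurableT_comp => //.
apply: (@measurable_fun_fubini_tonelli_F _ _ (n.-tuple R) S R mu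
  (fun z => (g z.2 * ew_weight z.1 z.2)%:E)).
- apply/measurable_EFinP/measurable_funM; first exact: measurableT_comp.
  apply: measurable_funM; last exact: measurableT_comp.
  apply: measurableT_comp; first exact: measurable_expR.
  apply: measurable_funM => //; apply: measurableT_comp => //.
  apply: (@measurable_sum _ _ R setT _ _
    (fun i (z : n.-tuple R * S) => (tnth z.1 i - zeta i z.2) ^+ 2)).
  move=> i; apply: measurable_funX; apply: measurable_funB.
    by have := measurableT_comp (measurable_tnth i) measurable_fst; apply.
  exact: measurableT_comp.
- by move=> z; rewrite lee_fin mulr_ge0// ew_weight_ge0.
Qed.

Lemma measurable_ew_total : measurable_fun [set: n.-tuple R] ew_total.
Proof.
have := @measurable_Rintegral_ew_weight (cst 1) (@measurable_cst _ _ _ _ _ _).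
move=> /(_ (fun=> ler01)); apply: eq_measurable_fun => y _.
by apply: eq_Rintegral => x _; rewrite mul1r.
Qed.

Lemma measurable_ew_moment2 k : measurable_fun [set: n.-tuple R] (ew_moment k 2).
Proof.
apply: measurable_Rintegral_ew_weight; first exact: measurable_funX.
by move=> x; exact: sqr_ge0.
Qed.

(* [2 z = (1 + z)^2 - 1 - z^2] reduces to non-negative integrands. *)
Lemma measurable_ew_moment1 k : measurable_fun [set: n.-tuple R] (ew_moment k 1).
Proof.
have mz1 : measurable_fun setT (fun x => (1 + zeta k x) ^+ 2).
  by apply: measurable_funX; exact: measurable_funD.
have m1 := measurable_Rintegral_ew_weight mz1 (fun x => sqr_ge0 _).
have := measurable_funM (measurable_funB (measurable_funB m1 measurable_ew_total)
  (measurable_ew_moment2 k)) (@measurable_cst _ _ _ _ setT (2^-1 : R)).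
apply: eq_measurable_fun => y _ /=.
rewrite (_ : \int[mu]_x _ =
    ew_total y + (2 * ew_moment k 1 y + ew_moment k 2 y)); first by field.
rewrite -RintegralZl//; last exact: integrable_ew_moment.
rewrite -RintegralD//; last 2 first.
- exact/integrableZ_real/integrable_ew_moment.
- exact: integrable_ew_moment.
rewrite -RintegralD//; last 2 first.
- exact: integrable_ew_weight.
- apply: integrableD_real; last exact: integrable_ew_moment.
  exact/integrableZ_real/integrable_ew_moment.
by apply: eq_Rintegral => x _; ring.
Qed.

Lemma measurable_ew_mean k : measurable_fun [set: n.-tuple R] (ew_mean k).
Proof.
apply: measurable_funM; first exact: measurable_ew_moment1.
exact: measurableT_comp (@measurable_invr R) measurable_ew_total.
Qed.

Lemma measurable_ew_sqr k : measurable_fun [set: n.-tuple R] (ew_sqr k).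
Proof.
apply: measurable_funM; first exact: measurable_ew_moment2.
exact: measurableT_comp (@measurable_invr R) measurable_ew_total.
Qed.

(** The weight [q] is general because the expansion is used twice, for the unnormalised posterior
    and for the comparison density. *)
Lemma integrable_sqdist_mul (q : S -> R) y :
  (forall k, mu.-integrable setT (fun x => (zeta k x * q x)%:E)) ->
  (forall k, mu.-integrable setT (fun x => (zeta k x ^+ 2 * q x)%:E)) ->
  mu.-integrable setT (fun x => (q x)%:E) ->
  mu.-integrable setT (fun x => (sqdist y x * q x)%:E) /\
  \int[mu]_x (sqdist y x * q x) =
  \sum_k ((tnth y k) ^+ 2 * (\int[mu]_x q x)
    - 2 * tnth y k * (\int[mu]_x (zeta k x * q x))
    + \int[mu]_x (zeta k x ^+ 2 * q x)).
Proof.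
move=> i1 i2 iq.
pose f k x := (tnth y k) ^+ 2 * q x + (- 2 * tnth y k) * (zeta k x * q x) +
  1 * (zeta k x ^+ 2 * q x).
have fE x : sqdist y x * q x = \sum_k f k x.
  by rewrite mulr_suml; apply: eq_bigr => k _; rewrite /f; ring.
have if1 k : mu.-integrable setT (fun x => ((tnth y k) ^+ 2 * q x +
    (- 2 * tnth y k) * (zeta k x * q x))%:E).
  by apply: integrableD_real; exact: integrableZ_real.
have if2 k : mu.-integrable setT (fun x => (f k x)%:E).
  by apply: integrableD_real => //; exact: integrableZ_real.
under eq_fun do rewrite fE.
under eq_Rintegral do rewrite fE.
split; first exact: integrable_sum_real.
rewrite Rintegral_sum//; apply: eq_bigr => k _.
rewrite [LHS](Rintegral_lin3 _ _ _ iq (i1 k) (i2 k)); ring.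
Qed.

Section positive_total.
Context y (Z0 : 0 < ew_total y).

Lemma ew_meanE k : ew_mean k y =
  tilted_moment mu (zeta k) (other_weight k y) 1 (tnth y k) /
  tilted_moment mu (zeta k) (other_weight k y) 0 (tnth y k).
Proof.
rewrite /ew_mean (ew_totalE k) !ew_momentE.
by rewrite -mulf_div mulfV ?mul1r// gt_eqF// expR_gt0.
Qed.

Lemma ew_sqrE k : ew_sqr k y =
  tilted_moment mu (zeta k) (other_weight k y) 2 (tnth y k) /
  tilted_moment mu (zeta k) (other_weight k y) 0 (tnth y k).
Proof.
rewrite /ew_sqr (ew_totalE k) !ew_momentE.
by rewrite -mulf_div mulfV ?mul1r// gt_eqF// expR_gt0.
Qed.

Lemma tilted_moment_gt0 k :
  0 < tilted_moment mu (zeta k) (other_weight k y) 0 (tnth y k).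
Proof.
by move: Z0; rewrite (ew_totalE k) ew_momentE pmulr_rgt0// expR_gt0.
Qed.

(** Non-negativity of the posterior variance. It gives the monotonicity of the posterior mean in
    each coordinate, without which Stein's inequality does not apply. *)
Lemma ew_mean_sqr_le k : ew_mean k y ^+ 2 <= ew_sqr k y.
Proof.
set m := ew_mean k y.
have i0 := integrable_ew_weight y.
have i1 : mu.-integrable setT (fun x => (zeta k x * ew_weight y x)%:E).
  exact: (integrable_ew_moment k 1 y).
have i2 := integrable_ew_moment k 2 y.
have : 0 <= \int[mu]_x ((zeta k x - m) ^+ 2 * ew_weight y x).
  by apply: Rintegral_ge0 => x _; rewrite mulr_ge0 ?sqr_ge0 ?ew_weight_ge0.
rewrite (_ : \int[mu]_x _ = \int[mu]_x (m ^+ 2 * ew_weight y x +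
    (- 2 * m) * (zeta k x * ew_weight y x) +
    1 * (zeta k x ^+ 2 * ew_weight y x))); last first.
  by apply: eq_Rintegral => x _; ring.
rewrite (Rintegral_lin3 _ _ _ i0 i1 i2).
rewrite -[\int[mu]_x ew_weight y x]/(ew_total y).
have -> : \int[mu]_x (zeta k x * ew_weight y x) = m * ew_total y.
  by rewrite /m /ew_mean divfK ?gt_eqF.
have -> : \int[mu]_x (zeta k x ^+ 2 * ew_weight y x) = ew_sqr k y * ew_total y.
  by rewrite /ew_sqr divfK ?gt_eqF.
rewrite (_ : _ + _ = (ew_sqr k y - m ^+ 2) * ew_total y); last ring.
by rewrite pmulr_lge0// subr_ge0.
Qed.

(** This is the non-negativity of the relative entropy of the posterior with respect to [p]. It is
    integrated from [ln s <= s - 1], where [s = z / e] is the inverse of the density of the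
    posterior relative to [p]; the mass of [p] enters only through its upper bound 1. *)
Lemma ew_avg_loss_le : (\int[mu]_x (p x)%:E <= 1)%E ->
  \sum_k ((tnth y k) ^+ 2 - 2 * tnth y k * ew_mean k y + ew_sqr k y) <=
  - 4 * ln (ew_total y).
Proof.
move=> p1; set z := ew_total y.
have i0 := integrable_ew_weight y.
have i1 k : mu.-integrable setT (fun x => (zeta k x * ew_weight y x)%:E).
  exact: (integrable_ew_moment k 1 y).
have i2 k := integrable_ew_moment k 2 y.
have [il lE] := integrable_sqdist_mul y i1 i2 i0.
have pR : \int[mu]_x p x <= 1.
  by rewrite -lee_fin Rintegral_fineE.
have ptw x : z^-1 * ew_weight y x + - 1 * p x <=
    (- ln z / z) * ew_weight y x +
    (- (4 * z)^-1) * (sqdist y x * ew_weight y x).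
  rewrite /ew_weight; set l := sqdist y x; set e := expR (- l / 4).
  have e0 : 0 < e by exact: expR_gt0.
  have : ln (z / e) <= z / e - 1.
    have := expR_ge1Dx (ln (z / e)); rewrite lnK ?posrE ?divr_gt0//.
    by rewrite lerBrDr addrC.
  rewrite ln_div ?posrE// expRK => h.
  rewrite -subr_ge0.
  rewrite (_ : _ - _ = (z / e - 1 - (ln z - - l / 4)) * (e / z * p x)).
    by rewrite mulr_ge0 ?subr_ge0// mulr_ge0// divr_ge0// ltW.
  by field; rewrite !gt_eqF.
have := le_Rintegral_real (integrableD_real (integrableZ_real _ i0) (integrableZ_real _ ip))
  (integrableD_real (integrableZ_real _ i0) (integrableZ_real _ il)) ptw.
rewrite (Rintegral_lin2 _ _ i0 ip) (Rintegral_lin2 _ _ i0 il).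
rewrite -[\int[mu]_x ew_weight y x]/z lE => h.
have -> : \sum_k ((tnth y k) ^+ 2 - 2 * tnth y k * ew_mean k y + ew_sqr k y) =
  (\sum_k ((tnth y k) ^+ 2 * z
    - 2 * tnth y k * (\int[mu]_x (zeta k x * ew_weight y x))
    + \int[mu]_x (zeta k x ^+ 2 * ew_weight y x))) / z.
  rewrite mulr_suml; apply: eq_bigr => k _.
  rewrite -[\int[mu]_x (zeta k x * _)]/(ew_moment k 1 y).
  rewrite -[\int[mu]_x (zeta k x ^+ 2 * _)]/(ew_moment k 2 y) /ew_mean /ew_sqr -/z.
  by field; rewrite gt_eqF.
move: h; set s := \sum_k _ => h.
have zV : z^-1 * z = 1 by rewrite mulVf// gt_eqF.
have : 0 <= (- ln z / z) * z + (- (4 * z)^-1) * s.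
  by apply: le_trans h; rewrite zV; lra.
rewrite (_ : - ln z / z * z = - ln z); last by rewrite -mulrA zV mulr1.
rewrite (_ : - (4 * z)^-1 * s = - (s / z) / 4); last by field; rewrite gt_eqF.
lra.
Qed.

End positive_total.

Section comparison.
Context (q : S -> R) (C : R) (C0 : 0 < C) (mq : measurable_fun setT q)
  (q0 : forall x, 0 <= q x) (q1 : (\int[mu]_x (q x)%:E = 1)%E)
  (qCp : forall x, q x <= C * p x)
  (iq2 : forall k, mu.-integrable setT (fun x => (zeta k x ^+ 2 * q x)%:E)).

Lemma integrable_comparison : mu.-integrable setT (fun x => (q x)%:E).
Proof.
apply/integrableP; split; first exact/measurable_EFinP.
by under eq_integral do rewrite gee0_abs ?lee_fin//; rewrite q1 ltry.
Qed.

Lemma integrable_zeta_comparison k :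
  mu.-integrable setT (fun x => (zeta k x * q x)%:E).
Proof.
apply: (le_integrable measurableT) (integrableD_real integrable_comparison (iq2 k)).
  by apply/measurable_EFinP/measurable_funM.
move=> x _; rewrite !abse_EFin lee_fin normrM (ger0_norm (q0 x)).
rewrite [leRHS]ger0_norm; last by rewrite addr_ge0// mulr_ge0// sqr_ge0.
rewrite -[X in X + _]mul1r -mulrDl ler_wpM2r//.
rewrite -[zeta k x ^+ 2]real_normK ?num_real//.
by have := sqr_ge0 (`|zeta k x| - 1); have := normr_ge0 (zeta k x); nra.
Qed.

(** The [q]-average of [sqdist y], expanded in coordinates so that its dependence on [y] is
    explicit: the quadratic term will cancel and the linear one is centered. *)
Definition comparison_loss y : R :=
  \sum_k ((tnth y k) ^+ 2 - 2 * tnth y k * (\int[mu]_x (zeta k x * q x))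
    + \int[mu]_x (zeta k x ^+ 2 * q x)).

(** Jensen's inequality for the exponential under [q], after bounding [p] below by [q / C]. The
    tangent line at the mean exponent [a] is integrated instead of invoking convexity. *)
Lemma ew_total_lower y :
  C^-1 * expR (- comparison_loss y / 4) <= ew_total y.
Proof.
have iq := integrable_comparison.
have iq1 := integrable_zeta_comparison.
have [il lE] := integrable_sqdist_mul y iq1 iq2 iq.
have qR : \int[mu]_x q x = 1 by rewrite /Rintegral q1.
have {}lE : \int[mu]_x (sqdist y x * q x) = comparison_loss y.
  by rewrite lE; apply: eq_bigr => k _; rewrite qR mulr1.
set a := - comparison_loss y / 4.
have ptw x : (expR a * (1 - a)) * q x + (- expR a / 4) * (sqdist y x * q x) <=
    C * ew_weight y x.
  rewrite /ew_weight; set l := sqdist y x.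
  have h1 : expR (- l / 4) * q x <= C * (expR (- l / 4) * p x).
    by rewrite mulrCA ler_wpM2l// expR_ge0.
  apply: le_trans h1; rewrite mulrA -mulrDl ler_wpM2r//.
  have h2 := expR_ge1Dx (- l / 4 - a).
  have -> : expR (- l / 4) = expR a * expR (- l / 4 - a).
    by rewrite -expRD addrC subrK.
  have := ler_wpM2l (expR_ge0 a) h2; apply: le_trans.
  by rewrite le_eqVlt; apply/orP; left; apply/eqP; field.
have := le_Rintegral_real (integrableD_real (integrableZ_real _ iq) (integrableZ_real _ il))
  (integrableZ_real _ (integrable_ew_weight y)) ptw.
rewrite (Rintegral_lin2 _ _ iq il) RintegralZl//; last exact: integrable_ew_weight.
rewrite qR lE -[\int[mu]_x ew_weight y x]/(ew_total y) => h.
rewrite ler_pdivrMl//; apply: le_trans h.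
by rewrite le_eqVlt; apply/orP; left; apply/eqP; rewrite /a; field.
Qed.

Lemma ew_total_gt0 y : 0 < ew_total y.
Proof.
apply: lt_le_trans (ew_total_lower y).
by rewrite mulr_gt0 ?invr_gt0// expR_gt0.
Qed.

(** Here [ln C] stands in for the relative entropy of [q] with respect to [p], which it bounds
    because [q <= C * p]. *)
Lemma ew_loss_le y : (\int[mu]_x (p x)%:E <= 1)%E ->
  \sum_k ((tnth y k) ^+ 2 - 2 * tnth y k * ew_mean k y + ew_sqr k y) <=
  4 * ln C + comparison_loss y.
Proof.
move=> p1; apply: (le_trans (ew_avg_loss_le (ew_total_gt0 y) p1)).
have := ew_total_lower y.
rewrite -ler_ln ?posrE ?ew_total_gt0//; last first.
  by rewrite mulr_gt0 ?invr_gt0// expR_gt0.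
rewrite lnM ?posrE ?invr_gt0 ?expR_gt0// lnV ?posrE// expRK.
lra.
Qed.

End comparison.
End exponential_weights.

(** * Risk of the aggregate when the noise satisfies Stein's inequality *)

Section stein_inequality.
Context d (T : measurableType d) (R : realType) (P : probability T R).

(** Isolates what the aggregation argument uses of the shape of the noise law, beyond independence
    and the first two moments. *)
Definition stein_inequality (X : T -> R) : Prop :=
  forall psi dpsi : R -> R, continuous dpsi -> (forall t, 0 <= dpsi t) ->
    (forall t, is_derive t (1 : R) psi (dpsi t)) ->
    (\int[P]_w (X w * psi (X w))%:E <= \int[P]_w (dpsi (X w))%:E)%E.

End stein_inequality.

Section exponential_weights_risk.
Context d (S : measurableType d) (R : realType)
  (mu : {sigma_finite_measure set S -> \bar R}).
Context (n : nat) (zeta : 'I_n -> S -> R)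
  (mzeta : forall k, measurable_fun setT (zeta k)).
Context (p : S -> R) (p0 : forall x, 0 <= p x)
  (mp : measurable_fun setT p) (p1 : (\int[mu]_x (p x)%:E <= 1)%E).
Context (q : S -> R) (C : R) (C0 : 0 < C) (mq : measurable_fun setT q)
  (q0 : forall x, 0 <= q x) (q1 : (\int[mu]_x (q x)%:E = 1)%E)
  (qCp : forall x, q x <= C * p x)
  (iq2 : forall k, mu.-integrable setT (fun x => (zeta k x ^+ 2 * q x)%:E)).
Implicit Types (y : n.-tuple R) (k : 'I_n).

Local Notation mean := (ew_mean mu zeta p).
Local Notation sqr := (ew_sqr mu zeta p).

Let ip : mu.-integrable setT (fun x => (p x)%:E).
Proof.
apply/integrableP; split; first exact/measurable_EFinP.
by under eq_integral do rewrite gee0_abs ?lee_fin//; exact: le_lt_trans p1 (ltry _).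
Qed.

Let Z0 y : 0 < ew_total mu zeta p y.
Proof. exact: (ew_total_gt0 mzeta p0 ip C0 mq q0 q1 qCp iq2 y). Qed.

Definition set_coord k (t : R) y : n.-tuple R :=
  [tuple if i == k then t else tnth y i | i < n].

Lemma other_weight_set_coord k t y :
  other_weight zeta p k (set_coord k t y) = other_weight zeta p k y.
Proof.
apply/funext => x; rewrite /other_weight; congr (expR (- _ / 4) * _).
by apply: eq_bigr => i /negbTE ik; rewrite tnth_mktuple ik.
Qed.

Lemma tnth_set_coord k t y : tnth (set_coord k t y) k = t.
Proof. by rewrite tnth_mktuple eqxx. Qed.

Definition ew_slope k y : R := (sqr k y - mean k y ^+ 2) / 2.

Lemma ew_slope_ge0 k y : 0 <= ew_slope k y.
Proof. by rewrite divr_ge0// subr_ge0 (ew_mean_sqr_le mzeta p0 ip (Z0 _)). Qed.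

(** Moving the [k]-th coordinate leaves [other_weight] unchanged, so along this line the posterior
    mean is a quotient of two tilted moments of the same weight. *)
Lemma is_derive_ew_mean k y t :
  is_derive t (1 : R) (fun u => mean k (set_coord k u y))
    (ew_slope k (set_coord k t y)).
Proof.
pose J j u := tilted_moment mu (zeta k) (other_weight zeta p k y) j u.
have JE j u : J j u = tilted_moment mu (zeta k)
    (other_weight zeta p k (set_coord k u y)) j (tnth (set_coord k u y) k).
  by rewrite other_weight_set_coord tnth_set_coord.
have -> : (fun u => mean k (set_coord k u y)) = (fun u => J 1 u / J 0 u).
  by apply/funext => u; rewrite !JE (ew_meanE mzeta p0 ip).
have -> : ew_slope k (set_coord k t y) =
    (J 2 t / J 0 t - (J 1 t / J 0 t) ^+ 2) / 2.
  by rewrite /ew_slope (ew_meanE mzeta p0 ip) (ew_sqrE mzeta p0 ip) !JE.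
apply: is_derive_tilted_mean => //.
- exact: other_weight_ge0.
- exact: (integrable_other_weight mzeta p0 ip).
- by rewrite -/(J 0 t) JE; exact: (tilted_moment_gt0 mzeta p0 ip (Z0 _)).
Qed.

Lemma continuous_ew_slope k y : continuous (fun t => ew_slope k (set_coord k t y)).
Proof.
pose J j u := tilted_moment mu (zeta k) (other_weight zeta p k y) j u.
have JE j u : J j u = tilted_moment mu (zeta k)
    (other_weight zeta p k (set_coord k u y)) j (tnth (set_coord k u y) k).
  by rewrite other_weight_set_coord tnth_set_coord.
have -> : (fun t => ew_slope k (set_coord k t y)) =
    (fun t => (J 2 t / J 0 t - (J 1 t / J 0 t) ^+ 2) / 2).
  by apply/funext => t; rewrite /ew_slope (ew_meanE mzeta p0 ip) (ew_sqrE mzeta p0 ip) !JE.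
have cJ j : continuous (J j).
  apply: continuous_tilted_moment => //.
  - exact: other_weight_ge0.
  - exact: (integrable_other_weight mzeta p0 ip).
have J0 t : J 0 t != 0 by rewrite JE gt_eqF// (tilted_moment_gt0 mzeta p0 ip (Z0 _)).
move=> t; have cV : (fun u => (J 0 u)^-1) u @[u --> t] --> (J 0 t)^-1.
  by apply: cvgV => //; exact: cJ.
apply: cvgM; last exact: cvg_cst.
apply: cvgB; first by apply: cvgM => //; exact: cJ.
by rewrite /= expr2; under eq_fun do rewrite expr2; apply: cvgM; apply: cvgM => //; exact: cJ.
Qed.

Section expectation.
Context d' (T : measurableType d') (P : probability T R) (N : 'I_n -> {RV P >-> R}).
Context (indepN : mutually_independent N)
  (steinN : forall k, stein_inequality P (N k))
  (iN : forall k, P.-integrable setT (fun w => (N k w)%:E))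
  (EN0 : forall k, (\int[P]_w (N k w)%:E = 0)%E)
  (EN2 : forall k, (\int[P]_w (N k w ^+ 2)%:E <= 1)%E).

Local Notation intP f := (P.-integrable setT (fun w => (f w)%:E)).
Local Notation tupN := (noise_tuple N).

Let tupNE k w : tnth (tupN w) k = N k w.
Proof. by rewrite tnth_mktuple. Qed.

Let iN2 k : intP (fun w => N k w ^+ 2).
Proof.
apply/integrableP; split.
  by apply/measurable_EFinP; exact: measurable_funX.
under eq_integral do rewrite gee0_abs ?lee_fin ?sqr_ge0//.
exact: le_lt_trans (EN2 k) (ltry _).
Qed.

Let a k := \int[mu]_x (zeta k x * q x).
Let b k := \int[mu]_x (zeta k x ^+ 2 * q x).
(** A quadratic polynomial in the noise, hence integrable. It serves as the dominating function for
    the posterior quantities below, about whose growth in [y] nothing else is known. *)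
Let H y := 4 * ln C + \sum_k ((tnth y k) ^+ 2 - 2 * tnth y k * a k + b k).

Let leH y : \sum_k ((tnth y k - mean k y) ^+ 2 + (sqr k y - mean k y ^+ 2)) <= H y.
Proof.
have := ew_loss_le mzeta p0 ip C0 mq q0 q1 qCp iq2 y p1.
rewrite [X in _ <= X -> _](_ : _ = H y)//; apply: le_trans.
by apply: ler_sum => k _; rewrite le_eqVlt; apply/orP; left; apply/eqP; ring.
Qed.

Let leHk k y : (tnth y k - mean k y) ^+ 2 + (sqr k y - mean k y ^+ 2) <= H y.
Proof.
apply: le_trans (leH y); rewrite (bigD1 k)//= lerDl; apply: sumr_ge0 => i _.
by rewrite addr_ge0 ?sqr_ge0// subr_ge0 (ew_mean_sqr_le mzeta p0 ip (Z0 _)).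
Qed.

Let integrable_cst c : intP (fun=> c).
Proof. exact: finite_measure_integrable_cst. Qed.

Let iH : intP (fun w => H (tupN w)).
Proof.
apply: integrableD_real => //; apply: integrable_sum_real => k.
under eq_fun do rewrite tupNE.
apply: integrableD_real => //.
rewrite (_ : (fun _ => _) =
  (fun w => (N k w ^+ 2 + (- 2 * a k) * N k w)%:E)); last first.
  by apply/funext => w; congr EFin; ring.
by apply: integrableD_real => //; exact: integrableZ_real.
Qed.

Let mN := measurable_noise_tuple N.

Let m_mean k : measurable_fun setT (mean k) := measurable_ew_mean mzeta p0 ip k.
Let m_sqr k : measurable_fun setT (sqr k) := measurable_ew_sqr mzeta p0 ip k.

Let mean2 k w : mean k (tupN w) ^+ 2 <= 2 * N k w ^+ 2 + 2 * H (tupN w).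
Proof.
have := leHk k (tupN w); rewrite tupNE.
have : 0 <= sqr k (tupN w) - mean k (tupN w) ^+ 2.
  by rewrite subr_ge0 (ew_mean_sqr_le mzeta p0 ip (Z0 _)).
set m := mean k _; set s := sqr k _; set h := H _; set x := N k w.
(* This square equals [2 x^2 + 2 (x - m)^2 - m^2]. *)
have := sqr_ge0 (x + (x - m)); rewrite !expr2; nra.
Qed.

Let imean2 k : intP (fun w => mean k (tupN w) ^+ 2).
Proof.
apply: (le_integrable measurableT) (integrableD_real
  (integrableZ_real 2 (iN2 k)) (integrableZ_real 2 iH)).
  apply/measurable_EFinP; apply: measurable_funX.
  exact: measurableT_comp (m_mean k) mN.
move=> w _; rewrite !abse_EFin lee_fin ger0_norm ?sqr_ge0//.
by rewrite (le_trans (mean2 k w))// ler_norm.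
Qed.

Let iNmean k : intP (fun w => N k w * mean k (tupN w)).
Proof.
apply: (le_integrable measurableT) (integrableD_real (iN2 k) (imean2 k)).
  apply/measurable_EFinP; apply: measurable_funM => //.
  exact: measurableT_comp (m_mean k) mN.
move=> w _; rewrite !abse_EFin lee_fin [leRHS]ger0_norm; last first.
  by rewrite addr_ge0// sqr_ge0.
set x := N k w; set m := mean k _.
have h1 := sqr_ge0 (x + m); have h2 := sqr_ge0 (x - m).
rewrite ler_norml; apply/andP; move: h1 h2; rewrite !expr2; split; nra.
Qed.

Let islope k : intP (fun w => ew_slope k (tupN w)).
Proof.
apply: (le_integrable measurableT) iH.
  apply/measurable_EFinP; apply: measurable_funM => //.
  apply: measurable_funB; first exact: measurableT_comp (m_sqr k) mN.
  by apply: measurable_funX; exact: measurableT_comp (m_mean k) mN.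
move=> w _; rewrite !abse_EFin lee_fin ger0_norm ?ew_slope_ge0//.
apply: le_trans (ler_norm _); apply: le_trans (leHk k _).
rewrite /ew_slope; have := sqr_ge0 (tnth (tupN w) k - mean k (tupN w)).
have : 0 <= sqr k (tupN w) - mean k (tupN w) ^+ 2.
  by rewrite subr_ge0 (ew_mean_sqr_le mzeta p0 ip (Z0 _)).
lra.
Qed.

(* Conditionally on the other coordinates this is Stein's inequality for the
   [k]-th one. *)
Lemma expectation_noise_mean_le k :
  (\int[P]_w (N k w * mean k (tupN w))%:E <=
   \int[P]_w (ew_slope k (tupN w))%:E)%E.
Proof.
pose F y := tnth y k * mean k y.
have mF : measurable_fun [set: n.-tuple R] F.
  by apply: measurable_funM => //; exact: measurable_tnth.
have mG : measurable_fun [set: n.-tuple R] (ew_slope k).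
  apply: measurable_funM => //; apply: measurable_funB => //.
  exact: measurable_funX.
have iF : P.-integrable setT (EFin \o F \o tupN).
  rewrite (_ : _ \o _ = fun w => (N k w * mean k (tupN w))%:E)//.
  by apply/funext => w /=; rewrite /F tupNE.
rewrite (_ : (\int[P]_w (N k w * mean k (tupN w))%:E =
    \int[P]_w (F (tupN w))%:E)%E); last first.
  by apply: eq_integral => w _; rewrite /F tupNE.
rewrite (integral_resample indepN k mF iF).
rewrite (integral_resample indepN k mG (islope k)).
apply: le_integral => //.
(* The inner integrals are compared for every [w]; their integrability in [w] is part of Fubini's
   theorem. *)
- exact: (integrable_fubini_F (integrable_resample indepN k mF iF)).
- exact: (integrable_fubini_F (integrable_resample indepN k mG (islope k))).
move=> w _.
have rE w' : resample N k (w, w') = set_coord k (N k w') (tupN w).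
  by apply: eq_from_tnth => i; rewrite !tnth_mktuple/=; case: eqP => // ->.
under eq_integral do rewrite rE /F tnth_set_coord.
under [leRHS]eq_integral do rewrite rE.
apply: (steinN k (psi := fun t => mean k (set_coord k t (tupN w)))
  (dpsi := fun t => ew_slope k (set_coord k t (tupN w)))).
- exact: continuous_ew_slope.
- by move=> t; exact: ew_slope_ge0.
- by move=> t; exact: is_derive_ew_mean.
Qed.

(** In the Gibbs bound the squares of the noise cancel and the terms linear in the noise alone have
    mean 0. Besides the squared means there remains [2 * (N * mean) - 2 * slope], because the
    variance is twice the slope; its expectation is non-positive by Stein's inequality. *)
Theorem ew_risk_bound :
  (\int[P]_w (\sum_k mean k (tupN w) ^+ 2)%:E <=
   (4 * ln C + \sum_k \int[mu]_x (zeta k x ^+ 2 * q x))%:E)%E.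
Proof.
pose G w := (4 * ln C + \sum_k b k) + (\sum_k (- 2 * a k) * N k w +
  \sum_k (2 * (N k w * mean k (tupN w)) + - 2 * ew_slope k (tupN w))).
have iS2 : intP (fun w =>
    \sum_k (2 * (N k w * mean k (tupN w)) + - 2 * ew_slope k (tupN w))).
  by apply: integrable_sum_real => k; apply: integrableD_real; exact: integrableZ_real.
have iS1 : intP (fun w => \sum_k (- 2 * a k) * N k w).
  by apply: integrable_sum_real => k; exact: integrableZ_real.
have iG : intP G by apply: integrableD_real => //; exact: integrableD_real.
have im : intP (fun w => \sum_k mean k (tupN w) ^+ 2).
  exact: integrable_sum_real.
rewrite -Rintegral_fineE// lee_fin.
apply: (@le_trans _ _ (\int[P]_w G w)).
  apply: le_Rintegral_real => // w.
  have := leH (tupN w); rewrite /H /G => h.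
  rewrite -subr_ge0; move: h; rewrite -subr_ge0; congr (0 <= _).
  rewrite -!addrA; congr (_ + _); rewrite -!sumrN -!big_split/=.
  apply: eq_bigr => k _; by rewrite tupNE /ew_slope; field.
rewrite /G RintegralD//; last 2 first.
- exact: integrable_cst.
- exact: integrableD_real.
rewrite Rintegral_cst// RintegralD//.
rewrite Rintegral_sum; last by move=> k; exact: integrableZ_real.
rewrite Rintegral_sum; last first.
  by move=> k; apply: integrableD_real; exact: integrableZ_real.
have -> : fine (P setT) = 1 by rewrite probability_setT.
rewrite mulr1 gerDl [X in X + _]big1 ?add0r => [|k _]; last first.
  have Nk0 : \int[P]_w N k w = 0 by rewrite /Rintegral EN0.
  by rewrite (RintegralZl _ measurableT (iN k)) Nk0 mulr0.
apply: sumr_le0 => k _.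
rewrite (Rintegral_lin2 _ _ (iNmean k) (islope k)).
have := expectation_noise_mean_le k.
rewrite -!Rintegral_fineE// lee_fin; lra.
Qed.

End expectation.
End exponential_weights_risk.

(** * Prior and comparison densities *)

Section product_sigma_finite.
Context d1 d2 (T1 : measurableType d1) (T2 : measurableType d2) (R : realType).
Context (mu : {sigma_finite_measure set T1 -> \bar R})
  (nu : {sigma_finite_measure set T2 -> \bar R}).

(** A named copy of the product measure to carry a sigma-finite structure. It is convertible with
    the original, so integrals pass from one to the other by conversion. *)
Definition sf_product : set (T1 * T2) -> \bar R := (mu \x nu)%E.

HB.instance Definition _ := Measure.on sf_product.

Let sf_product_sigma_finite : sigma_finite setT sf_product.
Proof.
have /sigma_finiteP[F [TF ndF Foo]] := sigma_finiteT mu.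
have /sigma_finiteP[G [TG ndG Goo]] := sigma_finiteT nu.
exists (fun k => F k `*` G k).
  apply/esym; rewrite -setXTT TF TG predeqE => -[x y]; split.
    by move=> [k _ []/= ? ?]; split; exists k.
  move=> [/= [i _ Fix] [j _ Gjy]]; exists (maxn i j) => //; split.
  - by move: x Fix; exact/subsetPset/ndF/leq_maxl.
  - by move: y Gjy; exact/subsetPset/ndG/leq_maxr.
move=> k; have [mF Fk] := Foo k; have [mG Gk] := Goo k.
split; first exact: measurableX.
by rewrite /sf_product product_measure1E// lte_mul_pinfty// ge0_fin_numE.
Qed.

HB.instance Definition _ := Measure_isSigmaFinite.Build _ _ _ sf_product
  sf_product_sigma_finite.

End product_sigma_finite.

Section power_measure_integral.
Context d (T : measurableType d) (R : realType)
  (mu : {sigma_finite_measure set T -> \bar R}).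

Lemma measurable_prod_tnth n (F : 'I_n -> T -> R) :
  (forall i, measurable_fun setT (F i)) ->
  measurable_fun [set: n.-tuple T] (fun t => \prod_i F i (tnth t i)).
Proof.
move=> mF.
apply: (@measurable_prod _ _ R setT _ _ (fun i (t : n.-tuple T) => F i (tnth t i))).
by move=> i _; have := measurableT_comp (mF i) (measurable_tnth i); apply.
Qed.

Lemma ge0_integral_power_measureS n (f : n.+1.-tuple T -> \bar R) :
  measurable_fun setT f -> (forall t, 0 <= f t)%E ->
  (\int[power_measure mu n.+1]_t f t =
   \int[mu]_x \int[power_measure mu n]_t f [tuple of x :: t])%E.
Proof.
move=> mf f0.
have mf' : measurable_fun setT (f \o @tuple_cons _ T n).
  by apply: measurableT_comp mf _; exact: measurable_tuple_cons.
transitivity (\int[mu \x power_measure mu n]_z (f \o @tuple_cons _ T n) z)%E.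
  rewrite -[LHS]/(\int[pushforward (mu \x power_measure mu n)%E
    (@tuple_cons _ T n)]_t f t)%E.
  rewrite ge0_integral_pushforward//.
  exact: measurable_tuple_cons.
apply: etrans (@fubini_tonelli1 _ _ _ _ _ mu (power_measure mu n) _ mf'
  (fun z => f0 _)) _.
by [].
Qed.

Lemma integral_power_measure_prod n (F : 'I_n -> T -> R) :
  (forall i, measurable_fun setT (F i)) -> (forall i x, 0 <= F i x) ->
  (\int[power_measure mu n]_t (\prod_i F i (tnth t i))%:E =
   \prod_i \int[mu]_x (F i x)%:E)%E.
Proof.
elim: n F => [|n ih] F mF F0.
  rewrite big_ord0 -[LHS]/(\int[\d_ [tuple]]_t _)%E.
  under eq_integral do rewrite big_ord0.
  by rewrite integral_dirac// diracT mul1e.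
rewrite ge0_integral_power_measureS; last 2 first.
- by apply/measurable_EFinP; exact: measurable_prod_tnth.
- by move=> t; rewrite lee_fin prodr_ge0.
rewrite [RHS]big_ord_recl.
have <- := ih (fun i => F (lift ord0 i)) (fun i => mF _) (fun i => F0 _).
rewrite -ge0_integralZr//; last 3 first.
- exact/measurable_EFinP.
- by move=> x _; rewrite lee_fin.
- by apply: integral_ge0 => t _; rewrite lee_fin prodr_ge0.
apply: eq_integral => x _.
rewrite -ge0_integralZl//; last 3 first.
- apply/measurable_EFinP.
  exact: (measurable_prod_tnth (fun i => mF (lift ord0 i))).
- by move=> t _; rewrite lee_fin prodr_ge0.
- by rewrite lee_fin.
apply: eq_integral => t _; rewrite -EFinM big_ord_recl; congr (_ * _)%:E.
by apply: eq_bigr => i _; rewrite tnthS.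
Qed.

End power_measure_integral.

Section param_integral.
Context (R : realType) (m1 m2 K : nat).

Local Notation M := (measurableTypeR R).

(** Convertible with [lebesgue_param], but with the sigma-finiteness that the aggregation results
    ask for. *)
Definition sf_lebesgue_param :
    {sigma_finite_measure set (param R m1 m2 K) -> \bar R} :=
  sf_product (sf_product (lebesgue_mx R m1 K) (lebesgue_mx R m2 K))
    (lebesgue_rv R K).

(** Tonelli with the scales outermost: once they are fixed, the two factors are independent. *)
Lemma integral_param_prod
    (A : m1.-tuple (K.-tuple M) -> K.-tuple M -> R)
    (B : m2.-tuple (K.-tuple M) -> K.-tuple M -> R)
    (h : K.-tuple M -> R) :
  measurable_fun setT (fun z => A z.1 z.2) ->
  measurable_fun setT (fun z => B z.1 z.2) ->
  measurable_fun setT h ->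
  (forall U g, 0 <= A U g) -> (forall V g, 0 <= B V g) -> (forall g, 0 <= h g) ->
  (\int[lebesgue_param R m1 m2 K]_x (A x.1.1 x.2 * B x.1.2 x.2 * h x.2)%:E =
   \int[lebesgue_rv R K]_g ((\int[lebesgue_mx R m1 K]_U (A U g)%:E) *
     (\int[lebesgue_mx R m2 K]_V (B V g)%:E) * (h g)%:E))%E.
Proof.
move=> mA mB mh A0 B0 h0.
rewrite -[LHS]/(\int[sf_product (lebesgue_mx R m1 K) (lebesgue_mx R m2 K) \x
  lebesgue_rv R K]_x (A x.1.1 x.2 * B x.1.2 x.2 * h x.2)%:E)%E.
rewrite fubini_tonelli2; last 2 first.
- apply/measurable_EFinP; apply: measurable_funM; first apply: measurable_funM.
  + have m : measurable_fun setT
        (fun x : param R m1 m2 K => (x.1.1, x.2)).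
      apply/measurable_fun_pair => //.
      by have := measurableT_comp (@measurable_fst _ _ _ _) (@measurable_fst _ _ _ _); apply.
    by have := measurableT_comp mA m; apply.
  + have m : measurable_fun setT
        (fun x : param R m1 m2 K => (x.1.2, x.2)).
      apply/measurable_fun_pair => //.
      by have := measurableT_comp (@measurable_snd _ _ _ _) (@measurable_fst _ _ _ _); apply.
    by have := measurableT_comp mB m; apply.
  + exact: measurableT_comp.
- by move=> x; rewrite lee_fin !mulr_ge0.
apply: eq_integral => g _; rewrite /fubini_G/=.
have mAr : measurable_fun setT (fun U => A U g).
  by have := measurableT_comp mA (measurable_pair2 g); apply.
have mBr : measurable_fun setT (fun V => B V g).
  by have := measurableT_comp mB (measurable_pair2 g); apply.
have mAg : measurable_fun setT (fun U => (A U g)%:E) by exact/measurable_EFinP.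
have mBg : measurable_fun setT (fun V => (B V g)%:E) by exact/measurable_EFinP.
transitivity (\int[lebesgue_mx R m1 K]_U \int[lebesgue_mx R m2 K]_V
    (A U g * B V g * h g)%:E)%E.
  apply: (@fubini_tonelli1 _ _ _ _ _ (lebesgue_mx R m1 K) (lebesgue_mx R m2 K)
    (fun z => (A z.1 g * B z.2 g * h g)%:E)).
  - apply/measurable_EFinP; apply: measurable_funM => //; apply: measurable_funM.
    + by have := measurableT_comp mAr (@measurable_fst _ _ _ _); apply.
    + by have := measurableT_comp mBr (@measurable_snd _ _ _ _); apply.
  - by move=> x; rewrite lee_fin !mulr_ge0.
transitivity (\int[lebesgue_mx R m1 K]_U ((A U g)%:E *
    ((\int[lebesgue_mx R m2 K]_V (B V g)%:E) * (h g)%:E)))%E.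
  apply: eq_integral => U _.
  rewrite -ge0_integralZr//; last 2 first.
  - by move=> V _; rewrite lee_fin.
  - by rewrite lee_fin.
  rewrite -ge0_integralZl//; last 3 first.
  - exact: emeasurable_funM.
  - by move=> V _; rewrite -EFinM lee_fin mulr_ge0.
  - by rewrite lee_fin.
  by apply: eq_integral => V _; rewrite -!EFinM mulrA.
rewrite ge0_integralZr// ?muleA//.
- by move=> U _; rewrite lee_fin.
- by rewrite mule_ge0 ?lee_fin// integral_ge0// => V _; rewrite lee_fin.
Qed.

End param_integral.

Section matrix_density.
Context (R : realType) (m K : nat).

Local Notation M := (measurableTypeR R).
Local Notation mxT := (m.-tuple (K.-tuple M)).
Implicit Types (a : 'I_m -> 'I_K -> R -> R -> R) (U : mxT) (g : K.-tuple M).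

(** The argument [a i l s u] is the density at [u] of the entry [(i, l)] when the scale of its
    column is [s]. Prior and comparison densities are both of this form. *)
Definition mx_density a U g : R :=
  \prod_i \prod_l a i l (tnth g l) (tnth (tnth U i) l).

Definition mx_sqdist (U0 : 'M[R]_(m, K)) U : R :=
  \sum_i \sum_l (tnth (tnth U i) l - U0 i l) ^+ 2.

Lemma measurable_entry i l : measurable_fun setT (fun U => tnth (tnth U i) l : R).
Proof.
by have := measurableT_comp (measurable_tnth l) (measurable_tnth i); apply.
Qed.

Lemma measurable_mx_density a :
  (forall i l, measurable_fun [set: M * M] (fun z => a i l z.1 z.2)) ->
  measurable_fun setT (fun z : mxT * K.-tuple M => mx_density a z.1 z.2).
Proof.
move=> ma.
apply: (@measurable_prod _ _ R setT _ _ (fun i (z : mxT * K.-tuple M) =>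
  \prod_l a i l (tnth z.2 l) (tnth (tnth z.1 i) l))) => i _.
apply: (@measurable_prod _ _ R setT _ _ (fun l (z : mxT * K.-tuple M) =>
  a i l (tnth z.2 l) (tnth (tnth z.1 i) l))) => l _.
have mz : measurable_fun [set: mxT * K.-tuple M]
    (fun z => (tnth z.2 l, tnth (tnth z.1 i) l)).
  apply/measurable_fun_pair.
    by have := measurableT_comp (measurable_tnth l) (@measurable_snd _ _ _ _); apply.
  by have := measurableT_comp (measurable_entry i l) (@measurable_fst _ _ _ _); apply.
by have := measurableT_comp (ma i l) mz; apply.
Qed.

Lemma measurable_mx_sqdist (U0 : 'M[R]_(m, K)) : measurable_fun setT (mx_sqdist U0).
Proof.
apply: (@measurable_sum _ _ R setT _ _ (fun i U =>
  \sum_l (tnth (tnth U i) l - U0 i l) ^+ 2)) => i.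
apply: (@measurable_sum _ _ R setT _ _ (fun l U =>
  (tnth (tnth U i) l - U0 i l) ^+ 2)) => l.
apply: measurable_funX; apply: measurable_funB => //.
exact: measurable_entry.
Qed.

Lemma mx_sqdist_ge0 (U0 : 'M[R]_(m, K)) U : 0 <= mx_sqdist U0 U.
Proof. by apply: sumr_ge0 => i _; apply: sumr_ge0 => l _; exact: sqr_ge0. Qed.

Lemma frob_mx_sqdist (U0 : 'M[R]_(m, K)) U : frob (mx_of_rows U - U0) ^+ 2 = mx_sqdist U0 U.
Proof.
rewrite /frob sqr_sqrtr; last first.
  by apply: sumr_ge0 => i _; apply: sumr_ge0 => l _; exact: sqr_ge0.
by apply: eq_bigr => i _; apply: eq_bigr => l _; rewrite !mxE.
Qed.

Lemma mx_density_ge0 a U g : (forall i l s u, 0 <= a i l s u) ->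
  0 <= mx_density a U g.
Proof. by move=> a0; apply: prodr_ge0 => i _; apply: prodr_ge0. Qed.

Lemma integral_mx_density a g :
  (forall i l, measurable_fun [set: M * M] (fun z => a i l z.1 z.2)) ->
  (forall i l s u, 0 <= a i l s u) ->
  (\int[lebesgue_mx R m K]_U (mx_density a U g)%:E =
   \prod_i \prod_l \int[lebesgue_measure]_u (a i l (tnth g l) u)%:E)%E.
Proof.
move=> ma a0.
have ma1 i l : measurable_fun [set: M] (a i l (tnth g l)).
  by have := measurableT_comp (ma i l) (measurable_pair1 (tnth g l : M)); apply.
rewrite (integral_power_measure_prod (lebesgue_rv R K)
  (F := fun i (t : K.-tuple M) => \prod_l a i l (tnth g l) (tnth t l))).
- apply: eq_bigr => i _.
  exact: (integral_power_measure_prod (@lebesgue_measure R)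
    (F := fun l => a i l (tnth g l))).
- by move=> i; exact: (@measurable_prod_tnth _ M R K (fun l => a i l (tnth g l))).
- by move=> i t; apply: prodr_ge0.
Qed.

Lemma integral_mx_density1 a g :
  (forall i l, measurable_fun [set: M * M] (fun z => a i l z.1 z.2)) ->
  (forall i l s u, 0 <= a i l s u) ->
  (forall i l, \int[lebesgue_measure]_u (a i l (tnth g l) u)%:E = 1)%E ->
  (\int[lebesgue_mx R m K]_U (mx_density a U g)%:E = 1)%E.
Proof.
move=> ma a0 a1; rewrite integral_mx_density//.
by rewrite big1// => i _; rewrite big1.
Qed.

Lemma integral_mx_sqdist_density a g (U0 : 'M[R]_(m, K)) (c : 'I_m -> 'I_K -> R) :
  (forall i l, measurable_fun [set: M * M] (fun z => a i l z.1 z.2)) ->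
  (forall i l s u, 0 <= a i l s u) ->
  (forall i l, \int[lebesgue_measure]_u (a i l (tnth g l) u)%:E = 1)%E ->
  (forall i l, \int[lebesgue_measure]_u
     ((u - U0 i l) ^+ 2 * a i l (tnth g l) u)%:E <= (c i l)%:E)%E ->
  (\int[lebesgue_mx R m K]_U (mx_sqdist U0 U * mx_density a U g)%:E <=
   (\sum_i \sum_l c i l)%:E)%E.
Proof.
move=> ma a0 a1 ac.
(* The square of one entry is absorbed into the factor of that entry. The product form survives, and
   all other factors integrate to 1. *)
pose a' i l i' l' s u :=
  if (i' == i) && (l' == l) then (u - U0 i l) ^+ 2 * a i l s u else a i' l' s u.
have ma' i l i' l' : measurable_fun [set: M * M] (fun z => a' i l i' l' z.1 z.2).
  rewrite /a'; case: (_ && _) => //; apply: measurable_funM => //.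
  by apply: measurable_funX; apply: measurable_funB.
have a'0 i l i' l' s u : 0 <= a' i l i' l' s u.
  by rewrite /a'; case: ifP => // _; rewrite mulr_ge0// sqr_ge0.
have a'E i l U : (tnth (tnth U i) l - U0 i l) ^+ 2 * mx_density a U g =
    mx_density (a' i l) U g.
  rewrite /mx_density (bigD1 i)//= [in RHS](bigD1 i)//= mulrA; congr (_ * _).
    rewrite (bigD1 l)//= [in RHS](bigD1 l)//= mulrA; congr (_ * _).
      by rewrite /a' !eqxx.
    by apply: eq_bigr => j /negbTE jl; rewrite /a' eqxx jl.
  apply: eq_bigr => j /negbTE ji; apply: eq_bigr => k _.
  by rewrite /a' ji.
have m' i l : measurable_fun [set: mxT] (fun U => (mx_density (a' i l) U g)%:E).
  apply/measurable_EFinP.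
  by have := measurableT_comp (measurable_mx_density (ma' i l)) (measurable_pair2 g); apply.
rewrite (_ : (\int[_]_U _)%E = (\int[lebesgue_mx R m K]_U
    \sum_i \sum_l (mx_density (a' i l) U g)%:E)%E); last first.
  apply: eq_integral => U _; rewrite /mx_sqdist mulr_suml -sumEFin.
  apply: eq_bigr => i _; rewrite mulr_suml -sumEFin.
  by apply: eq_bigr => l _; rewrite a'E.
rewrite ge0_integral_sum//; last 2 first.
- by move=> i; apply: emeasurable_sum.
- by move=> i U _; apply: sume_ge0 => l _; rewrite lee_fin mx_density_ge0.
rewrite -sumEFin; apply: lee_sum => i _.
rewrite ge0_integral_sum//; last by move=> l U _; rewrite lee_fin mx_density_ge0.
rewrite -sumEFin; apply: lee_sum => l _.
rewrite integral_mx_density//; apply: le_trans (ac i l).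
rewrite (bigD1 i)//= (bigD1 l)//= big1 => [|j /negbTE jl]; last first.
  by rewrite /a' eqxx jl/= a1.
rewrite big1 => [|j /negbTE ji]; last first.
  by rewrite big1// => k _; rewrite /a' ji/= a1.
by rewrite !mule1 /a' !eqxx.
Qed.

End matrix_density.

Section param_density.
Context (R : realType) (m1 m2 K : nat).

Local Notation M := (measurableTypeR R).
Context (a : 'I_m1 -> 'I_K -> R -> R -> R) (b : 'I_m2 -> 'I_K -> R -> R -> R)
  (h : 'I_K -> R -> R).
Context (ma : forall i l, measurable_fun [set: M * M] (fun z => a i l z.1 z.2))
  (mb : forall i l, measurable_fun [set: M * M] (fun z => b i l z.1 z.2))
  (mh : forall l, measurable_fun [set: M] (h l)).
Context (a0 : forall i l g u, 0 <= a i l g u) (b0 : forall i l g u, 0 <= b i l g u)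
  (h0 : forall l g, 0 <= h l g).

Definition param_density (x : param R m1 m2 K) : R :=
  mx_density a x.1.1 x.2 * mx_density b x.1.2 x.2 * \prod_l h l (tnth x.2 l).

Lemma param_density_ge0 x : 0 <= param_density x.
Proof. by rewrite !mulr_ge0 ?mx_density_ge0//; apply: prodr_ge0. Qed.

Let mhp : measurable_fun setT (fun g : K.-tuple M => \prod_l h l (tnth g l)).
Proof. exact: (measurable_prod_tnth mh). Qed.

Lemma measurable_param_density : measurable_fun setT param_density.
Proof.
have mx1 : measurable_fun setT (fun x : param R m1 m2 K => (x.1.1, x.2)).
  apply/measurable_fun_pair => //.
  by have := measurableT_comp (@measurable_fst _ _ _ _) (@measurable_fst _ _ _ _); apply.
have mx2 : measurable_fun setT (fun x : param R m1 m2 K => (x.1.2, x.2)).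
  apply/measurable_fun_pair => //.
  by have := measurableT_comp (@measurable_snd _ _ _ _) (@measurable_fst _ _ _ _); apply.
apply: measurable_funM; first apply: measurable_funM.
- by have := measurableT_comp (measurable_mx_density ma) mx1; apply.
- by have := measurableT_comp (measurable_mx_density mb) mx2; apply.
- by have := measurableT_comp mhp (@measurable_snd _ _ _ _); apply.
Qed.

Section moments.
Context (F : m1.-tuple (K.-tuple M) -> R) (G : m2.-tuple (K.-tuple M) -> R).
Context (mF : measurable_fun setT F) (mG : measurable_fun setT G)
  (F0 : forall U, 0 <= F U) (G0 : forall V, 0 <= G V).

Let mFa : measurable_fun setT (fun z : m1.-tuple (K.-tuple M) * K.-tuple M =>
  F z.1 * mx_density a z.1 z.2).
Proof.
apply: measurable_funM; last exact: measurable_mx_density.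
by have := measurableT_comp mF (@measurable_fst _ _ _ _); apply.
Qed.

Let mGb : measurable_fun setT (fun z : m2.-tuple (K.-tuple M) * K.-tuple M =>
  G z.1 * mx_density b z.1 z.2).
Proof.
apply: measurable_funM; last exact: measurable_mx_density.
by have := measurableT_comp mG (@measurable_fst _ _ _ _); apply.
Qed.

Let Fa0 U g : 0 <= F U * mx_density a U g.
Proof. by rewrite mulr_ge0// mx_density_ge0. Qed.

Let Gb0 U g : 0 <= G U * mx_density b U g.
Proof. by rewrite mulr_ge0// mx_density_ge0. Qed.

Let hp0 (g : K.-tuple M) : 0 <= \prod_l h l (tnth g l).
Proof. by apply: prodr_ge0. Qed.

Lemma integral_param_densityE :
  (\int[lebesgue_param R m1 m2 K]_x (F x.1.1 * G x.1.2 * param_density x)%:E =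
  \int[lebesgue_rv R K]_g
    ((\int[lebesgue_mx R m1 K]_U (F U * mx_density a U g)%:E) *
     (\int[lebesgue_mx R m2 K]_V (G V * mx_density b V g)%:E) *
     (\prod_l h l (tnth g l))%:E))%E.
Proof.
rewrite -integral_param_prod//.
by apply: eq_integral => x _; congr EFin; rewrite /param_density; ring.
Qed.

(** The bounds on the inner integrals are asked only where no scale density vanishes, since the
    integrand is 0 elsewhere. For the comparison density this confines the scales to their
    windows. *)
Lemma integral_param_density_le (x y : R) : 0 <= x -> 0 <= y ->
  (\prod_l \int[lebesgue_measure]_t (h l t)%:E <= 1)%E ->
  (forall g : K.-tuple M, (forall l, h l (tnth g l) != 0) ->
    (\int[lebesgue_mx R m1 K]_U (F U * mx_density a U g)%:E <= x%:E)%E) ->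
  (forall g : K.-tuple M, (forall l, h l (tnth g l) != 0) ->
    (\int[lebesgue_mx R m2 K]_V (G V * mx_density b V g)%:E <= y%:E)%E) ->
  (\int[lebesgue_param R m1 m2 K]_x (F x.1.1 * G x.1.2 * param_density x)%:E <=
    (x * y)%:E)%E.
Proof.
move=> x0 y0 h1 Fx Gy; rewrite integral_param_densityE.
apply: (@le_trans _ _ (\int[lebesgue_rv R K]_g
    ((x * y)%:E * (\prod_l h l (tnth g l))%:E)))%E.
  apply: ge0_le_integral => //.
  - move=> g _; rewrite !mule_ge0 ?integral_ge0 ?lee_fin// => U _.
      by rewrite lee_fin.
    by rewrite lee_fin.
  - apply: emeasurable_funM; last exact/measurable_EFinP.
    apply: emeasurable_funM.
    + apply: (@measurable_fun_fubini_tonelli_G _ _ _ _ R (lebesgue_mx R m1 K)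
        (fun z => (F z.1 * mx_density a z.1 z.2)%:E)); first exact/measurable_EFinP.
      by move=> z; rewrite lee_fin.
    + apply: (@measurable_fun_fubini_tonelli_G _ _ _ _ R (lebesgue_mx R m2 K)
        (fun z => (G z.1 * mx_density b z.1 z.2)%:E)); first exact/measurable_EFinP.
      by move=> z; rewrite lee_fin.
  - by apply: emeasurable_funM => //; exact/measurable_EFinP.
  - move=> g _.
    have [hg|] := pselect (forall l, h l (tnth g l) != 0).
      rewrite lee_wpmul2r ?lee_fin// EFinM lee_pmul// ?integral_ge0//.
      + by move=> U _; rewrite lee_fin.
      + by move=> U _; rewrite lee_fin.
      + exact: Fx.
      + exact: Gy.
    move=> /existsNP[l /negP]; rewrite negbK => /eqP hl.
    by rewrite (bigD1 l)//= hl mul0r !mule0.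
rewrite ge0_integralZl//; last 3 first.
- exact/measurable_EFinP.
- by move=> g _; rewrite lee_fin.
- by rewrite lee_fin mulr_ge0.
rewrite (integral_power_measure_prod (@lebesgue_measure R) mh h0).
by rewrite -[leRHS]mule1 lee_wpmul2l// lee_fin mulr_ge0.
Qed.

End moments.

Lemma integral_param_density1 :
  (\prod_l \int[lebesgue_measure]_t (h l t)%:E = 1)%E ->
  (forall g : K.-tuple M, (forall l, h l (tnth g l) != 0) -> forall i l,
    (\int[lebesgue_measure]_u (a i l (tnth g l) u)%:E = 1)%E) ->
  (forall g : K.-tuple M, (forall l, h l (tnth g l) != 0) -> forall i l,
    (\int[lebesgue_measure]_u (b i l (tnth g l) u)%:E = 1)%E) ->
  (\int[lebesgue_param R m1 m2 K]_x (param_density x)%:E = 1)%E.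
Proof.
move=> h1 a1 b1.
have := @integral_param_densityE (fun=> 1) (fun=> 1) (measurable_cst _)
  (measurable_cst _) (fun=> ler01) (fun=> ler01).
under eq_integral do rewrite mul1r mul1r.
move=> ->; rewrite -h1.
rewrite -(integral_power_measure_prod (@lebesgue_measure R) mh h0).
apply: eq_integral => g _.
have [hg|] := pselect (forall l, h l (tnth g l) != 0).
  under eq_integral do rewrite mul1r.
  under [X in (_ * X * _)%E]eq_integral do rewrite mul1r.
  rewrite !integral_mx_density1// ?mul1e//; [exact: b1|exact: a1].
move=> /existsNP[l /negP]; rewrite negbK => /eqP hl.
by rewrite (bigD1 l)//= hl mul0r mule0.
Qed.

End param_density.

(** * One-dimensional densities: scaling, half-line and boxes *)

Section lebesgue_scaling.
Context (R : realType).
Local Notation M := (measurableTypeR R).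
Local Open Scope ereal_scope.

(** The image of Lebesgue measure under division by [c], multiplied by [1/c], gives every interval
    its length, so it is Lebesgue measure again. *)
Lemma ge0_integral_scale (phi : R -> \bar R) (c : R) : (0 < c)%R ->
  measurable_fun [set: M] phi -> (forall x, 0 <= phi x) ->
  \int[lebesgue_measure]_u (c^-1%:E * phi (u / c)%R) =
  \int[lebesgue_measure]_x phi x.
Proof.
move=> c0 mphi phi0.
have c0' : (0 <= c^-1)%R by rewrite invr_ge0 ltW.
pose s (u : M) : M := (u / c)%R.
have ms : measurable_fun [set: M] s by exact: measurable_funM.
pose m : {measure set M -> \bar R} :=
  pushforward (@lebesgue_measure R) s.
pose m' : {measure set M -> \bar R} := mscale (NngNum c0') (m ms).
have mE A : measurable A -> lebesgue_measure A = m' A.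
  apply: lebesgue_measure_unique => X [[a b] _ <-].
  rewrite -[RHS]/((c^-1)%:E * lebesgue_measure (s @^-1` `]a, b]%classic)).
  have -> : s @^-1` `]a, b]%classic = `](a * c)%R, (b * c)%R]%classic.
    apply/seteqP; split => u /=; rewrite !in_itv/= /s.
      by rewrite ltr_pdivlMr// ler_pdivrMr.
    by rewrite ltr_pdivlMr// ler_pdivrMr.
  rewrite !lebesgue_measure_itv/= !lte_fin ltr_pM2r//.
  case: ifPn => ab; last by rewrite mule0.
  by rewrite -!EFinD -EFinM -mulrBl mulrC mulfK// gt_eqF.
rewrite (_ : \int[lebesgue_measure]_x phi x = \int[m']_x phi x); last first.
  by apply: eq_measure_integral => A mA _; exact: mE.
rewrite ge0_integral_mscale// ge0_integralZl//; last first.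
  by apply: measurableT_comp mphi ms.
congr (_ * _); rewrite /m ge0_integral_pushforward//.
Qed.

End lebesgue_scaling.

Section half_line_density.
Context (R : realType).
Local Notation M := (measurableTypeR R).
Implicit Types (f : R -> R).

(** The values of a density at negative arguments are unconstrained; setting them to 0 allows
    integration over the whole line. *)
Definition half_line f (x : R) : R := if 0 <= x then f x else 0.

Lemma half_lineE f : half_line f = f \_ `[0, +oo[%classic.
Proof.
apply/funext => x; rewrite /half_line patchE mem_setE in_itv/= andbT.
by [].
Qed.

Lemma measurable_half_line f :
  measurable_fun (`[0, +oo[%classic : set R) f ->
  measurable_fun [set: M] (half_line f).
Proof.
move=> mf; rewrite half_lineE.
exact: (measurable_restrictT f (measurable_itv _)).1 mf.
Qed.

Lemma integral_half_line f (A : set R) : measurable (A : set M) ->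
  (\int[lebesgue_measure]_(x in A) (half_line f x)%:E =
   \int[lebesgue_measure]_(x in A `&` `[0%R, +oo[) (f x)%:E)%E.
Proof.
move=> mA; rewrite integral_mkcondr; apply: eq_integral => x _.
by rewrite half_lineE restrict_EFin.
Qed.

(** An extension of [gscale] by 0 to all real scales and arguments, so that the prior can be
    integrated over the whole parameter space. *)
Definition scaled_density f (g u : R) : R :=
  if 0 < g then g^-1 * half_line f (u / g) else 0.

(** The left end is excluded so that [u > 0] even when [x0 = 0]: the lower bound on [f] is assumed
    at positive arguments only. *)
Definition box_density (c x0 u : R) : R :=
  if x0 < u <= x0 + c then c^-1 else 0.

Section is_density.
Context f (df : is_density f).

Let mf : measurable_fun [set: M] (half_line f).
Proof. by case: df => mf _ _; exact: measurable_half_line. Qed.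

Lemma half_line_ge0 x : 0 <= half_line f x.
Proof. by rewrite /half_line; case: ifP => // x0; case: df => _ + _; apply. Qed.

Lemma integral_half_line1 : (\int[lebesgue_measure]_x (half_line f x)%:E = 1)%E.
Proof. by rewrite integral_half_line// setTI; case: df. Qed.

Lemma scaled_density_ge0 g u : 0 <= scaled_density f g u.
Proof.
rewrite /scaled_density; case: ifP => // g0.
by rewrite mulr_ge0 ?half_line_ge0// invr_ge0 ltW.
Qed.

Lemma measurable_scaled_density :
  measurable_fun [set: M * M] (fun z => scaled_density f z.1 z.2).
Proof.
have mV : measurable_fun [set: M * M] (fun z => z.1^-1 : R).
  by have := measurableT_comp (@measurable_invr R) (@measurable_fst _ _ M M); apply.
apply: (measurable_fun_ifT (f := fun z : M * M => 0 < z.1)) => //.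
  by apply: measurable_fun_ltr.
apply: measurable_funM => //.
have md : measurable_fun [set: M * M] (fun z => (z.2 : R) / z.1 : M).
  by apply: measurable_funM.
by have := measurableT_comp mf md; apply.
Qed.

Lemma integral_scaled_density g : 0 < g ->
  (\int[lebesgue_measure]_u (scaled_density f g u)%:E = 1)%E.
Proof.
move=> g0; rewrite /scaled_density g0 -integral_half_line1.
rewrite -(@ge0_integral_scale _ (fun x => (half_line f x)%:E) g g0)//.
- exact/measurable_EFinP.
- by move=> x; rewrite lee_fin half_line_ge0.
Qed.

Lemma integral_scaled_density_sqr g : 0 < g -> (second_moment f < +oo)%E ->
  (\int[lebesgue_measure]_u (u ^+ 2 * scaled_density f g u)%:E <=
   (g ^+ 2 * S_ f)%:E)%E.
Proof.
move=> g0 f2; have g0' : g != 0 by rewrite gt_eqF.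
have h0 x : 0 <= x ^+ 2 * half_line f x by rewrite mulr_ge0 ?sqr_ge0 ?half_line_ge0.
have mh : measurable_fun [set: M] (fun x => (x ^+ 2 * half_line f x)%:E).
  by apply/measurable_EFinP/measurable_funM => //; exact: measurable_funX.
have -> : (\int[lebesgue_measure]_u (u ^+ 2 * scaled_density f g u)%:E =
    \int[lebesgue_measure]_u (g^-1%:E *
      ((g ^+ 2)%:E * ((u / g) ^+ 2 * half_line f (u / g))%:E)))%E.
  apply: eq_integral => u _; rewrite /scaled_density g0 -!EFinM; congr EFin.
  by field.
rewrite (@ge0_integral_scale _
  (fun x => ((g ^+ 2)%:E * (x ^+ 2 * half_line f x)%:E)%E))//; last 2 first.
- by apply: emeasurable_funM.
- by move=> x; rewrite -EFinM lee_fin mulr_ge0// sqr_ge0.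
rewrite ge0_integralZl//; last 2 first.
- by move=> x _; rewrite lee_fin.
- by rewrite lee_fin sqr_ge0.
rewrite [leRHS]EFinM; apply: lee_wpmul2l; first by rewrite lee_fin sqr_ge0.
have -> : (\int[lebesgue_measure]_x (x ^+ 2 * half_line f x)%:E = second_moment f)%E.
  rewrite /second_moment [RHS]integral_mkcond; apply: eq_integral => x _.
  by rewrite patchE mem_setE in_itv/= andbT /half_line; case: ifP; rewrite ?mulr0.
rewrite -(fineK (x := second_moment f)); last first.
  rewrite ge0_fin_numE// /second_moment integral_ge0// => x.
  rewrite /= in_itv/= andbT => x0; rewrite lee_fin mulr_ge0 ?sqr_ge0//.
  by case: df => _ + _; apply.
by rewrite lee_fin /S_ le_max lexx orbT.
Qed.

End is_density.

Section box.
Context (c x0 : R) (c0 : 0 < c).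

Lemma box_density_ge0 u : 0 <= box_density c x0 u.
Proof. by rewrite /box_density; case: ifP => // _; rewrite invr_ge0 ltW. Qed.

Lemma measurable_box_density : measurable_fun [set: M] (box_density c x0).
Proof.
apply: (measurable_fun_ifT (f := fun u : M => x0 < u <= x0 + c)) => //.
apply: measurable_and; first exact: measurable_fun_ltr.
exact: measurable_fun_ler.
Qed.

Lemma integral_box_density_mul (phi : R -> R) : measurable_fun [set: M] phi ->
  (\int[lebesgue_measure]_u (phi u * box_density c x0 u)%:E =
   \int[lebesgue_measure]_(u in `[x0, (x0 + c)%R]) (c^-1 * phi u)%:E)%E.
Proof.
move=> mphi; rewrite -integral_itv_obnd_cbnd; last first.
  by apply/measurable_EFinP/measurable_funTS; exact: measurable_funM.
rewrite [RHS]integral_mkcond; apply: eq_integral => u _.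
rewrite patchE mem_setE in_itv/= /box_density; case: ifP => _.
  by rewrite mulrC.
by rewrite mulr0.
Qed.

Lemma integral_box_density :
  (\int[lebesgue_measure]_u (box_density c x0 u)%:E = 1)%E.
Proof.
have := @integral_box_density_mul (fun=> 1) (measurable_cst _).
under eq_integral do rewrite mul1r.
move=> ->; rewrite mulr1.
rewrite [LHS](integral_cst _ _ (c^-1)%:E)//= lebesgue_measure_itv/= lte_fin ltrDl c0.
by rewrite -EFinD -EFinM addrAC subrr add0r mulVf// gt_eqF.
Qed.

(** The second moment is about the left end, not the center: boxes lie above the entries, which may
    be 0, because the prior charges non-negative values only. *)
Lemma integral_box_density_sqr :
  (\int[lebesgue_measure]_u ((u - x0) ^+ 2 * box_density c x0 u)%:E =
   (c ^+ 2 / 3)%:E)%E.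
Proof.
rewrite integral_box_density_mul; last first.
  by apply: measurable_funX; apply: measurable_funB.
pose psi (u : R) := (u - x0) ^+ 3 / 3.
have cdp : continuous (fun u : R => (u - x0) ^+ 2).
  rewrite (_ : (fun u => _) = (fun u : R => (u - x0) * (u - x0))) => [u|].
    by apply: cvgM; apply: cvgB; do ?[exact: cvg_id|exact: cvg_cst].
  by apply/funext => u; rewrite expr2.
have dp u : is_derive u (1 : R) psi ((u - x0) ^+ 2).
  have -> : psi = (3^-1 : R) \*: ((fun u : R => u - x0) ^+ 3).
    by apply/funext => v; rewrite /psi -[RHS]/(3^-1 * (v - x0) ^+ 3) mulrC.
  have hd : is_derive u (1 : R) (fun u : R => u - x0) 1.
    have -> : (fun u : R => u - x0) = id + cst (- x0) by [].
    apply: (is_derive_eq (is_deriveD (is_derive_id u 1) (is_derive_cst (- x0) u 1))).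
    exact: addr0.
  apply: (is_derive_eq (is_deriveZ 3^-1 (is_deriveX 3 hd))).
  by rewrite /GRing.scale/=; field.
have xc : x0 < x0 + c by rewrite ltrDl.
rewrite (integral_itv_derive cdp dp _ xc).
congr EFin; rewrite /psi subrr (_ : x0 + c - x0 = c); last ring.
by field; rewrite gt_eqF.
Qed.

End box.
End half_line_density.

Lemma mx_density_eq0 (R : realType) m K (a : 'I_m -> 'I_K -> R -> R -> R) U g i l :
  a i l (tnth g l) (tnth (tnth U i) l) = 0 -> mx_density a U g = 0.
Proof. by move=> a0; rewrite /mx_density (bigD1 i)//= (bigD1 l)//= a0 !mul0r. Qed.

Section prior.
Context (R : realType) (f h : R -> R) (df : is_density f) (dh : is_density h)
  (m1 m2 K : nat).
Local Notation M := (measurableTypeR R).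

Definition prior_product : param R m1 m2 K -> R :=
  param_density (fun _ _ => scaled_density f) (fun _ _ => scaled_density f)
    (fun=> half_line h).

Lemma scaled_density_gscale g u : 0 <= g -> 0 <= u ->
  scaled_density f g u = gscale f g u.
Proof.
rewrite le_eqVlt => /predU1P[<-|g0] u0.
  (* At scale 0 both sides are 0, since [0^-1 = 0]. *)
  by rewrite /scaled_density ltxx /gscale invr0 mul0r.
by rewrite /scaled_density g0 /half_line divr_ge0// ltW.
Qed.

Lemma scaled_density_lt0 g u : u < 0 -> scaled_density f g u = 0.
Proof.
rewrite /scaled_density; case: ifP => // g0 u0.
by rewrite /half_line leNgt pmulr_llt0 ?invr_gt0// u0 mulr0.
Qed.

Lemma prior_productE x : nonneg_param x ->
  prior_product x = prior_density f h (Upart x) (Vpart x) (gpart x).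
Proof.
move=> [U0 V0 g0]; rewrite /prior_product /param_density /prior_density.
rewrite !big_split/=; congr (_ * _ * _).
- rewrite /mx_density exchange_big/=; apply: eq_bigr => l _.
  apply: eq_bigr => i _; rewrite scaled_density_gscale//; first by rewrite mxE.
  by have := U0 i l; rewrite mxE.
- rewrite /mx_density exchange_big/=; apply: eq_bigr => l _.
  apply: eq_bigr => i _; rewrite scaled_density_gscale//; first by rewrite mxE.
  by have := V0 i l; rewrite mxE.
- by apply: eq_bigr => l _; rewrite /half_line g0.
Qed.

Lemma prior_product_eq0 x : ~ nonneg_param x -> prior_product x = 0.
Proof.
move=> nx; rewrite /prior_product /param_density.
have [U0|] := pselect (forall i l, 0 <= tnth (tnth x.1.1 i) l); last first.
  move=> /existsNP[i /existsNP[l /negP]]; rewrite -ltNge => lt0.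
  by rewrite (mx_density_eq0 (i := i) (l := l)) ?mul0r// scaled_density_lt0.
have [V0|] := pselect (forall i l, 0 <= tnth (tnth x.1.2 i) l); last first.
  move=> /existsNP[i /existsNP[l /negP]]; rewrite -ltNge => lt0.
  by rewrite [X in _ * X * _](mx_density_eq0 (i := i) (l := l))
    ?mulr0 ?mul0r// scaled_density_lt0.
have [g0|] := pselect (forall l, 0 <= tnth x.2 l); last first.
  move=> /existsNP[l /negP]; rewrite -ltNge => lt0.
  by rewrite [X in _ * X](bigD1 l)//= /half_line leNgt lt0 mul0r mulr0.
by exfalso; apply: nx; split => // i l; rewrite mxE.
Qed.

Let ms := measurable_scaled_density df.

Let mh : measurable_fun [set: M] (half_line h).
Proof. by case: dh => ? _ _; exact: measurable_half_line. Qed.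

Lemma prior_product_ge0 x : 0 <= prior_product x.
Proof.
apply: param_density_ge0.
- by move=> _ _; exact: scaled_density_ge0.
- by move=> _ _; exact: scaled_density_ge0.
- by move=> _; exact: half_line_ge0.
Qed.

Lemma measurable_prior_product : measurable_fun setT prior_product.
Proof. by apply: measurable_param_density => *; [exact: ms|exact: ms|exact: mh]. Qed.

Let integral_scaled_density_le1 g :
  (\int[lebesgue_measure]_u (scaled_density f g u)%:E <= 1)%E.
Proof.
have [g0|g0] := ltP 0 g; first by rewrite integral_scaled_density.
rewrite (_ : (fun u => _) = cst 0%E); first by rewrite integral0.
by apply/funext => u; rewrite /scaled_density ltNge g0.
Qed.

(** Not an equality, because [scaled_density] is 0 at non-positive scales; an upper bound on the
    mass of the prior is what the Gibbs bound asks for. *)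
Lemma integral_mx_scaled_density_le1 m (g : K.-tuple M) :
  (\int[lebesgue_mx R m K]_U (mx_density (fun _ _ => scaled_density f) U g)%:E <= 1)%E.
Proof.
rewrite integral_mx_density//; last by move=> *; exact: scaled_density_ge0.
pose le1 (x : \bar R) := (0 <= x <= 1)%E.
suff /andP[] : le1 (\prod_(i < m) \prod_l
  \int[lebesgue_measure]_u (scaled_density f (tnth g l) u)%:E)%E by [].
have le11 : le1 1%E by rewrite /le1 lee01 lexx.
have le1M x y : le1 x -> le1 y -> le1 (x * y)%E.
  move=> /andP[x0 x1] /andP[y0 y1]; rewrite /le1 mule_ge0//=.
  by rewrite -[leRHS]mule1 lee_pmul.
apply: (big_ind le1) => // i _; apply: (big_ind le1) => // l _.
rewrite /le1 integral_scaled_density_le1 andbT integral_ge0// => u _.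
by rewrite lee_fin scaled_density_ge0.
Qed.

Lemma integral_prior_product_le1 :
  (\int[lebesgue_param R m1 m2 K]_x (prior_product x)%:E <= 1)%E.
Proof.
have := @integral_param_density_le R m1 m2 K (fun _ _ => scaled_density f)
  (fun _ _ => scaled_density f) (fun=> half_line h) (fun _ _ => ms) (fun _ _ => ms)
  (fun=> mh) (fun _ _ => scaled_density_ge0 df) (fun _ _ => scaled_density_ge0 df)
  (fun=> half_line_ge0 dh) (fun=> 1) (fun=> 1) (measurable_cst _)
  (measurable_cst _) (fun=> ler01) (fun=> ler01) 1 1 ler01 ler01.
move=> le11; apply: (@le_trans _ _ (1 * 1 : R)%:E); last by rewrite mulr1.
rewrite [leLHS](_ : _ = (\int[lebesgue_param R m1 m2 K]_x
    (1 * 1 * prior_product x)%:E)%E); last first.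
  by apply: eq_integral => x _; rewrite !mul1r.
apply: le11.
- by rewrite big1// => l _; exact: integral_half_line1.
- move=> g _; under eq_integral do rewrite mul1r.
  exact: integral_mx_scaled_density_le1.
- move=> g _; under eq_integral do rewrite mul1r.
  exact: integral_mx_scaled_density_le1.
Qed.

End prior.

Section window_density.
Context (R : realType) (h : R -> R) (dh : is_density h).
Local Notation M := (measurableTypeR R).

Definition window_mass (s t : R) : R :=
  fine (\int[lebesgue_measure]_(x in `[s, t]) (h x)%:E)%E.

(** The density [h] conditioned to the window. Excluding the left end keeps the scale positive when
    [s = 0] and does not change the mass. *)
Definition window_density (s t g : R) : R :=
  (window_mass s t)^-1 * (if s < g <= t then half_line h g else 0).

Context (s t : R) (s0 : 0 <= s) (w0 : 0 < window_mass s t).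

Let mh : measurable_fun [set: M] (half_line h).
Proof. by case: dh => ? _ _; exact: measurable_half_line. Qed.

Lemma window_density_ge0 g : 0 <= window_density s t g.
Proof.
rewrite mulr_ge0 ?invr_ge0 ?(ltW w0)//; case: ifP => // _.
exact: half_line_ge0.
Qed.

Let mw : measurable_fun [set: M] (fun g : M => if s < g <= t then half_line h g else 0).
Proof.
apply: (measurable_fun_ifT (f := fun u : M => s < u <= t)) => //.
apply: measurable_and; first exact: measurable_fun_ltr.
exact: measurable_fun_ler.
Qed.

Lemma measurable_window_density : measurable_fun [set: M] (window_density s t).
Proof. exact: measurable_funM. Qed.

Lemma integral_windowE :
  (\int[lebesgue_measure]_(x in `[s, t]) (h x)%:E =
   \int[lebesgue_measure]_(x in `[s, t]) (half_line h x)%:E)%E.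
Proof.
apply: eq_integral => x; rewrite inE/= in_itv/= => /andP[sx _].
by rewrite /half_line (le_trans s0 sx).
Qed.

Lemma window_mass_fineE :
  (window_mass s t)%:E = (\int[lebesgue_measure]_(x in `[s, t]) (h x)%:E)%E.
Proof.
rewrite /window_mass fineK// integral_windowE ge0_fin_numE; last first.
  by apply: integral_ge0 => x _; rewrite lee_fin half_line_ge0.
rewrite (@le_lt_trans _ _ 1%E) ?ltry// -(integral_half_line1 dh).
apply: ge0_subset_integral => //; first exact/measurable_EFinP.
by move=> x _; rewrite lee_fin half_line_ge0.
Qed.

Lemma integral_window_density :
  (\int[lebesgue_measure]_g (window_density s t g)%:E = 1)%E.
Proof.
under eq_integral do rewrite EFinM.
rewrite ge0_integralZl//; last 3 first.
- exact/measurable_EFinP.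
- by move=> g _; rewrite lee_fin; case: ifP => // _; exact: half_line_ge0.
- by rewrite lee_fin invr_ge0 ltW.
rewrite (_ : (\int[_]_g _)%E = (window_mass s t)%:E).
  by rewrite -EFinM mulVf// gt_eqF.
rewrite window_mass_fineE integral_windowE -integral_itv_obnd_cbnd; last first.
  exact/measurable_EFinP/measurable_funTS.
rewrite [RHS]integral_mkcond; apply: eq_integral => x _.
by rewrite patchE mem_setE in_itv/=; case: ifP.
Qed.

End window_density.

(** * The comparison density and its ratio to the prior *)

Section factor_density.
Context (R : realType) (f ftilde : R -> R) (Cf : R).
Context (df : is_density f) (f2 : (second_moment f < +oo)%E)
  (pf : prior_f_assumption f ftilde Cf).
Context (K r : nat) (c : R) (c0 : 0 < c).
Local Notation M := (measurableTypeR R).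

Section one_factor.
Context (m : nat) (U0 : 'M[R]_(m, K)).

Definition factor_density (i : 'I_m) (l : 'I_K) : R -> R -> R :=
  if (l < r)%N then fun _ => box_density c (U0 i l) else scaled_density f.

Lemma factor_density_ge0 i l g u : 0 <= factor_density i l g u.
Proof.
rewrite /factor_density; case: ifP => _; first exact: box_density_ge0.
exact: scaled_density_ge0.
Qed.

Lemma measurable_factor_density i l :
  measurable_fun [set: M * M] (fun z => factor_density i l z.1 z.2).
Proof.
rewrite /factor_density; case: (l < r)%N; last exact: measurable_scaled_density.
by have := measurableT_comp (measurable_box_density c (U0 i l)) (@measurable_snd _ _ M M);
  apply.
Qed.

Lemma integral_factor_density i l g : 0 < g ->
  (\int[lebesgue_measure]_u (factor_density i l g u)%:E = 1)%E.
Proof.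
move=> g0; rewrite /factor_density; case: ifP => _.
  exact: integral_box_density.
exact: integral_scaled_density.
Qed.

Context (U00 : nonneg_mx U0) (U0r : forall i (l : 'I_K), (r <= l)%N -> U0 i l = 0).

Lemma integral_factor_density_sqr i (l : 'I_K) (g eps : R) : 0 < g ->
  (~~ (l < r)%N -> g <= eps) ->
  (\int[lebesgue_measure]_u ((u - U0 i l) ^+ 2 * factor_density i l g u)%:E <=
   (if (l < r)%N then c ^+ 2 / 3 else eps ^+ 2 * S_ f)%:E)%E.
Proof.
move=> g0 ge; rewrite /factor_density; case: ifPn => [_|lr].
  by rewrite integral_box_density_sqr.
rewrite U0r; last by rewrite leqNgt.
under eq_integral do rewrite subr0.
apply: (le_trans (integral_scaled_density_sqr df g0 f2)).
rewrite lee_fin ler_wpM2r//; first by rewrite /S_ le_max ler01.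
by rewrite lerXn2r ?nnegrE ?(ltW g0) ?ge// (le_trans (ltW g0))// ge.
Qed.

(** Bound on the mean of [mx_sqdist U0]. In each row the entries outside the first [r] columns are
    counted as [K] instead of [K - r]. *)
Definition factor_moment (eps : R) : R :=
  m%:R * (r%:R * (c ^+ 2 / 3) + K%:R * (eps ^+ 2 * S_ f)).

Lemma integral_mx_factor_sqdist (g : K.-tuple M) (eps : R) : (r <= K)%N ->
  (forall l, 0 < tnth g l) ->
  (forall l : 'I_K, ~~ (l < r)%N -> tnth g l <= eps) ->
  (\int[lebesgue_mx R m K]_U (mx_sqdist U0 U * mx_density factor_density U g)%:E <=
   (factor_moment eps)%:E)%E.
Proof.
move=> rK g0 ge.
apply: (@le_trans _ _ (\sum_(i < m) \sum_(l < K)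
    (if (l < r)%N then c ^+ 2 / 3 else eps ^+ 2 * S_ f))%:E).
  apply: integral_mx_sqdist_density.
  - exact: measurable_factor_density.
  - exact: factor_density_ge0.
  - by move=> i l; apply: integral_factor_density.
  - by move=> i l; apply: integral_factor_density_sqr => //; exact: ge.
have S0 : 0 <= S_ f by rewrite /S_ le_max ler01.
rewrite lee_fin /factor_moment sumr_const card_ord -[leLHS]mulr_natl ler_wpM2l//.
rewrite (bigID (fun l : 'I_K => (l < r)%N))/= lerD//.
  rewrite (eq_bigr (fun=> c ^+ 2 / 3)) => [|l ->//].
  rewrite -(big_ord_widen K (fun=> c ^+ 2 / 3) rK).
  by rewrite sumr_const card_ord mulr_natl.
rewrite (eq_bigr (fun=> eps ^+ 2 * S_ f)) => [|l /negbTE ->//].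
rewrite big_mkcond/= mulr_natl -[X in _ <= _ *+ X]card_ord -sumr_const.
by apply: ler_sum => l _; case: ifP => // _; rewrite mulr_ge0 ?sqr_ge0.
Qed.

Definition factor_ratio : R :=
  \prod_(i < m) \prod_(l < K | (l < r)%N) (2 / (c * Cf * ftilde (U0 i l + 1))).

Context (c1 : c <= 1) (fU0 : forall i (l : 'I_K), (l < r)%N -> 0 < ftilde (U0 i l + 1)).

Lemma factor_ratio_gt0 : 0 < factor_ratio.
Proof.
case: pf => _ _ Cf0 _.
apply: prodr_gt0 => i _; apply: prodr_gt0 => l lr.
by rewrite divr_gt0// !mulr_gt0// fU0.
Qed.

(** On the box [u <= U0 i l + 1], as [c <= 1], and division by a scale above 1 only lowers [u].
    Monotonicity then bounds [f (u / g)] below by [Cf * ftilde (U0 i l + 1)]; the factor 2 comes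
    from [g <= 2] in the prefactor [1/g]. *)
Lemma box_density_le i (l : 'I_K) g u : (l < r)%N -> 1 < g <= 2 ->
  box_density c (U0 i l) u <=
  2 / (c * Cf * ftilde (U0 i l + 1)) * scaled_density f g u.
Proof.
move=> lr /andP[g1 g2]; case: pf => _ fnd Cf0 fle.
have g0 : 0 < g by rewrite (lt_trans ltr01).
have fp := fU0 i lr.
rewrite /box_density; case: ifP => [/andP[Uu uU]|_]; last first.
  by rewrite mulr_ge0 ?scaled_density_ge0// divr_ge0// ltW// !mulr_gt0.
have u0 : 0 < u by apply: le_lt_trans Uu; exact: U00.
have ug0 : 0 < u / g by rewrite divr_gt0.
rewrite /scaled_density g0 /half_line (ltW ug0).
have h1 : Cf * ftilde (U0 i l + 1) <= f (u / g).
  apply: le_trans (fle _ ug0); rewrite ler_pM2l//; apply: fnd => //.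
  rewrite ler_pdivrMr//; apply: (le_trans uU); apply: (@le_trans _ _ (U0 i l + 1)).
    by rewrite lerD2l.
  by rewrite ler_peMr ?(ltW g1)// addr_ge0.
have h2 : 2^-1 <= g^-1 by rewrite lef_pV2 ?posrE.
have h3 : 2^-1 * (Cf * ftilde (U0 i l + 1)) <= g^-1 * f (u / g).
  by apply: ler_pM => //; rewrite mulr_ge0// ltW.
have c0' : 0 <= 2 / (c * Cf * ftilde (U0 i l + 1)).
  by rewrite divr_ge0// ltW// !mulr_gt0.
apply: le_trans (ler_wpM2l c0' h3).
rewrite le_eqVlt; apply/orP; left; apply/eqP; field.
by rewrite !gt_eqF.
Qed.

Lemma mx_factor_density_le U (g : K.-tuple M) :
  (forall l : 'I_K, (l < r)%N -> 1 < tnth g l <= 2) ->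
  mx_density factor_density U g <=
  factor_ratio * mx_density (fun _ _ => scaled_density f) U g.
Proof.
move=> g12; rewrite /mx_density /factor_ratio -big_split/=.
apply: ler_prod => i _; apply/andP; split.
  by apply: prodr_ge0 => l _; exact: factor_density_ge0.
rewrite [X in _ <= X * _]big_mkcond/= -big_split/=.
apply: ler_prod => l _; rewrite factor_density_ge0/= /factor_density.
by case: ifPn => lr; [exact/box_density_le/g12|rewrite mul1r].
Qed.

End one_factor.
End factor_density.

Section comparison_density.
Context (R : realType) (f h ftilde : R -> R) (Cf : R).
Context (df : is_density f) (f2 : (second_moment f < +oo)%E) (dh : is_density h)
  (pf : prior_f_assumption f ftilde Cf).
Context (m1 m2 K r : nat) (c eps : R) (c0 : 0 < c) (c1 : c <= 1).
Context (H1 : 0 < window_mass h 1 2) (H0 : 0 < window_mass h 0 eps).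
Context (U0 : 'M[R]_(m1, K)) (V0 : 'M[R]_(m2, K)) (UV0 : nonneg_factors r (U0, V0)).
Context (fU0 : forall i (l : 'I_K), (l < r)%N -> 0 < ftilde (U0 i l + 1))
  (fV0 : forall i (l : 'I_K), (l < r)%N -> 0 < ftilde (V0 i l + 1)).
Local Notation M := (measurableTypeR R).

Definition gamma_density (l : 'I_K) : R -> R :=
  if (l < r)%N then window_density h 1 2 else window_density h 0 eps.

Definition gamma_ratio : R :=
  \prod_(l < K) (if (l < r)%N then window_mass h 1 2 else window_mass h 0 eps)^-1.

Definition comparison_density : param R m1 m2 K -> R :=
  param_density (factor_density f r c U0) (factor_density f r c V0) gamma_density.

Definition comparison_ratio : R :=
  factor_ratio ftilde Cf r c U0 * factor_ratio ftilde Cf r c V0 * gamma_ratio.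

Lemma gamma_density_ge0 l g : 0 <= gamma_density l g.
Proof. by rewrite /gamma_density; case: ifP => _; exact: window_density_ge0. Qed.

Lemma measurable_gamma_density l : measurable_fun [set: M] (gamma_density l).
Proof. by rewrite /gamma_density; case: ifP => _; exact: measurable_window_density. Qed.

Lemma integral_gamma_density l :
  (\int[lebesgue_measure]_g (gamma_density l g)%:E = 1)%E.
Proof. by rewrite /gamma_density; case: ifP => _; exact: integral_window_density. Qed.

Lemma gamma_density_support l g : gamma_density l g != 0 ->
  if (l < r)%N then 1 < g <= 2 else 0 < g <= eps.
Proof.
rewrite /gamma_density; case: ifP => _; rewrite /window_density;
  by case: ifP => // _; rewrite mulr0 eqxx.
Qed.

Lemma gamma_density_gt0 l g : gamma_density l g != 0 -> 0 < g.
Proof.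
move=> /gamma_density_support; case: ifP => _ /andP[] //.
by move=> + _; exact: lt_trans.
Qed.

Lemma comparison_density_ge0 x : 0 <= comparison_density x.
Proof.
apply: param_density_ge0.
- by move=> *; exact: factor_density_ge0.
- by move=> *; exact: factor_density_ge0.
- by move=> *; exact: gamma_density_ge0.
Qed.

Lemma measurable_comparison_density : measurable_fun setT comparison_density.
Proof.
apply: measurable_param_density.
- by move=> *; exact: measurable_factor_density.
- by move=> *; exact: measurable_factor_density.
- by move=> *; exact: measurable_gamma_density.
Qed.

Lemma integral_comparison_density :
  (\int[lebesgue_param R m1 m2 K]_x (comparison_density x)%:E = 1)%E.
Proof.
apply: integral_param_density1.
- by move=> *; exact: measurable_factor_density.
- by move=> *; exact: measurable_factor_density.
- by move=> *; exact: measurable_gamma_density.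
- by move=> *; exact: factor_density_ge0.
- by move=> *; exact: factor_density_ge0.
- by move=> *; exact: gamma_density_ge0.
- by rewrite big1// => l _; exact: integral_gamma_density.
- by move=> g hg i l; apply: integral_factor_density => //; exact: gamma_density_gt0 (hg l).
- by move=> g hg i l; apply: integral_factor_density => //; exact: gamma_density_gt0 (hg l).
Qed.

Lemma comparison_ratio_gt0 : 0 < comparison_ratio.
Proof.
rewrite !mulr_gt0//.
- exact: (factor_ratio_gt0 pf c0 fU0).
- exact: (factor_ratio_gt0 pf c0 fV0).
by apply: prodr_gt0 => l _; rewrite invr_gt0; case: ifP.
Qed.

Lemma comparison_density_le x :
  comparison_density x <= comparison_ratio * prior_product f h x.
Proof.
case: UV0 => /= U00 V00 U0r V0r.
have rhs0 : 0 <= comparison_ratio * prior_product f h x.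
  by rewrite mulr_ge0 ?prior_product_ge0// ltW// comparison_ratio_gt0.
(* If some scale leaves its window the left-hand side is 0; otherwise the scales of the first [r]
   columns lie in []1, 2]], as the comparison of boxes with the prior requires. *)
have [hg|] := pselect (forall l, gamma_density l (tnth x.2 l) != 0); last first.
  move=> /existsNP[l /negP]; rewrite negbK => /eqP hl.
  by rewrite /comparison_density /param_density [X in _ * X](bigD1 l)//= hl mul0r mulr0.
have g12 (l : 'I_K) : (l < r)%N -> 1 < tnth x.2 l <= 2.
  by move=> lr; have := gamma_density_support (hg l); rewrite lr.
have hU := mx_factor_density_le df pf c0 U00 c1 fU0 x.1.1 g12.
have hV := mx_factor_density_le df pf c0 V00 c1 fV0 x.1.2 g12.
have hG : \prod_l gamma_density l (tnth x.2 l) =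
    gamma_ratio * \prod_l half_line h (tnth x.2 l).
  rewrite -big_split/=; apply: eq_bigr => l _.
  have := gamma_density_support (hg l).
  by rewrite /gamma_density /window_density; case: ifP => _ ->.
rewrite /comparison_density /param_density hG.
rewrite (_ : comparison_ratio * _ =
  (factor_ratio ftilde Cf r c U0 * mx_density (fun _ _ => scaled_density f) x.1.1 x.2) *
  (factor_ratio ftilde Cf r c V0 * mx_density (fun _ _ => scaled_density f) x.1.2 x.2) *
  (gamma_ratio * \prod_l half_line h (tnth x.2 l))); last first.
  by rewrite /comparison_ratio /prior_product /param_density; ring.
apply: ler_wpM2r.
  rewrite -hG; apply: prodr_ge0 => l _; exact: gamma_density_ge0.
by apply: ler_pM => //; apply: mx_density_ge0 => *; exact: factor_density_ge0.
Qed.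

Lemma integral_comparison_density_le
    (F : m1.-tuple (K.-tuple M) -> R) (G : m2.-tuple (K.-tuple M) -> R) (x y : R) :
  measurable_fun setT F -> measurable_fun setT G ->
  (forall U, 0 <= F U) -> (forall V, 0 <= G V) -> 0 <= x -> 0 <= y ->
  (forall g : K.-tuple M, (forall l, 0 < tnth g l) ->
    (forall l : 'I_K, ~~ (l < r)%N -> tnth g l <= eps) ->
    (\int[lebesgue_mx R m1 K]_U (F U * mx_density (factor_density f r c U0) U g)%:E
      <= x%:E)%E) ->
  (forall g : K.-tuple M, (forall l, 0 < tnth g l) ->
    (forall l : 'I_K, ~~ (l < r)%N -> tnth g l <= eps) ->
    (\int[lebesgue_mx R m2 K]_V (G V * mx_density (factor_density f r c V0) V g)%:E
      <= y%:E)%E) ->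
  (\int[lebesgue_param R m1 m2 K]_z (F z.1.1 * G z.1.2 * comparison_density z)%:E
    <= (x * y)%:E)%E.
Proof.
move=> mF mG F0 G0 hx hy HF HG.
have supp (g : K.-tuple M) : (forall l, gamma_density l (tnth g l) != 0) ->
    (forall l, 0 < tnth g l) /\
    (forall l : 'I_K, ~~ (l < r)%N -> tnth g l <= eps).
  move=> hg; split => l; first exact: gamma_density_gt0 (hg l).
  by move=> /negbTE lr; have := gamma_density_support (hg l); rewrite lr => /andP[].
apply: integral_param_density_le => //.
- by move=> *; exact: measurable_factor_density.
- by move=> *; exact: measurable_factor_density.
- by move=> *; exact: measurable_gamma_density.
- by move=> *; exact: factor_density_ge0.
- by move=> *; exact: factor_density_ge0.
- by move=> *; exact: gamma_density_ge0.
- by rewrite big1// => l _; exact: integral_gamma_density.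
- by move=> g /supp[? ?]; exact: HF.
- by move=> g /supp[? ?]; exact: HG.
Qed.

End comparison_density.

(** * Matrix inequalities *)

Section frobenius.
Context (R : realType).

(** Lagrange's identity: twice the gap is a double sum of squares. *)
Lemma sum_cauchy_schwarz (I : finType) (a b : I -> R) :
  (\sum_i a i * b i) ^+ 2 <= (\sum_i a i ^+ 2) * (\sum_i b i ^+ 2).
Proof.
have : 0 <= \sum_i \sum_j (a i * b j - a j * b i) ^+ 2.
  by apply: sumr_ge0 => i _; apply: sumr_ge0 => j _; exact: sqr_ge0.
rewrite (_ : \sum_i \sum_j _ = 2 * ((\sum_i a i ^+ 2) * (\sum_i b i ^+ 2) -
    (\sum_i a i * b i) ^+ 2)).
  by rewrite pmulr_rge0// subr_ge0.
have E1 : (\sum_i a i ^+ 2) * (\sum_i b i ^+ 2) = \sum_i \sum_j a i ^+ 2 * b j ^+ 2.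
  by rewrite mulr_suml; apply: eq_bigr => i _; rewrite mulr_sumr.
have E2 : (\sum_i a i ^+ 2) * (\sum_i b i ^+ 2) = \sum_i \sum_j a j ^+ 2 * b i ^+ 2.
  by rewrite E1 exchange_big.
have E3 : (\sum_i a i * b i) ^+ 2 = \sum_i \sum_j (a i * b i) * (a j * b j).
  by rewrite expr2 mulr_suml; apply: eq_bigr => i _; rewrite mulr_sumr.
have -> : 2 * ((\sum_i a i ^+ 2) * (\sum_i b i ^+ 2) - (\sum_i a i * b i) ^+ 2) =
    (\sum_i a i ^+ 2) * (\sum_i b i ^+ 2) + (\sum_i a i ^+ 2) * (\sum_i b i ^+ 2)
    + - 2 * (\sum_i a i * b i) ^+ 2 by ring.
rewrite {1}E1 E2 E3 mulr_sumr -!big_split/=; apply: eq_bigr => i _.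
rewrite mulr_sumr -!big_split/=; apply: eq_bigr => j _; ring.
Qed.

Lemma frob_sqr m n (A : 'M[R]_(m, n)) : frob A ^+ 2 = \sum_i \sum_j A i j ^+ 2.
Proof.
rewrite /frob sqr_sqrtr//.
by apply: sumr_ge0 => i _; apply: sumr_ge0 => j _; exact: sqr_ge0.
Qed.

Lemma frob_ge0 m n (A : 'M[R]_(m, n)) : 0 <= frob A.
Proof. exact: sqrtr_ge0. Qed.

Lemma frobD m n (A B : 'M[R]_(m, n)) : frob (A + B) <= frob A + frob B.
Proof.
rewrite -(@ler_pXn2r _ 2)// ?nnegrE ?addr_ge0 ?frob_ge0//.
rewrite sqrrD !frob_sqr.
have CS : \sum_i \sum_j A i j * B i j <= frob A * frob B.
  rewrite (le_trans (ler_norm _))// -(@ler_pXn2r _ 2)// ?nnegrE ?mulr_ge0 ?frob_ge0//.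
  rewrite real_normK ?num_real// exprMn !frob_sqr !pair_bigA/=.
  exact: (sum_cauchy_schwarz (fun p : 'I_m * 'I_n => A p.1 p.2) (fun p => B p.1 p.2)).
rewrite -mulr_natl (_ : \sum_i \sum_j (A + B) i j ^+ 2 = \sum_i \sum_j A i j ^+ 2 +
    2 * (\sum_i \sum_j A i j * B i j) + \sum_i \sum_j B i j ^+ 2).
  by rewrite lerD2r lerD2l ler_wpM2l.
rewrite mulr_sumr -!big_split/=; apply: eq_bigr => i _.
rewrite mulr_sumr -!big_split/=; apply: eq_bigr => j _.
by rewrite mxE; ring.
Qed.

(** Cauchy-Schwarz between row [i] of [A] and row [j] of [B]; the sum of the bounds over [i] and [j]
    factors. *)
Lemma frob_mulmx_tr m n k (A : 'M[R]_(m, k)) (B : 'M[R]_(n, k)) :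
  frob (A *m B^T) <= frob A * frob B.
Proof.
rewrite -(@ler_pXn2r _ 2)// ?nnegrE ?mulr_ge0 ?frob_ge0//.
rewrite exprMn !frob_sqr mulr_suml; apply: ler_sum => i _.
rewrite mulr_sumr; apply: ler_sum => j _; rewrite mxE.
under eq_bigr do rewrite mxE.
exact: (sum_cauchy_schwarz (fun l => A i l) (fun l => B j l)).
Qed.

(* Weighted Cauchy-Schwarz for
   [U V^T - M = (U0 V0^T - M) + (U - U0) V0^T + U0 (V - V0)^T + (U - U0) (V - V0)^T],
   the deviations being measured in units of [k]. *)
Lemma frob_sqr_factors_le m1 m2 K (U U0 : 'M[R]_(m1, K)) (V V0 : 'M[R]_(m2, K))
    (M : 'M[R]_(m1, m2)) (k : R) : 0 < k ->
  let D := frob (U0 *m V0^T - M) in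
  let u := frob U0 in let v := frob V0 in
  let x := frob (U - U0) ^+ 2 / k ^+ 2 in let y := frob (V - V0) ^+ 2 / k ^+ 2 in
  frob (U *m V^T - M) ^+ 2 <=
  (D + k ^+ 2 + k * v + k * u) * (D + k ^+ 2 * (x * y) + k * v * x + k * u * y).
Proof.
move=> k0; lazy zeta.
set D := frob (U0 *m V0^T - M); set u := frob U0; set v := frob V0.
set x := frob (U - U0) ^+ 2 / k ^+ 2; set y := frob (V - V0) ^+ 2 / k ^+ 2.
pose a := frob (U - U0); pose b := frob (V - V0).
have a0 : 0 <= a by exact: frob_ge0.
have b0 : 0 <= b by exact: frob_ge0.
have D0 : 0 <= D by exact: frob_ge0.
have u0 : 0 <= u by exact: frob_ge0.
have v0 : 0 <= v by exact: frob_ge0.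
have h : frob (U *m V^T - M) <= D + a * v + u * b + a * b.
  have -> : U *m V^T - M = (U0 *m V0^T - M) + (U - U0) *m V0^T + U0 *m (V - V0)^T +
      (U - U0) *m (V - V0)^T.
    have -> : (V - V0)^T = V^T - V0^T by rewrite linearB.
    rewrite !mulmxBl !mulmxBr.
    set p := U *m V^T; set q := U *m V0^T; set s := U0 *m V^T; set t := U0 *m V0^T.
    by apply/matrixP => i j; rewrite !mxE; ring.
  apply: le_trans (frobD _ _) _; apply: lerD; last exact: frob_mulmx_tr.
  apply: le_trans (frobD _ _) _; apply: lerD; last exact: frob_mulmx_tr.
  by apply: le_trans (frobD _ _) _; apply: lerD => //; exact: frob_mulmx_tr.
have {h} h : frob (U *m V^T - M) ^+ 2 <= (D + a * v + u * b + a * b) ^+ 2.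
  by rewrite lerXn2r// nnegrE ?frob_ge0// !addr_ge0// mulr_ge0.
apply: le_trans h _.
pose z := a / k; pose w := b / k.
have aE : a = k * z by rewrite /z; field; rewrite gt_eqF.
have bE : b = k * w by rewrite /w; field; rewrite gt_eqF.
have -> : x = z ^+ 2 by rewrite /x /z exprMn exprVn.
have -> : y = w ^+ 2 by rewrite /y /w exprMn exprVn.
rewrite aE bE -subr_ge0.
(* Lagrange's identity with weights [D], [k^2], [k v], [k u] and values [1], [z w], [z], [w]: the
   gap is the sum over pairs of the product of the weights times the squared difference of the
   values. *)
have -> : (D + k ^+ 2 + k * v + k * u) *
    (D + k ^+ 2 * (z ^+ 2 * w ^+ 2) + k * v * z ^+ 2 + k * u * w ^+ 2) -
    (D + k * z * v + u * (k * w) + k * z * (k * w)) ^+ 2 =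
    D * k ^+ 2 * (1 - z * w) ^+ 2 + D * (k * v) * (1 - z) ^+ 2 +
    D * (k * u) * (1 - w) ^+ 2 + k ^+ 2 * (k * v) * (z * w - z) ^+ 2 +
    k ^+ 2 * (k * u) * (z * w - w) ^+ 2 + (k * v) * (k * u) * (z - w) ^+ 2 by ring.
by have k0' := ltW k0; do ?[exact: sqr_ge0|by []|apply: addr_ge0|apply: mulr_ge0].
Qed.

(** This explains the form of [B]. With [e = (1 + u + v) k], which bounds the added terms as
    [k <= 1], it suffices that [e (2 D + 1) <= 1], for then [2 D e + e^2 <= 1]. The choice
    [k = 1/B^2] works because [B] dominates both [1 + u + v] and [1 + 2 D]. *)
Lemma oracle_weight_le (D u v : R) : 0 <= D -> 0 <= u -> 0 <= v ->
  let k := ((1 + u + v + 2 * D) ^+ 2)^-1 in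
  (D + k ^+ 2 + k * v + k * u) ^+ 2 <= D ^+ 2 + 1.
Proof.
move=> D0 u0 v0; lazy zeta; set k := _^-1.
set B := 1 + u + v + 2 * D.
have B1 : 1 <= B by rewrite /B; lra.
have B0 : 0 < B by lra.
have k0 : 0 <= k by rewrite /k invr_ge0 sqr_ge0.
have kB : k * B ^+ 2 = 1 by rewrite mulVf// expf_neq0// gt_eqF.
have k1 : k <= 1 by rewrite /k invf_le1 ?exprn_gt0// exprn_ege1.
pose e := (1 + u + v) * k.
have e0 : 0 <= e by rewrite mulr_ge0//; lra.
have e1 : e * (2 * D + 1) <= 1.
  have -> : e * (2 * D + 1) = k * ((1 + u + v) * (2 * D + 1)) by rewrite /e; ring.
  rewrite -[leRHS]kB ler_wpM2l// -subr_ge0.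
  have -> : B ^+ 2 - (1 + u + v) * (2 * D + 1) =
      (1 + u + v) * (u + v) + 2 * ((1 + u + v) * D) + 4 * D ^+ 2.
    by rewrite /B; ring.
  have uv1 : 0 <= 1 + u + v by lra.
  by do ?[exact: sqr_ge0|by []|apply: addr_ge0|apply: mulr_ge0].
have e2 : e <= 1 by apply: le_trans e1; nra.
have h : D + k ^+ 2 + k * v + k * u <= D + e.
  by rewrite /e expr2; nra.
apply: (@le_trans _ _ ((D + e) ^+ 2)).
  have h0 : 0 <= D + k ^+ 2 + k * v + k * u.
    by do ?[exact: sqr_ge0|by []|apply: addr_ge0|apply: mulr_ge0].
  by rewrite lerXn2r// nnegrE addr_ge0.
by rewrite !expr2; nra.
Qed.

End frobenius.

Section product_entries.
Context (R : realType) (m1 m2 K : nat).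

Lemma measurable_product_entry i j : measurable_fun setT
  (fun x : param R m1 m2 K => (Upart x *m (Vpart x)^T) i j).
Proof.
under eq_fun do rewrite mxE.
apply: (@measurable_sum _ _ R setT _ _ (fun l (x : param R m1 m2 K) =>
  Upart x i l * (Vpart x)^T l j)) => l.
apply: measurable_funM.
  under eq_fun do rewrite mxE.
  have m11 : measurable_fun setT (fun x : param R m1 m2 K => x.1.1).
    by have := measurableT_comp (@measurable_fst _ _ _ _) (@measurable_fst _ _ _ _); apply.
  by have := measurableT_comp (measurable_entry i l) m11; apply.
under eq_fun do rewrite !mxE.
have m12 : measurable_fun setT (fun x : param R m1 m2 K => x.1.2).
  by have := measurableT_comp (@measurable_snd _ _ _ _) (@measurable_fst _ _ _ _); apply.
by have := measurableT_comp (measurable_entry j l) m12; apply.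
Qed.

Lemma measurable_frob_sqr (M : 'M[R]_(m1, m2)) : measurable_fun setT
  (fun x : param R m1 m2 K => frob (Upart x *m (Vpart x)^T - M) ^+ 2).
Proof.
under eq_fun do rewrite frob_sqr.
apply: (@measurable_sum _ _ R setT _ _ (fun i (x : param R m1 m2 K) =>
  \sum_j (Upart x *m (Vpart x)^T - M) i j ^+ 2)) => i.
apply: (@measurable_sum _ _ R setT _ _ (fun j (x : param R m1 m2 K) =>
  (Upart x *m (Vpart x)^T - M) i j ^+ 2)) => j.
apply: measurable_funX.
rewrite (_ : (fun x => _) = (fun x : param R m1 m2 K =>
  (Upart x *m (Vpart x)^T) i j - M i j)); last first.
  by apply/funext => x; rewrite [LHS]mxE [X in _ + X]mxE.
by apply: measurable_funB => //; exact: measurable_product_entry.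
Qed.

End product_entries.

(** * Average loss under the comparison density *)

Lemma ge0_integral_lin_le d (T : measurableType d) (R : realType)
    (mu : {measure set T -> \bar R}) (f g : T -> R) (a b x y : R) :
  measurable_fun setT f -> measurable_fun setT g ->
  (forall t, 0 <= f t) -> (forall t, 0 <= g t) -> 0 <= a -> 0 <= b ->
  (\int[mu]_t (f t)%:E <= x%:E)%E -> (\int[mu]_t (g t)%:E <= y%:E)%E ->
  (\int[mu]_t (a * f t + b * g t)%:E <= (a * x + b * y)%:E)%E.
Proof.
move=> mf mg f0 g0 a0 b0 fx gy.
under eq_integral do rewrite EFinD !EFinM.
rewrite ge0_integralD//; last 4 first.
- by move=> t _; rewrite -EFinM lee_fin mulr_ge0.
- by apply: emeasurable_funM => //; exact/measurable_EFinP.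
- by move=> t _; rewrite -EFinM lee_fin mulr_ge0.
- by apply: emeasurable_funM => //; exact/measurable_EFinP.
rewrite !ge0_integralZl//; try exact/measurable_EFinP;
  do ?[by move=> t _; rewrite lee_fin|by rewrite lee_fin].
by rewrite EFinD !EFinM leeD// lee_wpmul2l// lee_fin.
Qed.

Section comparison_loss_bound.
Context (R : realType) (f h : R -> R).
Context (df : is_density f) (f2 : (second_moment f < +oo)%E) (dh : is_density h).
Context (m1 m2 K r : nat) (rK : (r <= K)%N) (c eps : R) (c0 : 0 < c).
Context (H1 : 0 < window_mass h 1 2) (H0 : 0 < window_mass h 0 eps).
Context (U0 : 'M[R]_(m1, K)) (V0 : 'M[R]_(m2, K)) (UV0 : nonneg_factors r (U0, V0)).
Context (M : 'M[R]_(m1, m2)) (k : R) (k0 : 0 < k)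
  (mom1 : factor_moment f K r c m1 eps <= k ^+ 2)
  (mom2 : factor_moment f K r c m2 eps <= k ^+ 2).

Local Notation q := (comparison_density f h r c eps U0 V0).

Let integral_one m (A : 'M[R]_(m, K)) (g : K.-tuple (measurableTypeR R)) :
  (forall l, 0 < tnth g l) ->
  (\int[lebesgue_mx R m K]_U (1 * mx_density (factor_density f r c A) U g)%:E
    <= 1%:E)%E.
Proof.
move=> g0; under eq_integral do rewrite mul1r.
rewrite integral_mx_density1//.
- by move=> *; exact: measurable_factor_density.
- by move=> *; exact: factor_density_ge0.
- by move=> i l; apply: integral_factor_density.
Qed.

Let integral_sqdist m (A : 'M[R]_(m, K)) (g : K.-tuple (measurableTypeR R)) :
  (forall i (l : 'I_K), (r <= l)%N -> A i l = 0) ->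
  factor_moment f K r c m eps <= k ^+ 2 ->
  (forall l, 0 < tnth g l) ->
  (forall l : 'I_K, ~~ (l < r)%N -> tnth g l <= eps) ->
  (\int[lebesgue_mx R m K]_U (mx_sqdist A U / k ^+ 2 *
    mx_density (factor_density f r c A) U g)%:E <= 1%:E)%E.
Proof.
move=> Ar mom g0 ge.
have h0 U : 0 <= mx_sqdist A U * mx_density (factor_density f r c A) U g.
  by rewrite mulr_ge0 ?mx_sqdist_ge0// mx_density_ge0// => *; exact: factor_density_ge0.
rewrite (_ : (\int[_]_U _)%E = (\int[lebesgue_mx R m K]_U ((k ^- 2)%:E *
    (mx_sqdist A U * mx_density (factor_density f r c A) U g)%:E))%E); last first.
  by apply: eq_integral => U _; rewrite -EFinM; congr EFin; ring.
rewrite ge0_integralZl//; last 3 first.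
- apply/measurable_EFinP/measurable_funM; first exact: measurable_mx_sqdist.
  have mm : measurable_fun setT (fun z : m.-tuple (K.-tuple (measurableTypeR R)) *
      K.-tuple (measurableTypeR R) => mx_density (factor_density f r c A) z.1 z.2).
    by apply: measurable_mx_density => *; exact: measurable_factor_density.
  by have := measurableT_comp mm (measurable_pair2 g); apply.
- by move=> U _; rewrite lee_fin.
- by rewrite lee_fin invr_ge0 sqr_ge0.
have hm := @integral_mx_factor_sqdist R f df f2 K r c c0 m A Ar g eps rK g0 ge.
apply: (@le_trans _ _ ((k ^- 2)%:E * (factor_moment f K r c m eps)%:E)%E).
  by apply: lee_wpmul2l => //; rewrite lee_fin invr_ge0 sqr_ge0.
by rewrite -EFinM lee_fin mulrC ler_pdivrMr ?exprn_gt0// mul1r.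
Qed.

(** Under [q] the squared deviations in units of [k], called [X] and [Y], have means at most 1, and
    so does their product, the factors being independent given the scales. Hence the second factor
    in [frob_sqr_factors_le] averages to at most the first one, [W]. *)
Lemma integral_comparison_loss :
  let D := frob (U0 *m V0^T - M) in
  (\int[lebesgue_param R m1 m2 K]_x
     (frob (Upart x *m (Vpart x)^T - M) ^+ 2 * q x)%:E <=
   ((D + k ^+ 2 + k * frob V0 + k * frob U0) ^+ 2)%:E)%E.
Proof.
lazy zeta; set D := frob _; set v := frob V0; set u := frob U0.
have D0 : 0 <= D by exact: frob_ge0.
have u0 : 0 <= u by exact: frob_ge0.
have v0 : 0 <= v by exact: frob_ge0.
case: (UV0) => /= _ _ U0r V0r.
pose X (U : m1.-tuple (K.-tuple (measurableTypeR R))) := mx_sqdist U0 U / k ^+ 2.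
pose Y (V : m2.-tuple (K.-tuple (measurableTypeR R))) := mx_sqdist V0 V / k ^+ 2.
have X0 U : 0 <= X U by rewrite divr_ge0 ?mx_sqdist_ge0 ?sqr_ge0.
have Y0 V : 0 <= Y V by rewrite divr_ge0 ?mx_sqdist_ge0 ?sqr_ge0.
have mX : measurable_fun setT X.
  by apply: measurable_funM => //; exact: measurable_mx_sqdist.
have mY : measurable_fun setT Y.
  by apply: measurable_funM => //; exact: measurable_mx_sqdist.
have mq : measurable_fun setT q by exact: measurable_comparison_density.
have q0 x : 0 <= q x by exact: comparison_density_ge0.
pose S F G (x : param R m1 m2 K) := F x.1.1 * G x.1.2 * q x.
have S0 F G x : (forall U, 0 <= F U) -> (forall V, 0 <= G V) -> 0 <= S F G x.
  by move=> F0 G0; apply: mulr_ge0 => //; exact: mulr_ge0.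
have mS (F : m1.-tuple (K.-tuple (measurableTypeR R)) -> R)
    (G : m2.-tuple (K.-tuple (measurableTypeR R)) -> R) :
    measurable_fun setT F -> measurable_fun setT G ->
    measurable_fun setT (S F G).
  move=> mF mG.
  have m11 : measurable_fun setT (fun x : param R m1 m2 K => x.1.1).
    by have := measurableT_comp (@measurable_fst _ _ _ _) (@measurable_fst _ _ _ _); apply.
  have m12 : measurable_fun setT (fun x : param R m1 m2 K => x.1.2).
    by have := measurableT_comp (@measurable_snd _ _ _ _) (@measurable_fst _ _ _ _); apply.
  apply: measurable_funM => //; apply: measurable_funM.
    by have := measurableT_comp mF m11; apply.
  by have := measurableT_comp mG m12; apply.
pose one1 (U : m1.-tuple (K.-tuple (measurableTypeR R))) : R := 1.
pose one2 (U : m2.-tuple (K.-tuple (measurableTypeR R))) : R := 1.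
have m_one1 : measurable_fun setT one1 by exact: measurable_cst.
have m_one2 : measurable_fun setT one2 by exact: measurable_cst.
have one10 U : 0 <= one1 U by [].
have one20 U : 0 <= one2 U by [].
have IS (F : m1.-tuple (K.-tuple (measurableTypeR R)) -> R)
    (G : m2.-tuple (K.-tuple (measurableTypeR R)) -> R) :
    measurable_fun setT F -> measurable_fun setT G ->
    (forall U, 0 <= F U) -> (forall V, 0 <= G V) ->
    (forall g : K.-tuple (measurableTypeR R), (forall l, 0 < tnth g l) ->
      (forall l : 'I_K, ~~ (l < r)%N -> tnth g l <= eps) ->
      (\int[lebesgue_mx R m1 K]_U (F U * mx_density (factor_density f r c U0) U g)%:E
        <= 1%:E)%E) ->
    (forall g : K.-tuple (measurableTypeR R), (forall l, 0 < tnth g l) ->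
      (forall l : 'I_K, ~~ (l < r)%N -> tnth g l <= eps) ->
      (\int[lebesgue_mx R m2 K]_V (G V * mx_density (factor_density f r c V0) V g)%:E
        <= 1%:E)%E) ->
    (\int[lebesgue_param R m1 m2 K]_z (S F G z)%:E <= 1%:E)%E.
  move=> mF mG F0 G0 HF HG; rewrite -[X in (_ <= X%:E)%E](mulr1 (1:R)).
  exact: (integral_comparison_density_le df dh c0 H1 H0 mF mG F0 G0 ler01 ler01 HF HG).
have o1 (g : K.-tuple (measurableTypeR R)) : (forall l, 0 < tnth g l) ->
    (forall l : 'I_K, ~~ (l < r)%N -> tnth g l <= eps) ->
    (\int[lebesgue_mx R m1 K]_U (one1 U * mx_density (factor_density f r c U0) U g)%:E
        <= 1%:E)%E by move=> g0 _; exact: integral_one.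
have o2 (g : K.-tuple (measurableTypeR R)) : (forall l, 0 < tnth g l) ->
    (forall l : 'I_K, ~~ (l < r)%N -> tnth g l <= eps) ->
    (\int[lebesgue_mx R m2 K]_U (one2 U * mx_density (factor_density f r c V0) U g)%:E
        <= 1%:E)%E by move=> g0 _; exact: integral_one.
have oX (g : K.-tuple (measurableTypeR R)) : (forall l, 0 < tnth g l) ->
    (forall l : 'I_K, ~~ (l < r)%N -> tnth g l <= eps) ->
    (\int[lebesgue_mx R m1 K]_U (X U * mx_density (factor_density f r c U0) U g)%:E
        <= 1%:E)%E by move=> g0 ge; exact: integral_sqdist.
have oY (g : K.-tuple (measurableTypeR R)) : (forall l, 0 < tnth g l) ->
    (forall l : 'I_K, ~~ (l < r)%N -> tnth g l <= eps) ->
    (\int[lebesgue_mx R m2 K]_U (Y U * mx_density (factor_density f r c V0) U g)%:E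
        <= 1%:E)%E by move=> g0 ge; exact: integral_sqdist.
have I11 := IS one1 one2 m_one1 m_one2 one10 one20 o1 o2.
have IXY := IS X Y mX mY X0 Y0 oX oY.
have IX1 := IS X one2 mX m_one2 X0 one20 oX o2.
have I1Y := IS one1 Y m_one1 mY one10 Y0 o1 oY.
set W := D + k ^+ 2 + k * v + k * u.
have k0' := ltW k0.
have W0 : 0 <= W by rewrite /W; do ?[exact: sqr_ge0|by []|apply: addr_ge0|apply: mulr_ge0].
pose A x := D * S one1 one2 x + k ^+ 2 * S X Y x.
pose B x := (k * v) * S X one2 x + (k * u) * S one1 Y x.
have mA : measurable_fun setT A.
  by apply: measurable_funD; apply: measurable_funM => //; exact: mS.
have mB : measurable_fun setT B.
  by apply: measurable_funD; apply: measurable_funM => //; exact: mS.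
have A0 x : 0 <= A x by do ?[exact: S0|exact: sqr_ge0|by []|apply: addr_ge0|apply: mulr_ge0].
have B0 x : 0 <= B x by do ?[exact: S0|exact: sqr_ge0|by []|apply: addr_ge0|apply: mulr_ge0].
have IA : (\int[lebesgue_param R m1 m2 K]_x (A x)%:E <= (D * 1 + k ^+ 2 * 1)%:E)%E.
  by apply: ge0_integral_lin_le => //; do ?[exact: mS|exact: sqr_ge0|move=> t; exact: S0].
have IB : (\int[lebesgue_param R m1 m2 K]_x (B x)%:E <= (k * v * 1 + k * u * 1)%:E)%E.
  by apply: ge0_integral_lin_le => //; do ?[exact: mS|exact: mulr_ge0|move=> t; exact: S0].
have := @ge0_integral_lin_le _ _ R (lebesgue_param R m1 m2 K) A B W W _ _
  mA mB A0 B0 W0 W0 IA IB.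
rewrite (_ : W * _ + W * _ = W ^+ 2); last by rewrite /W; ring.
apply: le_trans; apply: ge0_le_integral => //.
- by move=> x _; rewrite lee_fin mulr_ge0 ?sqr_ge0.
- by apply/measurable_EFinP/measurable_funM => //; exact: measurable_frob_sqr.
- by apply/measurable_EFinP; apply: measurable_funD; exact: measurable_funM.
move=> x _; rewrite lee_fin.
have := frob_sqr_factors_le (Upart x) U0 (Vpart x) V0 M k0.
lazy zeta; rewrite !frob_mx_sqdist -/D -/u -/v -/W -/(X x.1.1) -/(Y x.1.2) => hx.
apply: le_trans (ler_wpM2r (q0 x) hx) _.
by rewrite le_eqVlt; apply/orP; left; apply/eqP; rewrite /A /B /S /one1 /one2; ring.
Qed.

End comparison_loss_bound.

(** * Logarithm of the comparison constant and choice of the scales *)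

Lemma ln_prod (R : realType) (I : Type) (s : seq I) (P : pred I) (F : I -> R) :
  (forall i, P i -> 0 < F i) ->
  ln (\prod_(i <- s | P i) F i) = \sum_(i <- s | P i) ln (F i).
Proof.
move=> F0; suff [] : 0 < \prod_(i <- s | P i) F i /\
    ln (\prod_(i <- s | P i) F i) = \sum_(i <- s | P i) ln (F i) by [].
elim/big_ind2 : _ => [|x y u v [x0 <-] [u0 <-]|i Pi]; first by rewrite ln1.
  by rewrite mulr_gt0// lnM ?posrE.
by rewrite F0.
Qed.

Lemma log_inv_gt0 (R : realType) (y : R) : 0 < y -> log_inv y = (- ln y)%:E.
Proof.
by move=> y0; rewrite /log_inv inver gt_eqF// lne_EFin ?invr_gt0// lnV.
Qed.

Section factor_ratio_log.
Context (R : realType) (f ftilde : R -> R) (Cf : R).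
Context (df : is_density f) (pf : prior_f_assumption f ftilde Cf).

(** Integrate [Cf * ftilde <= f] over the open half-line, where it is assumed: both densities have
    mass 1. This fixes the sign of the logarithm attached to each box. *)
Lemma prior_f_const_le1 : Cf <= 1.
Proof.
case: pf => -[mt t0 it] _ Cf0 fle.
pose D : set R := `]0, +oo[%classic.
have sD : D `<=` `[0, +oo[%classic.
  by move=> x; rewrite /D/= !in_itv/= !andbT => /ltW.
have mf' : measurable_fun D (fun x => (f x)%:E).
  by case: df => mf _ _; apply/measurable_EFinP; exact: measurable_funS mf.
have mt' : measurable_fun D (fun x => (ftilde x)%:E).
  by apply/measurable_EFinP; exact: measurable_funS mt.
have hf : (\int[lebesgue_measure]_(x in D) (f x)%:E = 1)%E.
  by rewrite integral_itv_obnd_cbnd//; case: df.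
have ht : (\int[lebesgue_measure]_(x in D) (ftilde x)%:E = 1)%E.
  by rewrite integral_itv_obnd_cbnd.
have ft0 x : D x -> (0 <= (ftilde x)%:E)%E.
  by rewrite /D/= in_itv/= andbT lee_fin => /ltW/t0.
have f0 x : D x -> (0 <= (f x)%:E)%E.
  by rewrite /D/= in_itv/= andbT lee_fin => /ltW; case: df => _ + _; apply.
have : (\int[lebesgue_measure]_(x in D) (Cf%:E * (ftilde x)%:E) <=
        \int[lebesgue_measure]_(x in D) (f x)%:E)%E.
  apply: ge0_le_integral => //; first exact: measurable_itv.
  - by move=> x Dx; rewrite mule_ge0 ?ft0// lee_fin ltW.
  - by apply: emeasurable_funM => //; exact: measurable_cst.
  - move=> x; rewrite /D/= in_itv/= andbT => x0.
    by rewrite -EFinM lee_fin; exact: fle.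
rewrite ge0_integralZl//; last 2 first.
- exact: measurable_itv.
- by rewrite lee_fin ltW.
by rewrite hf ht mule1 lee_fin.
Qed.

Lemma ln_factor_ratio (K r : nat) (c : R) m (U0 : 'M[R]_(m, K)) : (r <= K)%N ->
  0 < c -> (forall i (l : 'I_K), (l < r)%N -> 0 < ftilde (U0 i l + 1)) ->
  ln (factor_ratio ftilde Cf r c U0) = m%:R * r%:R * ln (2 / (c * Cf)) +
    \sum_i \sum_(l < K | (l < r)%N) - ln (ftilde (U0 i l + 1)).
Proof.
move=> rK c0 fU0; case: pf => _ _ Cf0 _.
have cC0 : 0 < 2 / (c * Cf) by rewrite divr_gt0// mulr_gt0.
have F0 i (l : 'I_K) : (l < r)%N -> 0 < 2 / (c * Cf * ftilde (U0 i l + 1)).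
  by move=> lr; rewrite divr_gt0// !mulr_gt0// fU0.
rewrite /factor_ratio ln_prod; last by move=> i _; apply: prodr_gt0 => l; exact: F0.
rewrite (eq_bigr (fun i => r%:R * ln (2 / (c * Cf)) +
    \sum_(l < K | (l < r)%N) - ln (ftilde (U0 i l + 1)))); last first.
  move=> i _; rewrite ln_prod; last by move=> l lr; exact: F0.
  rewrite (eq_bigr (fun l : 'I_K => ln (2 / (c * Cf)) - ln (ftilde (U0 i l + 1)))).
    rewrite big_split/=; congr (_ + _).
    rewrite -(big_ord_widen K (fun=> ln (2 / (c * Cf))) rK).
    by rewrite sumr_const card_ord [RHS]mulr_natl.
  by move=> l lr; rewrite invfM mulrA lnM ?posrE ?invr_gt0 ?fU0// lnV// posrE fU0.
rewrite big_split/= sumr_const card_ord; congr (_ + _).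
by rewrite -mulrA [RHS]mulr_natl.
Qed.

End factor_ratio_log.

Section gamma_ratio_log.
Context (R : realType) (f h : R -> R) (alpha beta delta : R).
Context (dh : is_density h) (ph : prior_h_assumption f h alpha beta delta).

Lemma window_mass_ge_delta : delta <= window_mass h 1 2.
Proof. by case: ph => _ _ _ _; rewrite -(window_mass_fineE dh)// lee_fin. Qed.

Lemma window_mass_ge_alpha eps : 0 < eps <= (2 * Num.sqrt 2 * S_ f)^-1 ->
  alpha * eps `^ beta <= window_mass h 0 eps.
Proof. by case: ph => _ _ _ + _ he => /(_ _ he); rewrite -(window_mass_fineE dh)// lee_fin. Qed.

Lemma ln_gamma_ratio_le (K r : nat) (eps : R) : (r <= K)%N ->
  0 < eps <= (2 * Num.sqrt 2 * S_ f)^-1 -> eps <= 1 ->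
  ln (gamma_ratio h K r eps) <=
    r%:R * ln (1 / delta) + K%:R * (ln (1 / alpha) + beta * ln (eps^-1)).
Proof.
move=> rK he e1; have wa := window_mass_ge_alpha he.
have wd := window_mass_ge_delta; case/andP: he => e0 _.
case: ph => /andP[a0 a1] b0 d0 _ _.
have ap0 : 0 < alpha * eps `^ beta by rewrite mulr_gt0// powR_gt0.
have w10 : 0 < window_mass h 1 2 by exact: lt_le_trans wd.
have w00 : 0 < window_mass h 0 eps by exact: lt_le_trans wa.
(* Non-negativity of the cost of a null column, from [alpha < 1] and [eps <= 1], allows counting [K]
   of them instead of [K - r]. *)
have A0 : 0 <= ln (1 / alpha) + beta * ln (eps^-1).
  rewrite addr_ge0//; first by rewrite ln_ge0// div1r invf_ge1// ltW.
  by rewrite mulr_ge0// ln_ge0// invf_ge1.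
rewrite /gamma_ratio ln_prod; last by move=> l _; rewrite invr_gt0; case: ifP.
rewrite (bigID (fun l : 'I_K => (l < r)%N))/= lerD//.
  rewrite (eq_bigr (fun=> ln ((window_mass h 1 2)^-1))) => [|l ->//].
  rewrite -(big_ord_widen K (fun=> ln ((window_mass h 1 2)^-1)) rK).
  rewrite sumr_const card_ord -[leLHS]mulr_natl ler_wpM2l//.
  by rewrite ler_ln ?posrE ?divr_gt0 ?invr_gt0// div1r lef_pV2 ?posrE.
rewrite (eq_bigr (fun=> ln ((window_mass h 0 eps)^-1))) => [|l /negbTE ->//].
rewrite big_mkcond/= mulr_natl -[X in _ <= _ *+ X]card_ord -sumr_const.
apply: ler_sum => l _; case: ifP => // _.
apply: (@le_trans _ _ (ln ((alpha * eps `^ beta)^-1))).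
  by rewrite ler_ln ?posrE ?invr_gt0// lef_pV2 ?posrE.
rewrite lnV ?posrE// lnM ?posrE ?powR_gt0// ln_powR lnV ?posrE// div1r lnV ?posrE//.
by rewrite le_eqVlt; apply/orP; left; apply/eqP; ring.
Qed.

End gamma_ratio_log.

Section oracle_scales.
Context (R : realType) (f h ftilde : R -> R) (alpha beta delta Cf : R).
Context (df : is_density f) (dh : is_density h)
  (ph : prior_h_assumption f h alpha beta delta) (pf : prior_f_assumption f ftilde Cf).
Context (m1 m2 K r : nat) (r1 : (1 <= r)%N) (rK : (r <= K)%N) (K2 : (2 <= K)%N)
  (Km : (K <= minn m1 m2)%N).
Context (M : 'M[R]_(m1, m2)) (U0 : 'M[R]_(m1, K)) (V0 : 'M[R]_(m2, K)).

Let mm : R := (maxn m1 m2)%:R.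
Let k := Bconst M U0 V0 ^- 2.

(** The factor 2 compensates the one due to scales in [[1, 2]], so that [2 / (box_width * Cf)] is
    exactly [sqrt (2 mm r) * B^2 / Cf], the product of the arguments of the first two logarithms of
    the remainder. *)
Definition box_width : R := 2 * k / Num.sqrt (2 * mm * r%:R).
(** Its inverse is the product of the arguments of the two logarithms that carry [beta], and the
    square root, being at least [sqrt 2], puts it in the range where the small-ball condition on [h]
    holds. *)
Definition null_scale : R := k / (2 * S_ f * Num.sqrt (2 * K%:R * mm)).

Let mm2 : 2 <= mm.
Proof.
rewrite /mm ler_nat; apply: leq_trans (leq_trans K2 Km) _.
by rewrite geq_min !leq_max leqnn.
Qed.

Let S1 : 1 <= S_ f. Proof. by rewrite /S_ le_max lexx. Qed.

Let r1' : 1 <= r%:R :> R. Proof. by rewrite ler1n. Qed.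
Let K2' : 2 <= K%:R :> R. Proof. by rewrite ler_nat. Qed.

Lemma Bconst_ge1 : 1 <= Bconst M U0 V0.
Proof. by rewrite /Bconst -!addrA lerDl !addr_ge0 ?mulr_ge0 ?frob_ge0. Qed.

Lemma oracle_scale_gt0 : 0 < k.
Proof. by rewrite invr_gt0 exprn_gt0// (lt_le_trans ltr01) ?Bconst_ge1. Qed.

Lemma oracle_scale_le1 : k <= 1.
Proof.
rewrite invf_le1 ?exprn_ege1 ?Bconst_ge1// exprn_gt0//.
exact: lt_le_trans ltr01 Bconst_ge1.
Qed.

Let mm0 : 0 < mm. Proof. exact: lt_le_trans mm2. Qed.
Let K0' : 0 < K%:R :> R. Proof. exact: lt_le_trans K2'. Qed.
Let r0' : 0 < r%:R :> R. Proof. exact: lt_le_trans r1'. Qed.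
Let S0 : 0 < S_ f. Proof. exact: lt_le_trans S1. Qed.

(** From [K >= 2] one has [mm >= 2], so the radicand is at least 4; this is what makes the boxes no
    wider than 1. *)
Let box_sqrt_ge2 : 2 <= Num.sqrt (2 * mm * r%:R).
Proof.
rewrite -[leLHS]ger0_norm// -sqrtr_sqr ler_wsqrtr//.
by have := ler_pM (ler0n R 2) ler01 mm2 r1'; lra.
Qed.

Let null_sqrt_ge : Num.sqrt 2 <= Num.sqrt (2 * K%:R * mm).
Proof.
by rewrite ler_wsqrtr//; have := ler_pM (ler0n R 2) (ler0n R 2) K2' mm2; lra.
Qed.

Let box_sqrt_gt0 : 0 < Num.sqrt (2 * mm * r%:R).
Proof. exact: lt_le_trans box_sqrt_ge2. Qed.

Let null_sqrt_gt0 : 0 < Num.sqrt (2 * K%:R * mm).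
Proof. exact: lt_le_trans null_sqrt_ge. Qed.

Lemma box_width_gt0 : 0 < box_width.
Proof. by rewrite divr_gt0// mulr_gt0// oracle_scale_gt0. Qed.

Lemma box_width_le1 : box_width <= 1.
Proof.
rewrite ler_pdivrMr// mul1r; apply: le_trans box_sqrt_ge2.
by rewrite ler_piMr// oracle_scale_le1.
Qed.

Lemma null_scale_gt0 : 0 < null_scale.
Proof. by rewrite divr_gt0 ?oracle_scale_gt0// !mulr_gt0. Qed.

Lemma null_scale_le : null_scale <= (2 * Num.sqrt 2 * S_ f)^-1.
Proof.
rewrite -[leRHS]mul1r; apply: ler_pM.
- exact/ltW/oracle_scale_gt0.
- by rewrite invr_ge0 ltW// !mulr_gt0.
- exact: oracle_scale_le1.
rewrite lef_pV2; last 2 first.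
- by rewrite posrE !mulr_gt0.
- by rewrite posrE !mulr_gt0.
by rewrite -[leLHS]mulrA -[leRHS]mulrA ler_pM2l// mulrC ler_pM2l.
Qed.

Lemma null_scale_le1 : null_scale <= 1.
Proof.
apply: (le_trans null_scale_le); rewrite invf_le1 ?mulr_gt0 ?mulr_gt0//.
have h2 : 1 <= Num.sqrt 2 :> R by rewrite -[leLHS]sqrtr1 ler_wsqrtr// ler1n.
have := ler_pM ler01 ler01 h2 S1; rewrite mul1r -mulrA => h3.
by apply: (le_trans h3); rewrite ler_peMl// ?ler1n// ltW// mulr_gt0.
Qed.

Lemma factor_moment_le m : (m <= maxn m1 m2)%N ->
  factor_moment f K r box_width m null_scale <= k ^+ 2.
Proof.
move=> mmax; have hm : m%:R <= mm by rewrite ler_nat.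
rewrite /factor_moment.
have -> : box_width ^+ 2 = 4 * k ^+ 2 / (2 * mm * r%:R).
  by rewrite /box_width expr_div_n sqr_sqrtr ?mulr_ge0 ?ltW// exprMn; congr (_ * _ / _); ring.
have -> : null_scale ^+ 2 = k ^+ 2 / (4 * S_ f ^+ 2 * (2 * K%:R * mm)).
  rewrite /null_scale expr_div_n exprMn sqr_sqrtr ?mulr_ge0 ?ltW// exprMn.
  by congr (_ / (_ * _ * _)); ring.
have k20 : 0 <= k ^+ 2 by exact: sqr_ge0.
have hle : r%:R * (4 * k ^+ 2 / (2 * mm * r%:R) / 3) +
    K%:R * (k ^+ 2 / (4 * S_ f ^+ 2 * (2 * K%:R * mm)) * S_ f) <= k ^+ 2 / mm.
  (* The boxes account for [2/3] and the null columns for at most [1/8], since [S_ f >= 1]; the sum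
     is below 1. *)
  rewrite (_ : _ + _ = (2 / 3 + 8^-1 * (S_ f)^-1) * (k ^+ 2 / mm)); last first.
    by field; rewrite !gt_eqF.
  apply: ler_piMl; first by rewrite divr_ge0 ?(ltW mm0).
  have : (S_ f)^-1 <= 1 by rewrite invf_le1.
  lra.
apply: (@le_trans _ _ (m%:R * (k ^+ 2 / mm))); first by rewrite ler_wpM2l.
by rewrite mulrCA ler_piMr// ler_pdivrMr ?mul1r.
Qed.

Lemma ln_box_width : ln (2 / (box_width * Cf)) =
  ln (Num.sqrt (2 * mm * r%:R)) + ln (Bconst M U0 V0 ^+ 2 / Cf).
Proof.
case: pf => _ _ Cf0 _; have B0 : 0 < Bconst M U0 V0 by exact: lt_le_trans Bconst_ge1.
rewrite -lnM ?posrE ?divr_gt0 ?exprn_gt0//; congr ln; rewrite /box_width /k.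
by field; rewrite !gt_eqF.
Qed.

Lemma ln_null_scale : ln (null_scale^-1) =
  ln (Bconst M U0 V0 ^+ 2) + ln (2 * S_ f * Num.sqrt (2 * K%:R * mm)).
Proof.
have B0 : 0 < Bconst M U0 V0 by exact: lt_le_trans Bconst_ge1.
rewrite -lnM ?posrE ?exprn_gt0 ?mulr_gt0//; congr ln.
by rewrite /null_scale invf_div /k invrK mulrC.
Qed.

Let ln_box_ge0 : 0 <= ln (2 / (box_width * Cf)).
Proof.
case: (pf) => _ _ Cf0 _.
have cC : 0 < box_width * Cf by rewrite mulr_gt0// box_width_gt0.
apply: ln_ge0; rewrite ler_pdivlMr// mul1r.
apply: (@le_trans _ _ 1); last by rewrite ler1n.
by rewrite mulr_ile1 ?box_width_le1 ?(prior_f_const_le1 df pf)// ltW// box_width_gt0.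
Qed.

Lemma ln_comparison_ratio_le :
  (forall i (l : 'I_K), (l < r)%N -> 0 < ftilde (U0 i l + 1)) ->
  (forall i (l : 'I_K), (l < r)%N -> 0 < ftilde (V0 i l + 1)) ->
  ((4 * ln (comparison_ratio h ftilde Cf r box_width null_scale U0 V0) + 1)%:E <=
   remainder f ftilde alpha beta delta Cf M r U0 V0)%E.
Proof.
move=> fU0 fV0; have c0 := box_width_gt0; have e0 := null_scale_gt0.
have he : 0 < null_scale <= (2 * Num.sqrt 2 * S_ f)^-1 by rewrite e0 null_scale_le.
have sumE m (A : 'M[R]_(m, K)) : (forall i (l : 'I_K), (l < r)%N -> 0 < ftilde (A i l + 1)) ->
    (\sum_i \sum_(l < K | (l < r)%N) log_inv (ftilde (A i l + 1)) =
     (\sum_i \sum_(l < K | (l < r)%N) - ln (ftilde (A i l + 1)))%:E)%E.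
  move=> fA; rewrite -sumEFin; apply: eq_bigr => i _; rewrite -sumEFin.
  by apply: eq_bigr => l lr; rewrite log_inv_gt0// fA.
have G0 : 0 < gamma_ratio h K r null_scale.
  have wa := window_mass_ge_alpha dh ph he.
  have wd := window_mass_ge_delta dh ph; case: (ph) => /andP[a0 _] _ d0 _ _.
  apply: prodr_gt0 => l _; rewrite invr_gt0; case: ifP => _; first exact: lt_le_trans wd.
  by apply: lt_le_trans wa; rewrite mulr_gt0// powR_gt0.
rewrite /remainder (sumE _ _ fU0) (sumE _ _ fV0) -!EFinM -!EFinD lee_fin.
have FU0 := factor_ratio_gt0 pf c0 fU0.
have FV0 := factor_ratio_gt0 pf c0 fV0.
rewrite /comparison_ratio.
rewrite lnM; [rewrite lnM ?posrE//|by rewrite posrE mulr_gt0|by rewrite posrE].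
rewrite (ln_factor_ratio pf rK c0 fU0) (ln_factor_ratio pf rK c0 fV0).
have hG := ln_gamma_ratio_le dh ph rK he null_scale_le1.
have ln4 : 0 <= ln 4 :> R by rewrite ln_ge0// ler1n.
move: hG ln_box_ge0; rewrite ln_null_scale ln_box_width.
rewrite -/mm; set L1 := ln (Num.sqrt _); set L2 := ln (_ / Cf).
set b1 := ln (Bconst _ _ _ ^+ 2); set b2 := ln (2 * _ * _).
set la := ln (1 / alpha); set ld := ln (1 / delta); set lg := ln (gamma_ratio _ _ _ _).
set sU := \sum_i _; set sV := \sum_i _ => hG L0.
have hm1 : m1%:R <= mm by rewrite ler_nat leq_maxl.
have hm2 : m2%:R <= mm by rewrite ler_nat leq_maxr.
(* With this sign [m1 + m2] may be replaced by [2 mm], which turns the factor 4 into the 8 of the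
   remainder. *)
have rL : 0 <= r%:R * (L1 + L2) by rewrite mulr_ge0.
have h1 := ler_wpM2r rL hm1; have h2 := ler_wpM2r rL hm2.
rewrite -!mulrA in h1 h2 *.
lra.
Qed.

End oracle_scales.

(** * Quasi-posterior mean *)

(** The index set is pushed forward by [e] and the family of events extended along its left inverse
    [e']. *)
Lemma mutually_independent_reindex d (T : measurableType d) (R : realType)
    (P : probability T R) (I I' : finType) (X : I -> {RV P >-> R})
    (e : I' -> I) (e' : I -> I') : cancel e e' ->
  mutually_independent X -> mutually_independent (fun k => X (e k)).
Proof.
move=> eK indep J A mA.
have := indep (e @: J)%SET (fun i => A (e' i)) (fun i => mA _).
rewrite big_imset/=; last by move=> i j _ _; exact: (can_inj eK).
rewrite (eq_bigr (fun k => P (X (e k) @^-1` A k))); last by move=> k _; rewrite eK.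
move=> <-; congr (P _); apply/seteqP; split => w hw.
  by move=> i /= /imsetP[k kJ ->]; rewrite eK; exact: hw.
by move=> k kJ; have := hw (e k); rewrite /= eK; apply; exact: imset_f.
Qed.

Section flatten.
Context (R : realType) (m1 m2 : nat).

(** A cardinal, not [m1 * m2], so that [enum_val] directly numbers the entries. *)
Definition mx_size := #|{: 'I_m1 * 'I_m2}|.
Definition flat_entry (A : 'M[R]_(m1, m2)) (k : 'I_mx_size) : R :=
  A (enum_val k).1 (enum_val k).2.

Lemma sum_flat (F : 'I_m1 -> 'I_m2 -> R) :
  \sum_(k < mx_size) F (enum_val k).1 (enum_val k).2 = \sum_i \sum_j F i j.
Proof.
rewrite pair_bigA/= (reindex (@enum_val _ (mem {: 'I_m1 * 'I_m2})))//.
by exists enum_rank => k _; [exact: enum_valK|exact: enum_rankK].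
Qed.

Lemma frob_sqr_flat (A : 'M[R]_(m1, m2)) :
  frob A ^+ 2 = \sum_k flat_entry A k ^+ 2.
Proof. by rewrite frob_sqr -sum_flat. Qed.

End flatten.

Section quasi_posterior_mean.
Context (R : realType) (f h : R -> R) (df : is_density f) (dh : is_density h).
Context (m1 m2 K : nat) (M : 'M[R]_(m1, m2)).
Local Notation mu := (sf_lebesgue_param R m1 m2 K).
Local Notation p := (@prior_product R f h m1 m2 K).

Definition centered_entry (k : 'I_(mx_size m1 m2)) (x : param R m1 m2 K) : R :=
  flat_entry (Upart x *m (Vpart x)^T - M) k.

Lemma centered_entryE k x : centered_entry k x =
  (Upart x *m (Vpart x)^T) (enum_val k).1 (enum_val k).2 - flat_entry M k.
Proof. by rewrite /centered_entry /flat_entry [LHS]mxE [X in _ + X]mxE. Qed.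

Lemma measurable_centered_entry k : measurable_fun setT (centered_entry k).
Proof.
rewrite (funext (centered_entryE k)).
by apply: measurable_funB => //; exact: measurable_product_entry.
Qed.

Lemma integrable_prior_product : mu.-integrable setT (fun x => (p x)%:E).
Proof.
apply/integrableP; split; first (apply/measurable_EFinP; exact: measurable_prior_product).
under eq_integral do rewrite gee0_abs ?lee_fin ?(prior_product_ge0 df dh)//.
by rewrite (le_lt_trans (integral_prior_product_le1 df dh m1 m2 K))// ltry.
Qed.

Variables (A : 'M[R]_(m1, m2)) (y : (mx_size m1 m2).-tuple R).
Hypothesis yA : forall k, tnth y k = flat_entry A k.

(** Subtracting [M] from both the observation and [U V^T] leaves the residual [Y - U V^T] unchanged,
    and outside the non-negative parameters the extended prior is 0. *)
Lemma ew_weight_prior x : ew_weight centered_entry p y x =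
  if x \in (@nonneg_param R m1 m2 K) then quasi_weight f h (1 / 4) (M + A) x else 0.
Proof.
rewrite /ew_weight; case: ifPn => [/set_mem nx|/negP nx]; last first.
  by rewrite prior_product_eq0 ?mulr0// => nx'; apply: nx; exact: mem_set.
rewrite /quasi_weight prior_productE//; congr (expR _ * _).
rewrite frob_sqr_flat /sqdist.
rewrite (eq_bigr (fun k => flat_entry (M + A - Upart x *m (Vpart x)^T) k ^+ 2)).
  by field.
by move=> k _; rewrite yA /centered_entry /flat_entry !mxE; congr (_ ^+ 2); ring.
Qed.

Lemma Rintegral_quasi_weight (g : param R m1 m2 K -> R) :
  \int[lebesgue_param R m1 m2 K]_(x in @nonneg_param R m1 m2 K)
     (g x * quasi_weight f h (1 / 4) (M + A) x) =
  \int[mu]_x (g x * ew_weight centered_entry p y x).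
Proof.
rewrite /Rintegral integral_mkcond; congr fine; apply: eq_integral => x _.
by rewrite patchE ew_weight_prior; case: ifPn => // _; rewrite mulr0.
Qed.

(** The weights divided by [Z] have total mass 1, so centering commutes with averaging; a positive
    [Z] is needed for this normalisation. *)
Lemma Mhat_sub_flat k : 0 < ew_total mu centered_entry p y ->
  flat_entry (Mhat f h K (1 / 4) (M + A) - M) k =
  ew_mean mu centered_entry p k y.
Proof.
move=> Z0; set Z := ew_total _ _ _ _ in Z0.
have ZE : partition_function f h K (1 / 4) (M + A) = Z.
  rewrite /partition_function /Z /ew_total.
  transitivity (\int[lebesgue_param R m1 m2 K]_(x in @nonneg_param R m1 m2 K)
     (1 * quasi_weight f h (1 / 4) (M + A) x)).
    by apply: eq_Rintegral => x _; rewrite [RHS]mul1r.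
  by rewrite Rintegral_quasi_weight; apply: eq_Rintegral => x _; rewrite mul1r.
pose m := flat_entry M k; pose w := ew_weight centered_entry p y.
have iw : mu.-integrable setT (fun x => (w x)%:E).
  apply: integrable_ew_weight => //; first exact: measurable_centered_entry.
  - exact: (prior_product_ge0 df dh).
  - exact: integrable_prior_product.
have i1 : mu.-integrable setT (fun x => (centered_entry k x * w x)%:E).
  exact: (integrable_ew_moment measurable_centered_entry
    (@prior_product_ge0 R f h df dh m1 m2 K) integrable_prior_product k 1 y).
rewrite {1}/flat_entry [LHS]mxE [X in _ + X]mxE -/(flat_entry M k) -/m.
rewrite /Mhat mxE.
transitivity (\int[lebesgue_param R m1 m2 K]_(x in @nonneg_param R m1 m2 K)
  (((Upart x *m (Vpart x)^T) (enum_val k).1 (enum_val k).2 * Z^-1) *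
   quasi_weight f h (1 / 4) (M + A) x) - m).
  by congr (_ - _); apply: eq_Rintegral => x _; rewrite /quasi_posterior ZE mulrA.
rewrite Rintegral_quasi_weight.
(* Each entry of the product is split as its centered value plus [m]; the second part integrates to
   [m]. *)
transitivity (\int[mu]_x (Z^-1 * (centered_entry k x * w x) + (m / Z) * w x) - m).
  congr (_ - _); apply: eq_Rintegral => x _.
  rewrite centered_entryE -/m -/(w x); move: (w x) => wx.
  by set a := (_ *m _) _ _; ring.
rewrite Rintegral_lin2// -/Z.
have -> : \int[mu]_x w x = Z by [].
rewrite /ew_mean /ew_moment -/Z; under [in RHS]eq_Rintegral do rewrite expr1.
by rewrite divfK ?gt_eqF// addrK mulrC.
Qed.

End quasi_posterior_mean.

Lemma log_inv_gt_ninfty (R : realType) (y : R) : 0 <= y -> (log_inv y != -oo)%E.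
Proof.
rewrite le_eqVlt => /predU1P[<-|y0]; last by rewrite log_inv_gt0.
by rewrite /log_inv inver eqxx.
Qed.

Lemma sum_log_inv_eqy (R : realType) (K r m : nat) (ftilde : R -> R) (A : 'M[R]_(m, K)) :
  nonneg_mx A -> (forall x, 0 <= x -> 0 <= ftilde x) ->
  (exists i (l : 'I_K), (l < r)%N /\ ftilde (A i l + 1) = 0) ->
  (\sum_(i < m) \sum_(l < K | (l < r)%N) log_inv (ftilde (A i l + 1)%R) = +oo)%E.
Proof.
move=> A0 ft0 [i [l [lr ftA]]].
have fin j (l' : 'I_K) : log_inv (ftilde (A j l' + 1)) != -oo%E.
  by apply/log_inv_gt_ninfty/ft0; rewrite addr_ge0.
apply/esum_eqyP => /=.
  move=> j _; apply/eqP => /esum_eqNyP[l' [_ _ /eqP]]; exact/negP.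
exists i; split; [exact: mem_index_enum|by []|].
apply/esum_eqyP => [l' _|]; first exact: fin.
by exists l; split; rewrite ?mem_index_enum// ftA /log_inv inver eqxx.
Qed.

Lemma sum_log_inv_gt_ninfty (R : realType) (K r m : nat) (ftilde : R -> R) (A : 'M[R]_(m, K)) :
  nonneg_mx A -> (forall x, 0 <= x -> 0 <= ftilde x) ->
  (\sum_(i < m) \sum_(l < K | (l < r)%N) log_inv (ftilde (A i l + 1)%R) != -oo)%E.
Proof.
move=> A0 ft0; apply/eqP => /esum_eqNyP[i [_ _ /esum_eqNyP[l [_ _ /eqP]]]].
by apply/negP/log_inv_gt_ninfty/ft0; rewrite addr_ge0.
Qed.

(** In extended addition a [-oo] term would absorb [+oo]. Non-negativity of [ftilde] rules it out in
    both sums, so a single infinite logarithm decides the total. *)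
Lemma remainder_eqy (R : realType) (f ftilde : R -> R) (alpha beta delta Cf : R)
    (m1 m2 K r : nat) (M : 'M[R]_(m1, m2)) (U0 : 'M[R]_(m1, K)) (V0 : 'M[R]_(m2, K)) :
  nonneg_mx U0 -> nonneg_mx V0 -> (forall x, 0 <= x -> 0 <= ftilde x) ->
  (exists i (l : 'I_K), (l < r)%N /\ ftilde (U0 i l + 1) = 0) \/
  (exists j (l : 'I_K), (l < r)%N /\ ftilde (V0 j l + 1) = 0) ->
  remainder f ftilde alpha beta delta Cf M r U0 V0 = +oo%E.
Proof.
move=> U00 V00 ft0 H; rewrite /remainder.
have := sum_log_inv_gt_ninfty r U00 ft0; have := sum_log_inv_gt_ninfty r V00 ft0.
have : (\sum_(i < m1) \sum_(l < K | (l < r)%N) log_inv (ftilde (U0 i l + 1)%R) = +oo)%E \/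
    (\sum_(i < m2) \sum_(l < K | (l < r)%N) log_inv (ftilde (V0 i l + 1)%R) = +oo)%E.
  by case: H => H; [left|right]; exact: sum_log_inv_eqy.
set sU := (\sum_i _)%E; set sV := (\sum_i _)%E.
have y4 : (4%:E * +oo = +oo :> \bar R)%E by rewrite mulry gtr0_sg// mul1e.
by move=> [->|->]; [case: sV|case: sU] => // *; rewrite ?y4.
Qed.

(** * The risk bound for one fixed pair of factors, then the infimum *)

Section oracle_inequality.
Context d (T : measurableType d) (R : realType) (P : probability T R).
Context (m1 m2 K : nat) (M : 'M[R]_(m1, m2)) (E : 'I_m1 -> 'I_m2 -> {RV P >-> R}).
Context (f h ftilde : R -> R) (alpha beta delta Cf : R).
Context (K2 : (2 <= K)%N) (Km : (K <= minn m1 m2)%N) (noiseE : noise_assumption E).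
Context (df : is_density f) (f2 : (second_moment f < +oo)%E) (dh : is_density h).
Context (ph : prior_h_assumption f h alpha beta delta)
  (pf : prior_f_assumption f ftilde Cf).
Context (r : nat) (r1 : (1 <= r)%N) (rK : (r <= K)%N).
Context (U0 : 'M[R]_(m1, K)) (V0 : 'M[R]_(m2, K)) (UV0 : nonneg_factors r (U0, V0)).
Context (fU0 : forall i (l : 'I_K), (l < r)%N -> 0 < ftilde (U0 i l + 1))
  (fV0 : forall i (l : 'I_K), (l < r)%N -> 0 < ftilde (V0 i l + 1)).

Local Notation n := (mx_size m1 m2).
Local Notation mu := (sf_lebesgue_param R m1 m2 K).
Local Notation p := (@prior_product R f h m1 m2 K).
Local Notation zeta := (@centered_entry R m1 m2 K M).
Local Notation c := (box_width r M U0 V0).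
Local Notation eps := (null_scale f M U0 V0).
Local Notation q := (comparison_density f h r c eps U0 V0).
Local Notation C := (comparison_ratio h ftilde Cf r c eps U0 V0).
Local Notation D := (frob (U0 *m V0^T - M)).

Let N (k : 'I_n) : {RV P >-> R} := E (enum_val k).1 (enum_val k).2.

Let eps_bounds : 0 < eps <= (2 * Num.sqrt 2 * S_ f)^-1.
Proof. by rewrite null_scale_gt0// null_scale_le. Qed.

Let c0 : 0 < c. Proof. exact: box_width_gt0. Qed.

Let H1 : 0 < window_mass h 1 2.
Proof.
by case: (ph) => _ _ d0 _ _; apply: lt_le_trans (window_mass_ge_delta dh ph).
Qed.

Let H0 : 0 < window_mass h 0 eps.
Proof.
case: (ph) => /andP[a0 _] _ _ _ _; apply: lt_le_trans (window_mass_ge_alpha dh ph eps_bounds).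
by rewrite mulr_gt0// powR_gt0//; case/andP: eps_bounds.
Qed.

Let mq : measurable_fun setT q. Proof. exact: measurable_comparison_density. Qed.
Let q0 x : 0 <= q x. Proof. exact: comparison_density_ge0. Qed.

Let C0 : 0 < C. Proof. exact: (comparison_ratio_gt0 pf c0 H1 H0 fU0 fV0). Qed.

Let q1 : (\int[mu]_x (q x)%:E = 1)%E.
Proof. exact: (integral_comparison_density df dh r c0 H1 H0 U0 V0). Qed.

Let qCp x : q x <= C * p x.
Proof.
exact: (comparison_density_le df dh pf c0 (box_width_le1 r1 K2 Km M U0 V0) H1 H0 UV0 fU0 fV0).
Qed.

Let integral_frob_sqr : (\int[mu]_x (frob (Upart x *m (Vpart x)^T - M) ^+ 2 * q x)%:E <=
  (D ^+ 2 + 1)%:E)%E.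
Proof.
have k0 := oracle_scale_gt0 M U0 V0.
have mom m : (m <= maxn m1 m2)%N -> factor_moment f K r c m eps <= (Bconst M U0 V0 ^- 2) ^+ 2.
  exact: factor_moment_le.
have L := integral_comparison_loss df f2 dh rK c0 H1 H0 UV0 M k0
  (mom _ (leq_maxl _ _)) (mom _ (leq_maxr _ _)).
apply: (le_trans L).
by rewrite lee_fin; exact: oracle_weight_le (frob_ge0 _) (frob_ge0 _) (frob_ge0 _).
Qed.

Let integrable_frob_sqr :
  mu.-integrable setT (fun x => (frob (Upart x *m (Vpart x)^T - M) ^+ 2 * q x)%:E).
Proof.
apply/integrableP; split.
  by apply/measurable_EFinP/measurable_funM => //; exact: measurable_frob_sqr.
have pos x : (0 <= (frob (Upart x *m (Vpart x)^T - M) ^+ 2 * q x)%:E)%E.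
  by rewrite lee_fin; apply: mulr_ge0 => //; exact: sqr_ge0.
under eq_integral do rewrite (gee0_abs (pos _)).
by rewrite (le_lt_trans integral_frob_sqr)// ltry.
Qed.

Let frob_sqrE x : frob (Upart x *m (Vpart x)^T - M) ^+ 2 = \sum_k zeta k x ^+ 2.
Proof. by rewrite frob_sqr_flat. Qed.

Let integrable_zeta k : mu.-integrable setT (fun x => (zeta k x ^+ 2 * q x)%:E).
Proof.
apply: (le_integrable measurableT) integrable_frob_sqr.
  apply/measurable_EFinP/measurable_funM => //; apply: measurable_funX.
  exact: measurable_centered_entry.
move=> x _; have z0 : 0 <= zeta k x ^+ 2 * q x by apply: mulr_ge0 => //; exact: sqr_ge0.
have F0 : 0 <= frob (Upart x *m (Vpart x)^T - M) ^+ 2 * q x.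
  by apply: mulr_ge0 => //; exact: sqr_ge0.
rewrite /= lee_fin (ger0_norm z0) (ger0_norm F0); apply: ler_wpM2r => //.
by rewrite frob_sqrE (bigD1 k)//= lerDl; apply: sumr_ge0 => *; exact: sqr_ge0.
Qed.

Let sum_integral_zeta : \sum_k \int[mu]_x (zeta k x ^+ 2 * q x) <= D ^+ 2 + 1.
Proof.
rewrite -Rintegral_sum// -lee_fin Rintegral_fineE; last exact: integrable_sum_real.
apply: le_trans integral_frob_sqr; rewrite le_eqVlt; apply/orP; left; apply/eqP.
by apply: eq_integral => x _; rewrite frob_sqrE mulr_suml.
Qed.

Let loss_flat w :
  frob (Mhat f h K (1 / 4) (M + \matrix_(i, j) E i j w) - M) ^+ 2 =
  \sum_k ew_mean mu zeta p k (noise_tuple N w) ^+ 2.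
Proof.
rewrite frob_sqr_flat; apply: eq_bigr => k _; congr (_ ^+ 2).
apply: Mhat_sub_flat => //.
  by move=> l; rewrite tnth_mktuple /flat_entry mxE.
exact: (ew_total_gt0 (measurable_centered_entry M) (@prior_product_ge0 R f h df dh m1 m2 K)
  (integrable_prior_product df dh m1 m2 K) C0 mq q0 q1 qCp integrable_zeta).
Qed.

Lemma oracle_inequality_factors :
  ('E_P[fun w => (frob
     (Mhat f h K (1 / 4) (M + \matrix_(i, j) E i j w) - M) ^+ 2)%R] <=
   (D ^+ 2)%:E + remainder f ftilde alpha beta delta Cf M r U0 V0)%E.
Proof.
case: noiseE => indepE _ meanE [g [mg g01 gE]].
have intN k : P.-integrable setT (EFin \o N k) by case: (meanE (enum_val k).1 (enum_val k).2).
have EN0 k : ('E_P[N k] = 0)%E by case: (meanE (enum_val k).1 (enum_val k).2).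
rewrite unlock; under eq_integral do rewrite loss_flat.
apply: le_trans (_ : ((4 * ln C + \sum_k \int[mu]_x (zeta k x ^+ 2 * q x))%:E <= _)%E).
  apply: ew_risk_bound => //.
  - exact: measurable_centered_entry.
  - exact: (@prior_product_ge0 R f h df dh m1 m2 K).
  - exact: measurable_prior_product.
  - exact: integral_prior_product_le1.
  - exact: (mutually_independent_reindex (X := fun ij => E ij.1 ij.2)
      (@enum_valK ('I_m1 * 'I_m2)%type) indepE).
  - move=> k psi dpsi *; exact: (stein_le (intN k) (EN0 k) mg g01 (gE _ _)).
  - by move=> k; rewrite -(EN0 k) unlock.
  - by move=> k; exact: (integral_noise_sqr_le1 (intN k) (EN0 k) mg g01 (gE _ _)).
apply: le_trans (_ : ((D ^+ 2)%:E + (4 * ln C + 1)%:E <= _)%E).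
  by rewrite -EFinD lee_fin addrCA lerD2l.
by rewrite leeD2l// ln_comparison_ratio_le.
Qed.

End oracle_inequality.

Theorem theorem1 (R : realType) (d : measure_display) (T : measurableType d)
    (P : probability T R) (m1 m2 K : nat) (M : 'M[R]_(m1, m2))
    (E : 'I_m1 -> 'I_m2 -> {RV P >-> R})
    (f h ftilde : R -> R) (alpha beta delta Cf : R) :
  (2 <= K)%N -> (K <= minn m1 m2)%N ->
  nonneg_mx M ->
  noise_assumption E ->
  is_density f -> (second_moment f < +oo)%E ->
  is_density h ->
  prior_h_assumption f h alpha beta delta ->
  prior_f_assumption f ftilde Cf ->
  ('E_P[fun w => (frob
     (Mhat f h K (1 / 4) (M + \matrix_(i, j) E i j w) - M) ^+ 2)%R] <=
   ereal_inf [set ereal_inf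
     [set (frob (UV.1 *m UV.2^T - M) ^+ 2)%:E +
          remainder f ftilde alpha beta delta Cf M r UV.1 UV.2
     | UV in @nonneg_factors R m1 m2 K r] | r in [set r | (1 <= r <= K)%N]])%E.
Proof.
move=> K2 Km _ noiseE df f2 dh ph pf.
apply: le_ereal_inf_tmp => _ [r /andP[r1 rK] <-].
apply: le_ereal_inf_tmp => _ [[U0 V0] UV0 <-] /=.
case: (UV0) => /= U00 V00 _ _.
have ft0 x : 0 <= x -> 0 <= ftilde x by case: pf => -[_ + _] _ _ _; apply.
have [fU0|] := pselect (forall i (l : 'I_K), (l < r)%N -> ftilde (U0 i l + 1) != 0); last first.
  move=> /existsNP[i /existsNP[l /not_implyP[lr /negP]]]; rewrite negbK => /eqP fA.
  by rewrite (remainder_eqy _ _ _ _ _ _ U00 V00 ft0) ?addey ?leey//; left; exists i, l.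
have [fV0|] := pselect (forall i (l : 'I_K), (l < r)%N -> ftilde (V0 i l + 1) != 0); last first.
  move=> /existsNP[i /existsNP[l /not_implyP[lr /negP]]]; rewrite negbK => /eqP fA.
  by rewrite (remainder_eqy _ _ _ _ _ _ U00 V00 ft0) ?addey ?leey//; right; exists i, l.
apply: oracle_inequality_factors => // i l lr.
- by rewrite lt_neqAle eq_sym fU0// ft0// addr_ge0.
- by rewrite lt_neqAle eq_sym fV0// ft0// addr_ge0.
Qed.
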